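(* Let $D,n_0\in\mathbb{N}$, let $0<L_{min}\le L_{max}$, and let $\mathcal{Q}\in\mathfrak{Q}'_{D,n_0,L_{min},L_{max}}$ be a finite open quantum graph (unbalanced, with data bounded by $D,n_0,L_{min},L_{max}$). Set $Y(D,n_0,L_{min})=-\frac{\ln(D+n_0)}{L_{min}}$. Let $y_1\le Y(D,n_0,L_{min})$, let $y_2\ge 0$, and let $\varepsilon>0$. Then for every function $g$ that is holomorphic on the strip $\Omega_{y_1-\varepsilon,y_2+\varepsilon}=\{z\in\mathbb{C}:\ y_1-\varepsilon<\operatorname{Im}z<y_2+\varepsilon\}$ and belongs to $L^1(\Omega_{y_1-\varepsilon,y_2+\varepsilon})$, we have $$2i\pi\sum_{z\in\mathrm{Res}(\mathcal{Q})}g(z)=-\sum_{j=1,2}\int_{\mathbb{R}}g(x+iy_j)\,\mathrm{Tr}\left[U'_{\mathcal{Q}}(x+iy_j)\left(\mathrm{Id}-U_{\mathcal{Q}}(x+iy_j)\right)^{-1}\right]\mathrm{d}x,$$ where each resonance in the sum on the left-hand side is repeated according to its multiplicity.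
   Context: A quantum graph $\mathcal{Q}=(V,E,L,\mathbf{n})$ consists of a graph $(V,E)$ with vertex set $V$ and edge set $E$, a map $L:E\to(0,\infty)$ (edge lengths), and a map $\mathbf{n}:V\to\mathbb{N}\cup\{0\}$ (number of semi-infinite edges, or leads, attached to each vertex). It is finite if $(V,E)$ is finite. The (internal) degree $d(v)$ is the number of $e\in E$ to which $v$ belongs. $\mathfrak{Q}_{D,n_0,L_{min},L_{max}}$ is the set of quantum graphs with $d(v)\le D$ and $\mathbf{n}(v)\le n_0$ for all $v\in V$, and $L_{min}\le L(e)\le L_{max}$ for all $e\in E$. $\mathfrak{Q}'_{D,n_0,L_{min},L_{max}}$ is the subset of those that are unbalanced: $\mathbf{n}(v)\ne d(v)$ for all $v\in V$. $B=B(\mathcal{Q})$ is the set of oriented internal edges (bonds), two for each $e\in E$. For $b\in B$, $\hat b$ is the reversed bond, $o_b$ its origin, and $L_b$ the length of the underlying edge. For $b,b'\in B$ put $\sigma_{b,b'}=\frac{2}{\mathbf{n}(v)+d(v)}$ if $o_b=o_{b'}=v$ and $b\ne b'$; $\sigma_{b,b'}=\frac{2}{\mathbf{n}(v)+d(v)}-1$ if $b=b'$ with $o_b=v$; and $\sigma_{b,b'}=0$ if $o_b\ne o_{b'}$. For $z\in\mathbb{C}$ define the $B\times B$ matrices $D_{\mathcal{Q}}(z)_{b,b'}=\delta_{b,b'}e^{izL_b}$, $(S_{\mathcal{Q}})_{b,b'}=\sigma_{b,\hat{b'}}$, and $U_{\mathcal{Q}}(z)=S_{\mathcal{Q}}D_{\mathcal{Q}}(z)$;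 $U'_{\mathcal{Q}}$ is the derivative in $z$, and $\mathrm{Id}$ is the $B\times B$ identity matrix. Resonances: let $B_{ext}$ be the set of leads (the $\mathbf{n}(v)$ leads at $v$ having origin $v$) and $\hat B=B\cup B_{ext}$. A number $z\in\mathbb{C}$ is a scattering resonance of a finite $\mathcal{Q}$ if there is a nonzero family $f=(f_b)_{b\in\hat B}$ with $f_b\in C^2([0,L_b])$ for $b\in B$, $f_b\in C^2([0,\infty))$ for $b\in B_{ext}$, $f_b(\cdot)=f_{\hat b}(L_b-\cdot)$ for $b\in B$, such that: (continuity) $f_b(0)=f_{b'}(0)$ whenever $o_b=o_{b'}$; (current conservation) $\sum_{b\in\hat B:\,o_b=v}f_b'(0)=0$ for all $v\in V$; $-f_b''=z^2f_b$ for all $b\in\hat B$; and $f_b(x)=f_b(0)e^{izx}$ for all $b\in B_{ext}$. $\mathrm{Res}(\mathcal{Q})$ is the set of resonances. A number $z\neq0$ is a resonance if and only if $\det(\mathrm{Id}-U_{\mathcal{Q}}(z))=0$. The multiplicity of a resonance $z_0$ is by convention (including for $z_0=0$) the order of $z_0$ as a zero of the holomorphic function $z\mapsto\det(\mathrm{Id}-U_{\mathcal{Q}}(z))$.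
   Formalization: The right side is minus (the integral on y_1 minus the integral on y_2), since the printed sum of both is false; and when y_1 = Y or y_2 = 0 it is assumed that Id - U is invertible along that line and the integrand is integrable there. *)

(* Defs.v *)
(* MathComp / MathComp-Analysis; the complex plane is R[i] for R : realType. *)
From HB Require Import structures.
From mathcomp Require Import all_boot all_order all_algebra.
From mathcomp Require Import complex.
From mathcomp Require Import all_classical all_reals all_analysis.

Set Implicit Arguments.
Unset Strict Implicit.
Unset Printing Implicit Defensive.

Import Order.TTheory GRing.Theory Num.Theory.
Import numFieldNormedType.Exports.

Local Open Scope classical_set_scope.
Local Open Scope ring_scope.
Local Open Scope complex_scope.

(* The carrier R[i] with its topology and its normed-module structure over
   itself, so that [derivable] and [derive1] are complex differentiation. *)
Definition Cplx (R : realType) := (R[i])^o.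

Section ComplexAnalysis.
Variable R : realType.
Implicit Types (z : R[i]) (F : R[i] -> R[i]).

Definition cexp z : R[i] :=
  (expR (complex.Re z))%:C * (cos (complex.Im z) +i* sin (complex.Im z)).

Definition holomorphic_on (A : set (Cplx R)) F :=
  forall z, A z -> derivable (F : Cplx R -> Cplx R) z 1.

Definition cderiv F z : R[i] := derive1 (F : Cplx R -> Cplx R) z.

(* z0 is a zero of order n (n = 0 when F z0 <> 0): locally,
   F = (z - z0)^n h with h holomorphic and h z0 <> 0. *)
Definition has_zero_order F z0 (n : nat) :=
  exists h : Cplx R -> Cplx R,
    [/\ \forall z \near (z0 : Cplx R), derivable h z 1,
        h z0 != 0
      & \forall z \near (z0 : Cplx R), F z = (z - z0) ^+ n * h z].

(* The default value 0 is only reached when the order does not exist, e.g. for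
   F vanishing identically near z0. *)
Definition zero_order F z0 : nat := xget 0%N [set n | has_zero_order F z0 n].

Definition strip (a b : R) : set (Cplx R) :=
  [set z | a < complex.Im z < b].

Definition L1_strip (a b : R) F :=
  let mu := (@lebesgue_measure R \x @lebesgue_measure R)%E in
  let A := [set p : R * R | strip a b (p.1 +i* p.2)] in
  mu.-integrable A (fun p => (complex.Re (F (p.1 +i* p.2)))%:E) /\
  mu.-integrable A (fun p => (complex.Im (F (p.1 +i* p.2)))%:E).

Definition cintegrable (f : R -> R[i]) :=
  (@lebesgue_measure R).-integrable setT (fun x => (complex.Re (f x))%:E) /\
  (@lebesgue_measure R).-integrable setT (fun x => (complex.Im (f x))%:E).

Definition cintegral (f : R -> R[i]) : R[i] :=
  (\int[@lebesgue_measure R]_x complex.Re (f x))%R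
  +i* (\int[@lebesgue_measure R]_x complex.Im (f x))%R.

(* Unordered sums over a possibly infinite set of complex numbers; in finite
   dimension unordered summability is absolute summability. *)
Definition csummable (A : set R[i]) F :=
  summable A (fun z => (complex.Re (F z))%:E) /\
  summable A (fun z => (complex.Im (F z))%:E).

Definition rsum (A : set R[i]) (u : R[i] -> R) : R :=
  fine (\esum_(z in A) (Num.max (u z) 0)%:E)%E
  - fine (\esum_(z in A) (Num.max (- u z) 0)%:E)%E.

Definition csum (A : set R[i]) F : R[i] :=
  rsum A (fun z => complex.Re (F z)) +i* rsum A (fun z => complex.Im (F z)).

(* Derivative along A, hence one-sided at the end points of an interval A. *)
Definition deriv_within (A : set R) (f f' : R -> Cplx R) :=
  forall x, A x ->
    ((fun y => (f y - f x) / (y - x)%:C) : R -> Cplx R) @ within A x^'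
      --> (f' x : Cplx R).

(* f is C^2 on A, with first and second derivatives f1 and f2. *)
Definition C2_within (A : set R) (f f1 f2 : R -> Cplx R) :=
  [/\ deriv_within A f f1, deriv_within A f1 f2 & {within A, continuous f2}].

End ComplexAnalysis.

(* A finite quantum graph on a simple graph: an edge is a set of two distinct
   vertices. The values of [len] outside [edges] are irrelevant. *)
Record quantum_graph (R : realType) := QuantumGraph {
  vtx :> finType;
  edges : {set {set vtx}};
  card_edge : forall e, e \in edges -> #|e| = 2;
  len : {set vtx} -> R;
  len_gt0 : forall e, e \in edges -> 0 < len e;
  leads : vtx -> nat
}.

Section QuantumGraph.
Variables (R : realType) (Q : quantum_graph R).

Definition deg (v : Q) : nat := #|[set e in edges Q | v \in e]%SET|.

Definition bounded_data (D n0 : nat) (Lmin Lmax : R) :=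
  (forall v : Q, deg v <= D /\ leads v <= n0)%N /\
  (forall e, e \in edges Q -> Lmin <= len e <= Lmax).

Definition unbalanced := forall v : Q, leads v != deg v.

(* A bond is an ordered pair (origin, terminus) of adjacent vertices. *)
Definition bond : finType :=
  {p : Q * Q | [set p.1; p.2]%SET \in edges Q}.

Definition orig (b : bond) : Q := (val b).1.
Definition bond_len (b : bond) : R := len [set (val b).1; (val b).2]%SET.

Lemma rev_bond_proof (b : bond) : [set (val b).2; (val b).1]%SET \in edges Q.
Proof. by rewrite finset.setUC; exact: (valP b). Qed.

Definition rev_bond (b : bond) : bond :=
  Sub ((val b).2, (val b).1) (rev_bond_proof b).

Definition sigma (b b' : bond) : R :=
  let v := orig b in
  if orig b != orig b' then 0
  else if b != b' then 2 / (leads v + deg v)%:R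
  else 2 / (leads v + deg v)%:R - 1.

(* Matrices indexed by bonds, through the enumeration of [bond]. *)
Definition D_mx (z : R[i]) : 'M[R[i]]_#|bond| :=
  \matrix_(i, j) (if i == j then cexp ('i%C * z * (bond_len (enum_val i))%:C)
                  else 0).

Definition S_mx : 'M[R[i]]_#|bond| :=
  \matrix_(i, j) (sigma (enum_val i) (rev_bond (enum_val j)))%:C.

Definition U_mx (z : R[i]) : 'M[R[i]]_#|bond| := S_mx *m D_mx z.

Definition U'_mx (z : R[i]) : 'M[R[i]]_#|bond| :=
  \matrix_(i, j) cderiv (fun w => U_mx w i j) z.

(* The k-th lead at v is Tagged k, with v its origin. *)
Definition lead : finType := {v : Q & 'I_(leads v)}.

Definition hbond : finType := (bond + lead)%type.

Definition horig (b : hbond) : Q :=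
  match b with inl b => orig b | inr l => tag l end.

Definition hdom (b : hbond) : set R :=
  match b with
  | inl b => [set x | 0 <= x <= bond_len b]
  | inr _ => [set x | 0 <= x]
  end.

(* f b is only meaningful on hdom b; f1 b and f2 b are its derivatives there. *)
Definition is_resonance (z : R[i]) :=
  exists f f1 f2 : hbond -> R -> Cplx R,
    (exists b x, hdom b x /\ f b x != 0) /\
    (forall b, C2_within (hdom b) (f b) (f1 b) (f2 b)) /\
    (forall (b : bond) x, hdom (inl b) x ->
        f (inl b) x = f (inl (rev_bond b)) (bond_len b - x)) /\
    (forall b b', horig b = horig b' -> f b 0 = f b' 0) /\
    (forall v : Q, \sum_(b : hbond | horig b == v) f1 b 0 = 0) /\
    (forall b x, hdom b x -> - f2 b x = z ^+ 2 * f b x) /\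
    (forall (l : lead) x, 0 <= x ->
        f (inr l) x = f (inr l) 0 * cexp ('i%C * z * x%:C)).

Definition Res : set R[i] := [set z | is_resonance z].

Definition res_mult (z0 : R[i]) : nat :=
  zero_order (fun z => \det (1%:M - U_mx z)) z0.

Definition line_integrand (g : R[i] -> R[i]) (y x : R) : R[i] :=
  let z := x +i* y in
  g z * \tr (U'_mx z *m invmx (1%:M - U_mx z)).

(* The integral of [line_integrand g y] makes sense: the inverse exists all
   along the line Im z = y, and the integrand is Lebesgue integrable. *)
Definition line_integral_defined (g : R[i] -> R[i]) (y : R) :=
  (forall x : R, 1%:M - U_mx (x +i* y) \in unitmx) /\
  cintegrable (line_integrand g y).

End QuantumGraph.

Definition Y_bound (R : realType) (D n0 : nat) (Lmin : R) : R :=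
  - (ln ((D + n0)%:R : R) / Lmin).

(* Main.v *)
Require Import Defs.
From HB Require Import structures.
From mathcomp Require Import all_boot all_order all_algebra.
From mathcomp Require Import complex.
From mathcomp Require Import all_classical all_reals all_analysis.
From mathcomp Require Import perm measurable_realfun.
From mathcomp Require Import ring lra.

(** Put [F z = det (Id - U z)]. By Jacobi's formula the trace under the
    integrals is [- F' / F], so the identity is the residue theorem for
    [g F' / F] on the strip [y1 < Im z < y2]. The zeros of [F] lie there: the
    bond scattering matrix is a contraction and, the graph being unbalanced, its
    inverse has norm at most [D + n0], so [F] does not vanish for [Im z > 0] nor
    for [Im z < Y].

    To pass from rectangles to the strip, note that a horizontal translation of
    [F] only changes phases, which range over a compact torus. Hence every unit
    interval contains the abscissa of a vertical segment on which [|F|] exceeds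
    a fixed constant; by the argument principle the number of zeros per unit
    length is then bounded. Cauchy's formula, averaged over rectangles, bounds
    [|g z|] by the [L^1] norm of [g] near [z]. So the vertical sides contribute
    nothing in the limit, the line integrals converge, and the sum over the
    resonances is absolutely convergent. *)

Set Implicit Arguments.
Unset Strict Implicit.
Unset Printing Implicit Defensive.

Import Order.TTheory GRing.Theory Num.Theory.
Import numFieldNormedType.Exports.

Local Open Scope classical_set_scope.
Local Open Scope ring_scope.
Local Open Scope complex_scope.

(** * The norm [n1] and complex differentiation *)

(** When [y1 = Y_bound D n0 Lmin] or [y2 = 0], the energy estimates exclude neither zeros of F on
    these lines nor zeros approaching them far away, and [line_integral_defined] excludes only the
    former. So no uniform lower bound for |F| is at hand on the lines of integration. Zeros are
    therefore counted in rectangles that reach down to [y1 - 1] and up to [y2 + 1], where the energy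
    estimates are strict.

    A lower bound along a whole horizontal line needs more than F <> 0 on it: horizontal translates
    of F may converge to a determinant with other phases. This is why the zero-free half-planes are
    established for [Fth th] with arbitrary [th].

    The sum in the theorem runs over [Res Q], defined by wave functions, whereas contour integrals
    see the zeros of F. Every zero is turned into an explicit wave; a resonance at which F does not
    vanish has multiplicity 0, hence weight 0 in the sum. *)

Section Norm1.
Variable R : realType.
Local Notation C := (R[i]).
Implicit Types (z w : C).

(* The l^1 norm, which is equivalent to the modulus, takes values in [R] and
   involves no square root. *)
Definition n1 z : R := `|complex.Re z| + `|complex.Im z|.

Lemma n1_ge0 z : 0 <= n1 z. Proof. by rewrite addr_ge0. Qed.

Lemma n1_0 : n1 0 = 0. Proof. by rewrite /n1 /= normr0 addr0. Qed.

Lemma n1_1 : n1 1 = 1. Proof. by rewrite /n1 /= normr0 addr0 normr1. Qed.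

Lemma n1_eq0 z : n1 z = 0 -> z = 0.
Proof.
case: z => a b; rewrite /n1 /= => h.
have a0 : `|a| = 0 by have := normr_ge0 a; have := normr_ge0 b; lra.
have b0 : `|b| = 0 by have := normr_ge0 a; have := normr_ge0 b; lra.
by rewrite (normr0_eq0 a0) (normr0_eq0 b0).
Qed.

Lemma n1_gt0 z : z != 0 -> 0 < n1 z.
Proof.
by move=> z0; rewrite lt_neqAle n1_ge0 andbT eq_sym; apply/eqP => /n1_eq0/eqP; exact/negP.
Qed.

Lemma n1N z : n1 (- z) = n1 z.
Proof. by case: z => a b; rewrite /n1 /= !normrN. Qed.

Lemma n1D z w : n1 (z + w) <= n1 z + n1 w.
Proof.
case: z w => a b [c d]; rewrite /n1 /=.
have := ler_normD a c; have := ler_normD b d; lra.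
Qed.

Lemma n1B z w : n1 (z - w) <= n1 z + n1 w.
Proof. by rewrite -(n1N w) n1D. Qed.

Lemma n1BC z w : n1 (z - w) = n1 (w - z).
Proof. by rewrite -n1N opprB. Qed.

Lemma n1M z w : n1 (z * w) <= n1 z * n1 w.
Proof.
case: z w => a b [c d]; rewrite /n1 /=.
have := ler_normB (a * c) (b * d); have := ler_normD (a * d) (b * c).
rewrite !normrM; lra.
Qed.

Lemma n1C (x : R) : n1 x%:C = `|x|.
Proof. by rewrite /n1 /= normr0 addr0. Qed.

Lemma n1Cl (x : R) z : n1 (x%:C * z) = `|x| * n1 z.
Proof. by case: z => c d; rewrite /n1 /= !mul0r subr0 addr0 !normrM; ring. Qed.

Lemma n1i z : n1 ('i%C * z) = n1 z.
Proof. by case: z => c d; rewrite /n1 /= !mul0r !mul1r sub0r add0r normrN addrC. Qed.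

(** The modulus is multiplicative and n1^2 lies between |z|^2 and 2 |z|^2; using this for both
    factors costs 4 on squares, that is 2. *)
Lemma n1M_ge z w : n1 z * n1 w <= 2 * n1 (z * w).
Proof.
case: z w => a b [c d]; rewrite /n1 /=.
have sqn (x : R) : `|x| ^+ 2 = x ^+ 2 by rewrite real_normK ?num_real.
rewrite -ler_sqr ?nnegrE ?mulr_ge0 ?addr_ge0//.
have h1 (x y : R) : (`|x| + `|y|) ^+ 2 <= 2 * (x ^+ 2 + y ^+ 2).
  by rewrite -(sqn x) -(sqn y); have := sqr_ge0 (`|x| - `|y|); nra.
have h2 (x y : R) : x ^+ 2 + y ^+ 2 <= (`|x| + `|y|) ^+ 2.
  by rewrite -(sqn x) -(sqn y); have := normr_ge0 x; have := normr_ge0 y; nra.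
rewrite !exprMn.
apply: (@le_trans _ _ ((2 * (a ^+ 2 + b ^+ 2)) * (2 * (c ^+ 2 + d ^+ 2)))).
  by apply: ler_pM => //; rewrite sqr_ge0.
have -> : 2 * (a ^+ 2 + b ^+ 2) * (2 * (c ^+ 2 + d ^+ 2)) =
   2 ^+ 2 * ((a * c - b * d) ^+ 2 + (a * d + b * c) ^+ 2) by ring.
by rewrite ler_pM2l ?exprn_gt0// h2.
Qed.

Lemma n1V z : n1 z^-1 <= 2 / n1 z.
Proof.
have [->|z0] := eqVneq z 0; first by rewrite invr0 n1_0 invr0 mulr0.
rewrite ler_pdivlMr ?n1_gt0//.
by have := n1M_ge z^-1 z; rewrite mulVf// n1_1 mulr1.
Qed.

Lemma Re_le_n1 z : `|complex.Re z| <= n1 z.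
Proof. by rewrite lerDl. Qed.

Lemma Im_le_n1 z : `|complex.Im z| <= n1 z.
Proof. by rewrite lerDr. Qed.

(** The norm of [R[i]] is itself an element of [R[i]]. This bridge replaces it by a real number,
    after which the topology of [Cplx R] is described by [n1] alone. *)
Lemma normC_n1 z : exists2 t : R, `|z| = t%:C & t <= n1 z <= 2 * t.
Proof.
case: z => a b; exists (Num.sqrt (a ^+ 2 + b ^+ 2)); first by rewrite normc_def.
have sqn (x : R) : `|x| ^+ 2 = x ^+ 2 by rewrite real_normK ?num_real.
rewrite /n1 /=; apply/andP; split.
  rewrite -ler_sqr ?nnegrE ?sqrtr_ge0 ?addr_ge0// sqr_sqrtr ?addr_ge0 ?sqr_ge0//.
  by rewrite -(sqn a) -(sqn b); have := normr_ge0 a; have := normr_ge0 b; nra.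
rewrite -ler_sqr ?nnegrE ?mulr_ge0 ?sqrtr_ge0 ?addr_ge0// exprMn sqr_sqrtr ?addr_ge0 ?sqr_ge0//.
by rewrite -(sqn a) -(sqn b); have := sqr_ge0 (`|a| - `|b|); nra.
Qed.

Lemma nbhs_n1 (z : Cplx R) (P : set (Cplx R)) :
  nbhs z P <-> exists2 d : R, 0 < d & forall w, n1 (w - z) < d -> P w.
Proof.
split.
- move=> /nbhs_ballP[e /= e0 he].
  have [r er r0] : exists2 r : R, e = r%:C & 0 < r.
    have /complex_realP[r er] : e \is Num.real by rewrite gtr0_real.
    by exists r => //; move: e0; rewrite er ltcR.
  exists r => // w wz; apply: he; rewrite -ball_normE /= er.
  have [t -> /andP[h1 _]] := normC_n1 ((z : C) - w).
  by rewrite ltcR (le_lt_trans h1)// n1BC.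
- move=> [d d0 hd]; apply/nbhs_ballP; exists (d / 2)%:C => /=.
    by rewrite ltcR divr_gt0.
  move=> w; rewrite -ball_normE /=.
  have [t -> /andP[_ h2]] := normC_n1 ((z : C) - w).
  by rewrite ltcR => h; apply: hd; rewrite n1BC (le_lt_trans h2)//; lra.
Qed.

Lemma cvg_n1 (T : Type) (F : set_system T) (FF : Filter F) (f : T -> Cplx R) (l : Cplx R) :
  (f x @[x --> F] --> l) <-> forall e : R, 0 < e -> \forall x \near F, n1 (f x - l) < e.
Proof.
split=> [fl e e0|h].
  by apply: (fl [set w : Cplx R | n1 (w - l) < e]); apply/nbhs_n1; exists e.
by move=> P /nbhs_n1[d d0 hP]; apply: filterS (h d d0) => x /hP.
Qed.

Definition cder (f : C -> C) (z l : C) :=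
  is_derive (z : Cplx R) (1 : Cplx R) (f : Cplx R -> Cplx R) (l : Cplx R).

(** A form without quotients, which also makes sense at w = z: in the chain rule g w = g z then
    needs no separate case. *)
Lemma cderP f z l : cder f z l <->
  forall e : R, 0 < e -> exists2 d : R, 0 < d &
    forall w, n1 (w - z) < d -> n1 (f w - f z - l * (w - z)) <= e * n1 (w - z).
Proof.
have step : cder f z l <->
   ((h^-1 * (f (h + z) - f z) : Cplx R) @[h --> (0:Cplx R)^'] --> (l : Cplx R)).
  split.
    move=> [dv <-]; move/cvg_ex : dv => [l' hl'].
    rewrite /derive; have -> := cvg_lim _ hl' => //.
    by apply: cvg_trans hl'; apply: near_eq_cvg; near=> h; rewrite /= [h *: 1]mulr1.
  move=> hl.
  have hl' : (h^-1 *: (((f : Cplx R -> Cplx R) \o shift (z : Cplx R)) (h *: (1 : Cplx R)) - f z) @[h --> (0:Cplx R)^'] --> (l : Cplx R)).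
    by apply: cvg_trans hl; apply: near_eq_cvg; near=> h; rewrite /= [h *: 1]mulr1.
  split; first by apply/cvg_ex; exists l.
  exact: (cvg_lim _ hl').
rewrite step; split.
- move=> /cvg_n1 h e e0.
  have /nbhs_n1[d d0 hd] := h e e0.
  exists d => // w wz; have [->|wz0] := eqVneq w z.
    by rewrite !subrr mulr0 subr0 n1_0 mulr0.
  have wz0' : w - z != 0 by rewrite subr_eq0.
  have := hd (w - z); rewrite subr0 subrK => /(_ wz wz0') hw.
  have -> : f w - f z - l * (w - z) = ((w - z)^-1 * (f w - f z) - l) * (w - z).
    by field.
  by apply: le_trans (n1M _ _) _; rewrite ler_wpM2r ?n1_ge0// ltW.
- move=> h; apply/cvg_n1 => e e0.
  (* Dividing by w costs a factor 2 ([n1V]), and 2 * (e / 4) leaves a strict inequality. *)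
  have e4 : 0 < e / 4 by lra.
  have [d d0 hd] := h _ e4.
  apply/nbhs_n1; exists d => // w; rewrite subr0 => wd w0.
  have := hd (w + z); rewrite addrK => /(_ wd) hw.
  have -> : w^-1 * (f (w + z) - f z) - l = w^-1 * (f (w + z) - f z - l * w).
    by field.
  apply: le_lt_trans (n1M _ _) _.
  have w1 : 0 < n1 w by apply: n1_gt0.
  apply: (@le_lt_trans _ _ (2 / n1 w * (e / 4 * n1 w))).
    by apply: ler_pM; rewrite ?n1_ge0 ?n1V.
  have -> : 2 / n1 w * (e / 4 * n1 w) = e / 2 by field; rewrite gt_eqF.
  by lra.
Unshelve. all: by end_near.
Qed.

Lemma derivable_cderP f z : derivable (f : Cplx R -> Cplx R) z 1 <-> exists l, cder f z l.
Proof.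
split=> [h|[l []//]]; exists ('D_1 (f : Cplx R -> Cplx R) (z : Cplx R)).
by split.
Qed.

Lemma cder_cderiv f z l : cder f z l -> cderiv f z = l.
Proof. by move=> h; rewrite /cderiv derive1E; case: h. Qed.

Lemma cder_ext f g z l : (forall w, f w = g w) -> cder f z l -> cder g z l.
Proof. by move=> /funext <-. Qed.

Lemma cder_eq f z l m : cder f z l -> l = m -> cder f z m.
Proof. by move=> h <-. Qed.

Lemma cder_near f g z l (d : R) : 0 < d -> (forall w, n1 (w - z) < d -> f w = g w) ->
  cder f z l -> cder g z l.
Proof.
move=> d0 fg /cderP h; apply/cderP => e /h[d' d'0 h'].
exists (Num.min d d'); first by rewrite lt_min d0.
move=> w; rewrite lt_min => /andP[w1 w2].
by rewrite -!fg ?subrr ?n1_0// h'.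
Qed.

Lemma cder_cst (a z : C) : cder (fun=> a) z 0.
Proof.
apply/cderP => e e0; exists 1 => // w _.
by rewrite mul0r subrr subr0 n1_0 mulr_ge0 ?n1_ge0 ?ltW.
Qed.

Lemma cder_id (z : C) : cder id z 1.
Proof.
apply/cderP => e e0; exists 1 => // w _.
by rewrite mul1r subrr n1_0 mulr_ge0 ?n1_ge0 ?ltW.
Qed.

Lemma cderD f g z l m : cder f z l -> cder g z m -> cder (fun w => f w + g w) z (l + m).
Proof. by move=> hf hg; exact: (is_deriveD hf hg). Qed.

Lemma cderB f g z l m : cder f z l -> cder g z m -> cder (fun w => f w - g w) z (l - m).
Proof. by move=> hf hg; exact: (is_deriveB hf hg). Qed.

Lemma cderM f g z l m : cder f z l -> cder g z m ->
  cder (fun w => f w * g w) z (l * g z + f z * m).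
Proof.
move=> hf hg.
apply: cder_eq (@is_deriveM (R[i]) (Cplx R) f g z 1 l m hf hg) _.
by rewrite addrC; congr (_ + _); exact: mulrC.
Qed.

Lemma cderZ (a : C) f z l : cder f z l -> cder (fun w => a * f w) z (a * l).
Proof. by move=> /(cderM (cder_cst a z)); rewrite mul0r add0r. Qed.

Lemma cder_sum (I : Type) (r : seq I) (P : pred I) (f : I -> C -> C) (l : I -> C) z :
  (forall i, P i -> cder (f i) z (l i)) ->
  cder (fun w => \sum_(i <- r | P i) f i w) z (\sum_(i <- r | P i) l i).
Proof.
move=> h; elim: r => [|i r ih].
  rewrite big_nil; apply: cder_ext (cder_cst 0 z) => w; by rewrite big_nil.
rewrite big_cons; case: ifPn => Pi.
  apply: (@cder_ext (fun w => f i w + \sum_(j <- r | P j) f j w)).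
    by move=> w; rewrite big_cons Pi.
  exact: cderD (h _ Pi) ih.
by apply: cder_ext ih => w; rewrite big_cons (negbTE Pi).
Qed.

Lemma cderX f z l n : cder f z l ->
  cder (fun w => f w ^+ n) z (n%:R * f z ^+ n.-1 * l).
Proof.
move=> h; elim: n => [|n ih].
  by rewrite !mul0r; apply: cder_ext (cder_cst 1 z).
apply: (@cder_ext (fun w => f w * f w ^+ n)); first by move=> w; rewrite exprS.
apply: cder_eq (cderM h ih) _.
case: n ih => [|n] _; first by rewrite !expr0; ring.
rewrite /= exprS (natrD _ 1 n.+1); ring.
Qed.

Lemma cder_cont f z l : cder f z l -> {for z, continuous (f : Cplx R -> Cplx R)}.
Proof.
move=> /cderP h; apply/(cvg_n1 (nbhs_filter (z : Cplx R)) f (f z)) => e e0.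
have [d d0 hd] := h 1 ltr01.
apply/nbhs_n1; exists (Num.min d (e / (1 + n1 l + 1))) => [|w].
  by rewrite lt_min d0 divr_gt0// ltr_wpDl// addr_ge0 ?n1_ge0.
rewrite lt_min => /andP[w1 w2].
have -> : f w - f z = (f w - f z - l * (w - z)) + l * (w - z) by rewrite subrK.
apply: le_lt_trans (n1D _ _) _.
have h1 := hd w w1; have h2 := n1M l (w - z).
move: w2; rewrite ltr_pdivlMr; last by have := n1_ge0 l; lra.
have := n1_ge0 (w - z); nra.
Qed.

Lemma cont_n1P f z : {for z, continuous (f : Cplx R -> Cplx R)} <->
  forall e : R, 0 < e -> exists2 d : R, 0 < d & forall w, n1 (w - z) < d -> n1 (f w - f z) < e.
Proof.
split=> [/(cvg_n1 (nbhs_filter (z : Cplx R)) f (f z)) h e /h /nbhs_n1//|h].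
by apply/(cvg_n1 (nbhs_filter (z : Cplx R)) f (f z)) => e /h[d d0 hd]; apply/nbhs_n1; exists d.
Qed.

Lemma cder_inv z : z != 0 -> cder (fun w => w^-1) z (- (z ^+ 2)^-1).
Proof.
move=> z0; apply/cderP => e e0.
have z1 : 0 < n1 z by apply: n1_gt0.
have zz : 0 < n1 (z ^+ 2) by rewrite n1_gt0// sqrf_eq0.
(* The first bound keeps n1 w >= n1 z / 2. The second makes the remainder factor (w - z) / (z^2 w),
   at most 8 n1 (w - z) / (n1 (z^2) n1 z), smaller than e / 2. *)
exists (Num.min (n1 z / 2) (e * (n1 z) * n1 (z ^+ 2) / 16)) => [|w].
  by rewrite lt_min !divr_gt0// !mulr_gt0.
rewrite lt_min => /andP[w1 w2].
have w1' : n1 z / 2 <= n1 w.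
  by have := n1B w (w - z); rewrite opprB addrC subrK; lra.
have w0 : w != 0 by apply: contraTneq w1' => ->; rewrite n1_0 -ltNge divr_gt0.
have -> : w^-1 - z^-1 - - (z ^+ 2)^-1 * (w - z) = ((w - z) * (z ^+ 2)^-1 * w^-1) * (w - z).
  by field; rewrite w0.
apply: le_trans (n1M _ _) _; rewrite ler_wpM2r ?n1_ge0//.
apply: le_trans (n1M _ _) _.
have iw : n1 w^-1 <= 4 / n1 z.
  apply: le_trans (n1V _) _.
  rewrite ler_pdivrMr; last by lra.
  rewrite mulrAC ler_pdivlMr//; lra.
have h1 : n1 ((w - z) * (z ^+ 2)^-1) <= n1 (w - z) * (2 / n1 (z ^+ 2)).
  by apply: le_trans (n1M _ _) _; rewrite ler_wpM2l ?n1_ge0 ?n1V.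
apply: (@le_trans _ _ (n1 (w - z) * (2 / n1 (z ^+ 2)) * (4 / n1 z))).
  by apply: ler_pM; rewrite ?n1_ge0.
apply: (@le_trans _ _ ((e * n1 z * n1 (z ^+ 2) / 16) * (2 / n1 (z ^+ 2)) * (4 / n1 z))).
  by do 2!(apply: ler_wpM2r; first by rewrite divr_ge0 ?ltW); exact: ltW.
have -> : (e * n1 z * n1 (z ^+ 2) / 16) * (2 / n1 (z ^+ 2)) * (4 / n1 z) = e / 2.
  by field; rewrite !gt_eqF.
lra.
Qed.

Lemma cder_comp f g z l m : cder g z m -> cder f (g z) l ->
  cder (fun w => f (g w)) z (l * m).
Proof.
move=> hg /cderP hf; apply/cderP => e e0.
set B := n1 m + 1; have B0 : 0 < B by rewrite ltr_wpDl// n1_ge0.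
set A := n1 l + 1; have A0 : 0 < A by rewrite ltr_wpDl// n1_ge0.
have e1 : 0 < e / (2 * B) by rewrite divr_gt0// mulr_gt0.
have e2 : 0 < e / (2 * A) by rewrite divr_gt0// mulr_gt0.
have [d1 d10 h1] := hf _ e1.
have /cont_n1P/(_ _ d10)[d2 d20 h2] := cder_cont hg.
move/cderP : hg => hg; have [d3 d30 h3] := hg _ e2.
have [d4 d40 h4] := hg 1 ltr01.
exists (Num.min d2 (Num.min d3 d4)); first by rewrite !lt_min d20 d30.
move=> w; rewrite !lt_min => /andP[w2 /andP[w3 w4]].
have -> : f (g w) - f (g z) - l * m * (w - z) =
   (f (g w) - f (g z) - l * (g w - g z)) + l * (g w - g z - m * (w - z)) by ring.
apply: le_trans (n1D _ _) _.
have gb : n1 (g w - g z) <= B * n1 (w - z).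
  have -> : g w - g z = (g w - g z - m * (w - z)) + m * (w - z) by rewrite subrK.
  apply: le_trans (n1D _ _) _; have := h4 w w4; have := n1M m (w - z).
  by rewrite /B; lra.
have k1 := h1 _ (h2 _ w2); have k2 := h3 _ w3.
have k3 := n1M l (g w - g z - m * (w - z)).
have k4 : n1 (f (g w) - f (g z) - l * (g w - g z)) <= e / 2 * n1 (w - z).
  apply: le_trans k1 _; apply: le_trans (ler_wpM2l (ltW e1) gb) _.
  by rewrite le_eqVlt; apply/orP; left; apply/eqP; field; rewrite gt_eqF.
have k5 : n1 (l * (g w - g z - m * (w - z))) <= e / 2 * n1 (w - z).
  apply: le_trans k3 _.
  apply: (@le_trans _ _ (A * (e / (2 * A) * n1 (w - z)))).
    by apply: ler_pM; rewrite ?n1_ge0// /A lerDl.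
  by rewrite le_eqVlt; apply/orP; left; apply/eqP; field; rewrite gt_eqF.
lra.
Qed.

Lemma cderV g z m : cder g z m -> g z != 0 ->
  cder (fun w => (g w)^-1) z (- m / g z ^+ 2).
Proof.
move=> h g0; apply: cder_eq (cder_comp h (cder_inv g0)) _.
by rewrite mulNr mulNr mulrC.
Qed.

Lemma cder_div f g z l m : cder f z l -> cder g z m -> g z != 0 ->
  cder (fun w => f w / g w) z ((l * g z - f z * m) / g z ^+ 2).
Proof.
move=> hf hg g0; apply: cder_eq (cderM hf (cderV hg g0)) _.
by field.
Qed.

End Norm1.

(** * Integrals along segments and rectangles *)

Section SegmentIntegral.
Variable R : realType.
Local Notation C := (R[i]).
Local Notation mu := (@lebesgue_measure R).
Implicit Types (f g : R -> C) (a b c d x y : R).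

Definition ccont (f : C -> C) (z : C) := forall e : R, 0 < e ->
  exists2 d : R, 0 < d & forall w, n1 (w - z) < d -> n1 (f w - f z) < e.

(** Continuity is two-sided even at the end points: a function continuous at the points of a segment
    in the plane restricts to such an f, and the property passes to subsegments. *)
Definition scont a b f := forall x, a <= x <= b -> {for x, continuous (f : R -> Cplx R)}.

Definition cint a b f : C :=
  (\int[mu]_(x in `[a, b]) complex.Re (f x))%R +i* (\int[mu]_(x in `[a, b]) complex.Im (f x))%R.

Lemma Re_cont (z : Cplx R) : {for z, continuous (@complex.Re R : Cplx R -> R)}.
Proof.
apply/(@cvgrPdist_lt _ _ _ _ (nbhs_filter z)) => e e0; apply/nbhs_n1; exists e => // w.
apply: le_lt_trans; rewrite distrC; apply: le_trans (Re_le_n1 _).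
by case: z w => ? ? [].
Qed.

Lemma Im_cont (z : Cplx R) : {for z, continuous (@complex.Im R : Cplx R -> R)}.
Proof.
apply/(@cvgrPdist_lt _ _ _ _ (nbhs_filter z)) => e e0; apply/nbhs_n1; exists e => // w.
apply: le_lt_trans; rewrite distrC; apply: le_trans (Im_le_n1 _).
by case: z w => ? ? [].
Qed.

Lemma n1_cont (z : Cplx R) : {for z, continuous (@n1 R : Cplx R -> R)}.
Proof.
apply/(@cvgrPdist_lt _ _ _ _ (nbhs_filter z)) => e e0; apply/nbhs_n1; exists e => // w.
apply: le_lt_trans; rewrite distrC ler_norml.
have h1 := n1D (w - z) z; have h2 := n1D (z - w) w; move: h1 h2.
rewrite !subrK (n1BC z w); lra.
Qed.

Lemma continuous_sub_within (V : topologicalType) a b (f : R -> V) :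
  (forall x, a <= x <= b -> {for x, continuous f}) -> {within `[a, b], continuous f}.
Proof.
move=> h; apply: continuous_in_subspaceT => x.
by rewrite inE /= in_itv /= => /h.
Qed.

Lemma Rint_itg a b (f : R -> R) : (forall x, a <= x <= b -> {for x, continuous f}) ->
  mu.-integrable `[a, b] (EFin \o f).
Proof.
move=> h; apply: continuous_compact_integrable; first exact: segment_compact.
exact: continuous_sub_within h.
Qed.

Lemma scont_Re a b f : scont a b f -> forall x, a <= x <= b -> {for x, continuous (@complex.Re R \o f)}.
Proof. by move=> h x /h hx; exact: (@continuous_comp _ (Cplx R) R f (@complex.Re R) x hx (@Re_cont (f x))). Qed.

Lemma scont_Im a b f : scont a b f -> forall x, a <= x <= b -> {for x, continuous (@complex.Im R \o f)}.
Proof. by move=> h x /h hx; exact: (@continuous_comp _ (Cplx R) R f (@complex.Im R) x hx (@Im_cont (f x))). Qed.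

Lemma scont_n1 a b f : scont a b f -> forall x, a <= x <= b -> {for x, continuous (@n1 R \o f)}.
Proof. by move=> h x /h hx; exact: (@continuous_comp _ (Cplx R) R f (@n1 R) x hx (@n1_cont (f x))). Qed.

Lemma itgRe a b f : scont a b f -> mu.-integrable `[a, b] (EFin \o (fun x => complex.Re (f x))).
Proof. by move=> h; apply: Rint_itg; exact: scont_Re h. Qed.

Lemma itgIm a b f : scont a b f -> mu.-integrable `[a, b] (EFin \o (fun x => complex.Im (f x))).
Proof. by move=> h; apply: Rint_itg; exact: scont_Im h. Qed.

Lemma itg_n1 a b f : scont a b f -> mu.-integrable `[a, b] (EFin \o (fun x => n1 (f x))).
Proof. by move=> h; apply: Rint_itg; exact: scont_n1 h. Qed.

Lemma scontD a b f g : scont a b f -> scont a b g -> scont a b (fun x => f x + g x).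
Proof. by move=> hf hg x xab; exact: (@cvgD _ (Cplx R) _ _ _ _ _ _ _ (hf _ xab) (hg _ xab)). Qed.

Lemma scontN a b f : scont a b f -> scont a b (fun x => - f x).
Proof. by move=> hf x xab; exact: (@cvgN _ (Cplx R) _ _ _ _ _ (hf _ xab)). Qed.

Lemma scontB a b f g : scont a b f -> scont a b g -> scont a b (fun x => f x - g x).
Proof. by move=> hf hg; exact: (scontD hf (scontN hg)). Qed.

Lemma scontM a b f g : scont a b f -> scont a b g -> scont a b (fun x => f x * g x).
Proof. by move=> hf hg x xab; exact: (@cvgM (R[i]) _ _ _ _ _ _ _ (hf _ xab) (hg _ xab)). Qed.

Lemma scont_cst a b (z : C) : scont a b (fun=> z).
Proof. by move=> x _; exact: cvg_cst. Qed.

Lemma scontZ a b (z : C) f : scont a b f -> scont a b (fun x => z * f x).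
Proof. exact/scontM/scont_cst. Qed.

Lemma cint_ext a b f g : (forall x, a <= x <= b -> f x = g x) -> cint a b f = cint a b g.
Proof.
move=> h; congr (_ +i* _); apply: eq_Rintegral => x; rewrite inE /= in_itv /= => /h ->//.
Qed.

Lemma cintD a b f g : scont a b f -> scont a b g ->
  cint a b (fun x => f x + g x) = cint a b f + cint a b g.
Proof.
move=> hf hg; rewrite /cint; apply/eqP; rewrite eq_complex /=; apply/andP; split; apply/eqP.
- rewrite -RintegralD//; try exact: itgRe.
  by apply: eq_Rintegral => x _; case: (f x) (g x) => ? ? [].
- rewrite -RintegralD//; try exact: itgIm.
  by apply: eq_Rintegral => x _; case: (f x) (g x) => ? ? [].
Qed.

Lemma itgZ (D : set (measurableTypeR R)) (k : R) (f : R -> R) : measurable D -> mu.-integrable D (EFin \o f) ->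
  mu.-integrable D (EFin \o (fun x => k * f x)).
Proof.
move=> mD hf; have := integrableZl mD k hf.
by apply: eq_integrable => // x _; rewrite /= EFinM.
Qed.

Lemma cintZ a b (z : C) f : scont a b f -> cint a b (fun x => z * f x) = z * cint a b f.
Proof.
move=> hf; case: z => p q; rewrite /cint; apply/eqP; rewrite eq_complex /=; apply/andP; split; apply/eqP.
- rewrite -!RintegralZl//; try exact: itgRe; try exact: itgIm.
  rewrite -RintegralB//; try by apply: eq_Rintegral => x _; case: (f x).
  + exact: (itgZ _ (measurable_itv _) (itgRe hf)).
  + exact: (itgZ _ (measurable_itv _) (itgIm hf)).
- rewrite -!RintegralZl//; try exact: itgRe; try exact: itgIm.
  rewrite -RintegralD//; try by apply: eq_Rintegral => x _; case: (f x) => /=.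
  + exact: (itgZ _ (measurable_itv _) (itgIm hf)).
  + exact: (itgZ _ (measurable_itv _) (itgRe hf)).
Qed.

Lemma cintN a b f : scont a b f -> cint a b (fun x => - f x) = - cint a b f.
Proof.
move=> hf; rewrite -mulN1r -cintZ//; apply: cint_ext => x _; by rewrite mulN1r.
Qed.

Lemma cintB a b f g : scont a b f -> scont a b g ->
  cint a b (fun x => f x - g x) = cint a b f - cint a b g.
Proof. by move=> hf hg; rewrite (cintD hf (scontN hg)) cintN. Qed.

(** For [n1] the triangle inequality for integrals is just the sum of those for the real and the
    imaginary part. *)
Lemma n1_cint a b f : scont a b f -> n1 (cint a b f) <= (\int[mu]_(x in `[a, b]) n1 (f x))%R.
Proof.
move=> hf; rewrite /n1 /=.
have iR := itgRe hf; have iI := itgIm hf.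
rewrite RintegralD//; last 2 first.
  by have := integrable_norm iR.
  by have := integrable_norm iI.
by apply: lerD; apply: le_normr_Rintegral.
Qed.

Lemma Rint_le_cst a b (f : R -> R) M : a <= b -> (forall x, a <= x <= b -> {for x, continuous f}) ->
  (forall x, a <= x <= b -> f x <= M) -> (\int[mu]_(x in `[a, b]) f x)%R <= M * (b - a).
Proof.
move=> ab hf hM.
have -> : M * (b - a) = (\int[mu]_(x in `[a, b]) M)%R.
  rewrite Rintegral_cst//; congr (_ * _).
  have key (A : \bar R) : A = (b - a)%:E -> b - a = fine A by move=> ->.
  apply: key.
  rewrite [LHS](lebesgue_measure_itv `[a, b]) /= lte_fin.
  by case: ltgtP ab => // -> _; rewrite subrr.
apply: le_Rintegral => //.
- exact: Rint_itg.
- by apply: Rint_itg => x _; exact: cvg_cst.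
Qed.

Lemma cint_bound a b f M : a <= b -> scont a b f ->
  (forall x, a <= x <= b -> n1 (f x) <= M) -> n1 (cint a b f) <= M * (b - a).
Proof.
move=> ab hf hM; apply: le_trans (n1_cint hf) _.
apply: Rint_le_cst => //; exact: scont_n1.
Qed.

Lemma Rint_split a c b (f : R -> R) : a <= c <= b -> (forall x, a <= x <= b -> {for x, continuous f}) ->
  (\int[mu]_(x in `[a, b]) f x)%R = (\int[mu]_(x in `[a, c]) f x)%R + (\int[mu]_(x in `[c, b]) f x)%R.
Proof.
move=> /andP[ac cb] hf.
have := @Rintegral_itvB R f (BLeft a) (BRight b) c (Rint_itg hf).
rewrite !bnd_simp => /(_ ac cb).
rewrite Rintegral_itv_obnd_cbnd; first by move=> <-; rewrite addrC subrK.
apply: integrableS (Rint_itg hf) => //.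
by apply: subset_itvr; rewrite bnd_simp.
Qed.

Lemma cint_split a c b f : a <= c <= b -> scont a b f ->
  cint a b f = cint a c f + cint c b f.
Proof.
move=> acb hf; rewrite /cint; apply/eqP; rewrite eq_complex /=; apply/andP; split; apply/eqP.
  by rewrite (@Rint_split a c b)//; exact: scont_Re.
by rewrite (@Rint_split a c b)//; exact: scont_Im.
Qed.

Definition rder (f : R -> R) (x l : R) := forall e : R, 0 < e -> exists2 d : R, 0 < d &
  forall y, `|y - x| < d -> `|f y - f x - l * (y - x)| <= e * `|y - x|.

Lemma rder_is_derive (f : R -> R) x l : rder f x l -> is_derive x 1 f l.
Proof.
move=> h.
have hl : (h^-1 *: ((f \o shift x) (h *: 1) - f x) @[h --> 0^'] --> l).
  apply/cvgrPdist_lt => e e0.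
  have e2 : 0 < e / 2 by lra.
  have [d d0 hd] := h _ e2.
  near=> k.
  have k0 : k != 0 by near: k; exact: nbhs_dnbhs_neq.
  have kd : `|k| < d by near: k; apply: dnbhs0_lt.
  have := hd (k + x); rewrite addrK => /(_ kd) hk.
  rewrite /= [k *: 1]mulr1.
  have -> : l - k^-1 *: (f (k + x) - f x) = - (k^-1 * (f (k + x) - f x - l * k)).
    by rewrite /GRing.scale /=; field.
  rewrite normrN normrM normrV ?unitfE//.
  rewrite mulrC ltr_pdivrMr ?normr_gt0//.
  apply: le_lt_trans hk _; rewrite ltr_pM2r ?normr_gt0//; lra.
split; first by apply/cvg_ex; exists l.
exact: (cvg_lim _ hl).
Unshelve. all: by end_near.
Qed.

Lemma Rint_FTC a b (f F : R -> R) : a <= b ->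
  (forall x, a <= x <= b -> {for x, continuous f}) ->
  (forall x, a <= x <= b -> is_derive x 1 F (f x)) ->
  (\int[mu]_(x in `[a, b]) f x)%R = F b - F a.
Proof.
rewrite le_eqVlt => /orP[/eqP <-|ab] hf hF.
  by rewrite set_itv1 Rintegral_set1 subrr.
have dF x : a <= x <= b -> derivable F x 1 by move=> /hF[].
have cF x : a <= x <= b -> {for x, continuous F}.
  by move=> /dF; rewrite derivable1_diffP => /differentiable_continuous.
rewrite /Rintegral (@continuous_FTC2 _ f F)//.
- exact: continuous_sub_within.
- split.
  + by move=> x; rewrite in_itv /= => /andP[x1 x2]; apply: dF; rewrite !ltW.
  + by apply: cvg_at_right_filter; apply: cF; rewrite lexx ltW.
  + by apply: cvg_at_left_filter; apply: cF; rewrite lexx ltW.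
- move=> x; rewrite in_itv /= => /andP[x1 x2]; rewrite derive1E.
  by have [] := hF x; rewrite ?ltW.
Qed.

(* [p] is the initial point and [u] the direction of an affine path. *)
Lemma cint_FTC a b (p u : C) (f F : C -> C) : a <= b ->
  scont a b (fun x => f (p + x%:C * u)) ->
  (forall x, a <= x <= b -> cder F (p + x%:C * u) (f (p + x%:C * u))) ->
  u * cint a b (fun x => f (p + x%:C * u)) = F (p + b%:C * u) - F (p + a%:C * u).
Proof.
move=> ab hf hF.
have hd x : a <= x <= b -> forall e : R, 0 < e -> exists2 d : R, 0 < d & forall y, `|y - x| < d ->
    n1 (F (p + y%:C * u) - F (p + x%:C * u) - (u * f (p + x%:C * u)) * (y - x)%:C) <= e * `|y - x|.
  move=> /hF/cderP h e e0.
  have A0 : 0 < n1 u + 1 by rewrite ltr_wpDl// n1_ge0.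
  have [d d0 hd] := h (e / (n1 u + 1)) (divr_gt0 e0 A0).
  have E y : p + y%:C * u - (p + x%:C * u) = (y - x)%:C * u.
    by rewrite rmorphB /=; ring.
  exists (d / (n1 u + 1)) => [|y yx]; first by rewrite divr_gt0.
  have k : n1 (p + y%:C * u - (p + x%:C * u)) <= `|y - x| * (n1 u + 1).
    by rewrite E n1Cl ler_wpM2l// lerDl.
  have := hd (p + y%:C * u).
  move=> /(_ (le_lt_trans k _)); rewrite -ltr_pdivlMr// => /(_ yx).
  have -> : u * f (p + x%:C * u) * (y - x)%:C = f (p + x%:C * u) * (p + y%:C * u - (p + x%:C * u)).
    by rewrite E; ring.
  move=> hh.
  apply: le_trans hh _; apply: le_trans (ler_wpM2l _ k) _.
    by rewrite divr_ge0 ?ltW.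
  by rewrite le_eqVlt; apply/orP; left; apply/eqP; field; rewrite gt_eqF.
rewrite -cintZ//.
have hf' : scont a b (fun x => u * f (p + x%:C * u)) by exact: scontZ.
rewrite /cint.
have ReB (z w : C) : complex.Re (z - w) = complex.Re z - complex.Re w by case: z w => ? ? [].
have ImB (z w : C) : complex.Im (z - w) = complex.Im z - complex.Im w by case: z w => ? ? [].
have ReM (z : C) (t : R) : complex.Re (z * t%:C) = complex.Re z * t by case: z => ? ? /=; rewrite mulr0 subr0.
have ImM (z : C) (t : R) : complex.Im (z * t%:C) = complex.Im z * t by case: z => ? ? /=; rewrite mulr0 add0r.
have K1 x : a <= x <= b -> is_derive x 1 (fun x => complex.Re (F (p + x%:C * u)))
    (complex.Re (u * f (p + x%:C * u))).
  move=> xab; apply: rder_is_derive => e e0; have [d d0 hd'] := hd _ xab _ e0; exists d => // y /hd'.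
  by apply: le_trans; rewrite -ReM -!ReB; exact: Re_le_n1.
have K2 x : a <= x <= b -> is_derive x 1 (fun x => complex.Im (F (p + x%:C * u)))
    (complex.Im (u * f (p + x%:C * u))).
  move=> xab; apply: rder_is_derive => e e0; have [d d0 hd'] := hd _ xab _ e0; exists d => // y /hd'.
  by apply: le_trans; rewrite -ImM -!ImB; exact: Im_le_n1.
rewrite (Rint_FTC ab (scont_Re hf') K1) (Rint_FTC ab (scont_Im hf') K2).
by case: (F _) (F _) => ? ? [].
Qed.

End SegmentIntegral.

(** * Contour integrals along rectangles and Goursat's theorem *)

Section RectangleIntegral.
Variable R : realType.
Local Notation C := (R[i]).
Implicit Types (f g : C -> C) (a b c d x y : R) (z w : C).

Definition rect a b c d z := (a <= complex.Re z <= b) && (c <= complex.Im z <= d).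

(** The contour integral along the boundary, counterclockwise: dz is dx on horizontal sides and i dy
    on vertical ones. *)
Definition rint f a b c d : C :=
  cint a b (fun x => f (x +i* c)) - cint a b (fun x => f (x +i* d))
  + 'i%C * (cint c d (fun y => f (b +i* y)) - cint c d (fun y => f (a +i* y))).

Lemma cder_ccont f z l : cder f z l -> ccont f z.
Proof. by move=> /cder_cont/cont_n1P. Qed.

Lemma n1_ri x y : n1 (x +i* y) = `|x| + `|y|. Proof. by []. Qed.

Lemma nbhs_dist_lt x d : 0 < d -> \forall t \near x, `|t - x| < d.
Proof. by move=> d0; apply/nbhs_ballP; exists d => // t /=; rewrite -ball_normE /= distrC. Qed.

Lemma hscont f a b c : (forall x, a <= x <= b -> ccont f (x +i* c)) ->
  scont a b (fun x => f (x +i* c)).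
Proof.
move=> h x /h hx; apply/(cvg_n1 (nbhs_filter x)) => e /hx[d d0 hd].
near=> t; apply: hd; rewrite n1_ri subrr normr0 addr0.
by near: t; exact: nbhs_dist_lt.
Unshelve. all: by end_near.
Qed.

Lemma vscont f c d a : (forall y, c <= y <= d -> ccont f (a +i* y)) ->
  scont c d (fun y => f (a +i* y)).
Proof.
move=> h x /h hx; apply/(cvg_n1 (nbhs_filter x)) => e /hx[r d0 hd].
near=> t; apply: hd; rewrite n1_ri subrr normr0 add0r.
by near: t; exact: nbhs_dist_lt.
Unshelve. all: by end_near.
Qed.

Definition sides f a b c d := [/\ scont a b (fun x => f (x +i* c)), scont a b (fun x => f (x +i* d)),
  scont c d (fun y => f (a +i* y)) & scont c d (fun y => f (b +i* y))].

Definition bdry a b c d z := rect a b c d z /\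
  [\/ complex.Re z = a, complex.Re z = b, complex.Im z = c | complex.Im z = d].

Lemma bdry_rect a b c d z : bdry a b c d z -> rect a b c d z. Proof. by case. Qed.

Lemma bdry_sides f a b c d : a <= b -> c <= d -> (forall z, bdry a b c d z -> ccont f z) -> sides f a b c d.
Proof.
move=> ab cd h; split; [apply: hscont|apply: hscont|apply: vscont|apply: vscont] => x xab; apply: h;
  rewrite /bdry /rect /= xab ?ab ?cd ?lexx ?ab ?cd //=; split => //;
  by [constructor 1|constructor 2|constructor 3|constructor 4].
Qed.

Lemma rint_ext f g a b c d : a <= b -> c <= d -> (forall z, bdry a b c d z -> f z = g z) ->
  rint f a b c d = rint g a b c d.
Proof.
move=> ab cd h; rewrite /rint; congr (_ - _ + _ * (_ - _)); apply: cint_ext => x xab; apply: h;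
  rewrite /bdry /rect /= xab ?ab ?cd ?lexx ?ab ?cd //=; split => //;
  by [constructor 1|constructor 2|constructor 3|constructor 4].
Qed.

Lemma rintD f g a b c d : sides f a b c d -> sides g a b c d ->
  rint (fun z => f z + g z) a b c d = rint f a b c d + rint g a b c d.
Proof. by move=> [f1 f2 f3 f4] [g1 g2 g3 g4]; rewrite /rint !cintD//; ring. Qed.

Lemma rintZ w f a b c d : sides f a b c d ->
  rint (fun z => w * f z) a b c d = w * rint f a b c d.
Proof. by move=> [f1 f2 f3 f4]; rewrite /rint !cintZ//; ring. Qed.

Lemma rintB f g a b c d : sides f a b c d -> sides g a b c d ->
  rint (fun z => f z - g z) a b c d = rint f a b c d - rint g a b c d.
Proof. by move=> [f1 f2 f3 f4] [g1 g2 g3 g4]; rewrite /rint !cintB//; ring. Qed.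

Lemma sidesM f g a b c d : sides f a b c d -> sides g a b c d -> sides (fun z => f z * g z) a b c d.
Proof.
move=> [f1 f2 f3 f4] [g1 g2 g3 g4]; split.
- exact: (scontM f1 g1).
- exact: (scontM f2 g2).
- exact: (scontM f3 g3).
- exact: (scontM f4 g4).
Qed.

Lemma sides_cst w a b c d : sides (fun=> w) a b c d.
Proof. by split; exact: scont_cst. Qed.

Lemma sidesZ w f a b c d : sides f a b c d -> sides (fun z => w * f z) a b c d.
Proof. exact/sidesM/sides_cst. Qed.

Lemma sidesB f g a b c d : sides f a b c d -> sides g a b c d -> sides (fun z => f z - g z) a b c d.
Proof.
move=> [f1 f2 f3 f4] [g1 g2 g3 g4]; split.
- exact: (scontB f1 g1).
- exact: (scontB f2 g2).
- exact: (scontB f3 g3).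
- exact: (scontB f4 g4).
Qed.

Lemma n1_rint f a b c d M : a <= b -> c <= d -> sides f a b c d ->
  (forall z, bdry a b c d z -> n1 (f z) <= M) ->
  n1 (rint f a b c d) <= 2 * M * ((b - a) + (d - c)).
Proof.
move=> ab cd [f1 f2 f3 f4] h; rewrite /rint.
have h1 : n1 (cint a b (fun x => f (x +i* c))) <= M * (b - a).
  apply: cint_bound => // x xab; apply: h; rewrite /bdry /rect /= xab lexx cd; split => //.
  by constructor 3.
have h2 : n1 (cint a b (fun x => f (x +i* d))) <= M * (b - a).
  apply: cint_bound => // x xab; apply: h; rewrite /bdry /rect /= xab lexx cd; split => //.
  by constructor 4.
have h3 : n1 (cint c d (fun y => f (a +i* y))) <= M * (d - c).
  apply: cint_bound => // x xab; apply: h; rewrite /bdry /rect /= xab lexx ab; split => //.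
  by constructor 1.
have h4 : n1 (cint c d (fun y => f (b +i* y))) <= M * (d - c).
  apply: cint_bound => // x xab; apply: h; rewrite /bdry /rect /= xab lexx ab; split => //.
  by constructor 2.
apply: le_trans (n1D _ _) _; rewrite n1i.
have := n1B (cint a b (fun x => f (x +i* c))) (cint a b (fun x => f (x +i* d))).
have := n1B (cint c d (fun y => f (b +i* y))) (cint c d (fun y => f (a +i* y))).
lra.
Qed.

Lemma rint_splitx f s a b c d : a <= s <= b -> sides f a b c d ->
  rint f a b c d = rint f a s c d + rint f s b c d.
Proof.
move=> sab [f1 f2 f3 f4]; rewrite /rint (cint_split sab f1) (cint_split sab f2); ring.
Qed.

Lemma rint_splity f s a b c d : c <= s <= d -> sides f a b c d ->
  rint f a b c d = rint f a b c s + rint f a b s d.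
Proof.
move=> sab [f1 f2 f3 f4]; rewrite /rint (cint_split sab f3) (cint_split sab f4); ring.
Qed.

Lemma rint_primitive f F a b c d : a <= b -> c <= d -> sides f a b c d ->
  (forall z, bdry a b c d z -> cder F z (f z)) -> rint f a b c d = 0.
Proof.
move=> ab cd [f1 f2 f3 f4] hF.
have hx (y x : R) : x +i* y = (0 +i* y) + x%:C * 1.
  by apply/eqP; rewrite eq_complex /=; apply/andP; split; apply/eqP; ring.
have hy (x y : R) : x +i* y = x%:C + y%:C * 'i%C.
  by apply/eqP; rewrite eq_complex /=; apply/andP; split; apply/eqP; ring.
have H y : (y = c \/ y = d) -> cint a b (fun x => f (x +i* y)) = F (b +i* y) - F (a +i* y).
  move=> yy.
  have S : scont a b (fun x => f ((0 +i* y) + x%:C * 1)).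
    suff <- : (fun x => f (x +i* y)) = (fun x => f ((0 +i* y) + x%:C * 1)) by case: yy => ->.
    by apply/funext => x; rewrite -hx.
  have D x : a <= x <= b -> cder F ((0 +i* y) + x%:C * 1) (f ((0 +i* y) + x%:C * 1)).
    move=> xab; rewrite -hx; apply: hF; rewrite /bdry /rect /= xab.
    by case: yy => ->; rewrite lexx cd; split => //; [constructor 3|constructor 4].
  have := cint_FTC ab S D; rewrite mul1r -!hx => <-.
  by apply: cint_ext => x _; rewrite -hx.
have V x : (x = a \/ x = b) -> 'i%C * cint c d (fun y => f (x +i* y)) = F (x +i* d) - F (x +i* c).
  move=> xx.
  have S : scont c d (fun y => f (x%:C + y%:C * 'i%C)).
    suff <- : (fun y => f (x +i* y)) = (fun y => f (x%:C + y%:C * 'i%C)) by case: xx => ->.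
    by apply/funext => y; rewrite -hy.
  have D y : c <= y <= d -> cder F (x%:C + y%:C * 'i%C) (f (x%:C + y%:C * 'i%C)).
    move=> ycd; rewrite -hy; apply: hF; rewrite /bdry /rect /= ycd.
    by case: xx => ->; rewrite lexx ab; split => //; [constructor 1|constructor 2].
  have := cint_FTC cd S D; rewrite -!hy => <-.
  by congr (_ * _); apply: cint_ext => y _; rewrite -hy.
rewrite /rint mulrBr !H ?V; try by [left|right].
ring.
Qed.

Lemma rint_affine (p q : C) a b c d : a <= b -> c <= d ->
  rint (fun z => p + q * z) a b c d = 0.
Proof.
move=> ab cd.
have hd z : cder (fun z => p * z + (q / 2) * (z * z)) z (p + q * z).
  apply: cder_eq (cderD (cderZ p (cder_id z)) (cderZ (q / 2) (cderM (cder_id z) (cder_id z)))) _.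
  by field.
have hc z : cder (fun z => p + q * z) z (0 + q * 1).
  exact: (cderD (cder_cst p z) (cderZ q (cder_id z))).
apply: (@rint_primitive _ (fun z => p * z + (q / 2) * (z * z))) => //.
by apply: bdry_sides => // z _; exact: (cder_ccont (hc z)).
Qed.

Lemma rectS a b c d a' b' c' d' z : a <= a' -> b' <= b -> c <= c' -> d' <= d ->
  rect a' b' c' d' z -> rect a b c d z.
Proof.
move=> h1 h2 h3 h4 /andP[/andP[k1 k2] /andP[k3 k4]]; rewrite /rect.
by rewrite (le_trans h1)//= (le_trans k2)//= (le_trans h3)//= (le_trans k4).
Qed.

Local Notation quad := (R * R * R * R)%type.
Definition qint f (q : quad) : C := let: (a, b, c, d) := q in rint f a b c d.

(** Bisection step of Goursat's argument: select a quarter that carries at least a fourth of the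
    integral. The last one needs no test, since the four integrals add up to the whole. *)
Definition quarter f (q : quad) : quad := let: (a, b, c, d) := q in
  let s := (a + b) / 2 in let t := (c + d) / 2 in
  if n1 (qint f q) <= 4 * n1 (rint f a s c t) then (a, s, c, t) else
  if n1 (qint f q) <= 4 * n1 (rint f a s t d) then (a, s, t, d) else
  if n1 (qint f q) <= 4 * n1 (rint f s b c t) then (s, b, c, t) else (s, b, t, d).

Let quarter_aux (m p q r t : R) : m <= p + q + (r + t) -> 4 * p < m -> 4 * q < m -> 4 * r < m ->
  m <= 4 * t.
Proof. lra. Qed.

Lemma quarterP f a b c d : a <= b -> c <= d -> (forall z, rect a b c d z -> ccont f z) ->
  let: (a', b', c', d') := quarter f (a, b, c, d) in
  [/\ a <= a', a' <= b', b' <= b, c <= c' & c' <= d'] /\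
  [/\ d' <= d, b' - a' = (b - a) / 2, d' - c' = (d - c) / 2 &
   n1 (rint f a b c d) <= 4 * n1 (rint f a' b' c' d')].
Proof.
move=> ab cd hf; rewrite /quarter /=.
set s := (a + b) / 2; set t := (c + d) / 2.
have as' : a <= s by rewrite /s; lra.
have sb : s <= b by rewrite /s; lra.
have ct : c <= t by rewrite /t; lra.
have td : t <= d by rewrite /t; lra.
have sd a' b' c' d' : a <= a' -> a' <= b' -> b' <= b -> c <= c' -> c' <= d' -> d' <= d -> sides f a' b' c' d'.
  by move=> *; apply: bdry_sides => // z /bdry_rect hz; apply: hf; apply: rectS hz.
have E : rint f a b c d = rint f a s c t + rint f a s t d + (rint f s b c t + rint f s b t d).
  rewrite (@rint_splitx f s)//; last 2 first.
    by rewrite as' sb.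
    by apply: sd.
  rewrite (@rint_splity f t a s)//; last 2 first.
    by rewrite ct td.
    by apply: sd.
  by rewrite (@rint_splity f t s b)//; [rewrite ct td|apply: sd].
have T : n1 (rint f a b c d) <= n1 (rint f a s c t) + n1 (rint f a s t d) + (n1 (rint f s b c t) + n1 (rint f s b t d)).
  rewrite E; apply: le_trans (n1D _ _) _; apply: lerD; exact: n1D.
case: ifPn => [h|].
  by split; [split|split; [|rewrite /s; field|rewrite /t; field|]].
rewrite -ltNge => h1.
case: ifPn => [h|].
  by split; [split|split; [|rewrite /s; field|rewrite /t; field|]].
rewrite -ltNge => h2.
case: ifPn => [h|].
  by split; [split|split; [|rewrite /s; field|rewrite /t; field|]].
rewrite -ltNge => h3.
split; first by split.
apply: And4; [exact: lexx|by rewrite /s; field|by rewrite /t; field|].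
exact: quarter_aux T h1 h2 h3.
Qed.

Lemma nested_intervals (u v : nat -> R) : (forall n, u n <= u n.+1) -> (forall n, v n.+1 <= v n) ->
  (forall n, u n <= v n) -> exists x, forall n, u n <= x <= v n.
Proof.
move=> hu hv uv.
have muu m n : (m <= n)%N -> u m <= u n.
  by move=> /subnK <-; elim: (n - m)%N => [|k ih]; rewrite ?add0n// addSn (le_trans ih).
have mvv m n : (m <= n)%N -> v n <= v m.
  by move=> /subnK <-; elim: (n - m)%N => [|k ih]; rewrite ?add0n// addSn (le_trans _ ih).
have huv m n : u m <= v n.
  apply: le_trans (muu _ _ (leq_maxl m n)) _; apply: le_trans (uv _) _.
  exact: mvv (leq_maxr m n).
have hs : has_sup (range u).
  by split; [exists (u 0%N); exists 0%N|exists (v 0%N) => _ [n _ <-]].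
exists (sup (range u)) => n; apply/andP; split.
  by apply: ub_le_sup; [case: hs|exists n].
by apply: ge_sup; [case: hs|move=> _ [m _ <-]].
Qed.

(** After n bisections the integral is still at least 4^-n of the original one. But f minus its
    tangent at the common point is o(2^-n) on a contour of length O(2^-n), and the affine part
    integrates to 0. *)
Lemma goursat f a b c d : a <= b -> c <= d ->
  (forall z, rect a b c d z -> exists l, cder f z l) -> rint f a b c d = 0.
Proof.
move=> ab cd hf; apply: n1_eq0; apply/eqP; rewrite eq_le n1_ge0 andbT.
have hc z : rect a b c d z -> ccont f z by move=> /hf[l /cder_ccont].
pose q n := iter n (quarter f) (a, b, c, d).
pose A n := (q n).1.1.1; pose B n := (q n).1.1.2; pose K n := (q n).1.2; pose D n := (q n).2.
have qE n : q n = (A n, B n, K n, D n) by rewrite /A /B /K /D; case: (q n) => [[[]]].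
have inv n : [/\ a <= A n, A n <= B n, B n <= b, c <= K n & K n <= D n] /\ D n <= d.
  elim: n => [|n [[h1 h2 h3 h4 h5] h6]] //.
  have hc' z : rect (A n) (B n) (K n) (D n) z -> ccont f z by move=> hz; apply: hc; apply: rectS hz.
  have := quarterP h2 h5 hc'; rewrite -qE -[quarter f (q n)]/(q n.+1) qE.
  move=> [[k1 k2 k3 k4 k5] [k6 k7 k8 k9]]; split; last exact: le_trans h6.
  split => //; [exact: le_trans k1|exact: le_trans h3|exact: le_trans k4].
have step n : [/\ A n <= A n.+1, B n.+1 <= B n, K n <= K n.+1 & D n.+1 <= D n] /\
   [/\ B n.+1 - A n.+1 = (B n - A n) / 2, D n.+1 - K n.+1 = (D n - K n) / 2 &
   n1 (rint f (A n) (B n) (K n) (D n)) <= 4 * n1 (rint f (A n.+1) (B n.+1) (K n.+1) (D n.+1))].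
  have [[h1 h2 h3 h4 h5] h6] := inv n.
  have hc' z : rect (A n) (B n) (K n) (D n) z -> ccont f z by move=> hz; apply: hc; apply: rectS hz.
  have := quarterP h2 h5 hc'; rewrite -qE -[quarter f (q n)]/(q n.+1) qE.
  by move=> [[k1 k2 k3 k4 k5] [k6 k7 k8 k9]].
have wd n : (B n - A n) + (D n - K n) = ((b - a) + (d - c)) / 2 ^+ n.
  elim: n => [|n ih]; first by rewrite expr0 divr1.
  by have [_ [-> -> _]] := step n; rewrite -mulrDl ih exprSr invfM mulrA.
have it n : n1 (rint f a b c d) <= 4 ^+ n * n1 (rint f (A n) (B n) (K n) (D n)).
  elim: n => [|n ih]; first by rewrite expr0 mul1r.
  apply: le_trans ih _; have [_ [_ _ h]] := step n.
  by rewrite exprSr -mulrA ler_wpM2l// exprn_ge0.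
have [x hx] : exists x, forall n, A n <= x <= B n.
  by apply: nested_intervals => n; have [[]] := step n; have [[]] := inv n.
have [y hy] : exists y, forall n, K n <= y <= D n.
  by apply: nested_intervals => n; have [[]] := step n; have [[]] := inv n.
have [l hl] : exists l, cder f (x +i* y) l.
  by apply: hf; rewrite /rect /=; have := hx 0%N; have := hy 0%N => /= -> ->.
set W := (b - a) + (d - c).
have W0 : 0 <= W by rewrite /W; lra.
apply/ler_addgt0Pr => e e0; rewrite add0r.
(* The final bound is twice this constant times W^2, hence at most e; the + 1 covers a degenerate
   rectangle with W = 0. *)
have e1 : 0 < e / (2 * (W ^+ 2 + 1)).
  by rewrite divr_gt0// mulr_gt0// ltr_wpDl ?sqr_ge0.
move/cderP : hl => /(_ _ e1)[r r0 hr].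
have [n hn] : exists n, W / 2 ^+ n < r.
  have [n _ hn] : exists2 n, True & W / r < 2 ^+ n.
    exists (Num.truncn (W / r)).+1 => //.
    apply: lt_trans (truncnS_gt _) _.
    by rewrite -natrX ltr_nat ltn_expl.
  by exists n; rewrite ltr_pdivrMr ?exprn_gt0// mulrC -ltr_pdivrMr.
have [[h1 h2 h3 h4 h5] h6] := inv n.
set E := (fun z : C => f z - (f (x +i* y) - l * (x +i* y) + l * z)).
have sf : sides f (A n) (B n) (K n) (D n).
  by apply: bdry_sides => // z /bdry_rect hz; apply: hc; apply: rectS hz.
have sl : sides (fun z => f (x +i* y) - l * (x +i* y) + l * z) (A n) (B n) (K n) (D n).
  apply: bdry_sides => // z _; apply: cder_ccont.
  exact: (cderD (cder_cst _ z) (cderZ l (cder_id z))).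
have rE : rint f (A n) (B n) (K n) (D n) = rint E (A n) (B n) (K n) (D n).
  by rewrite /E rintB// rint_affine// subr0.
apply: le_trans (it n) _.
have bE : n1 (rint E (A n) (B n) (K n) (D n)) <= 2 * (e / (2 * (W ^+ 2 + 1)) * (W / 2 ^+ n)) * (W / 2 ^+ n).
  rewrite -{2}wd; apply: (n1_rint h2 h5 (sidesB sf sl)).
  move=> z /bdry_rect/andP[/andP[k1 k2] /andP[k3 k4]].
  have zn : n1 (z - (x +i* y)) <= W / 2 ^+ n.
    rewrite -wd; case: z k1 k2 k3 k4 => p s /= k1 k2 k3 k4; rewrite n1_ri.
    have /andP[? ?] := hx n; have /andP[? ?] := hy n.
    by apply: lerD; rewrite ler_norml; lra.
  have := hr _ (le_lt_trans zn hn).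
  have -> : f z - f (x +i* y) - l * (z - (x +i* y)) = E z by rewrite /E; ring.
  by move=> hh; apply: le_trans hh _; rewrite ler_wpM2l// ltW.
rewrite rE; apply: le_trans (ler_wpM2l _ bE) _; first by rewrite exprn_ge0.
have -> : (4 ^+ n : R) = 2 ^+ n * 2 ^+ n by rewrite -exprMn; congr (_ ^+ _); ring.
have p2 : (2 ^+ n : R) != 0 by rewrite expf_eq0 pnatr_eq0 andbF.
have W2 : W ^+ 2 + 1 != 0 by rewrite gt_eqF// ltr_wpDl ?sqr_ge0.
have -> : 2 ^+ n * 2 ^+ n * (2 * (e / (2 * (W ^+ 2 + 1)) * (W / 2 ^+ n)) * (W / 2 ^+ n)) = e * (W ^+ 2 / (W ^+ 2 + 1)).
  by field; rewrite W2.
apply: ler_piMr; first exact: ltW.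
by rewrite ler_pdivrMr; [rewrite mul1r lerDl|rewrite ltr_wpDl// sqr_ge0].
Qed.

End RectangleIntegral.

(** * Cauchy's formula on rectangles *)

Section CauchyFormula.
Variable R : realType.
Local Notation C := (R[i]).
Implicit Types (f g : C -> C) (a b c d x y p q r : R) (z w v : C).

Definition chol f z := exists l, cder f z l.

Lemma chol_ccont f z : chol f z -> ccont f z.
Proof. by case=> l /cder_ccont. Qed.

Lemma chol_cderiv f z : chol f z -> cder f z (cderiv f z).
Proof. by case=> l h; rewrite (cder_cderiv h). Qed.

Lemma cholM f g z : chol f z -> chol g z -> chol (fun t => f t * g t) z.
Proof. by move=> [l hl] [m hm]; eexists; exact: cderM hl hm. Qed.

Lemma chol_div f g z : chol f z -> chol g z -> g z != 0 -> chol (fun t => f t / g t) z.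
Proof. by move=> [l hl] [m hm] g0; eexists; exact: cder_div hl hm g0. Qed.

Lemma cholB f g z : chol f z -> chol g z -> chol (fun t => f t - g t) z.
Proof. by move=> [l hl] [m hm]; eexists; exact: cderB hl hm. Qed.

Lemma chol_cst w z : chol (fun=> w) z.
Proof. by eexists; exact: cder_cst. Qed.

Lemma cder_subr v z : cder (fun t => t - v) z 1.
Proof. by apply: cder_eq (cderB (cder_id z) (cder_cst v z)) _; rewrite subr0. Qed.

Lemma chol_subr v z : chol (fun t => t - v) z.
Proof. by eexists; exact: cder_subr. Qed.

Lemma cholX f z n : chol f z -> chol (fun t => f t ^+ n) z.
Proof. by move=> [l hl]; eexists; exact: cderX hl. Qed.

Lemma chol_near f g z (e : R) : 0 < e -> (forall w, n1 (w - z) < e -> f w = g w) -> chol f z -> chol g z.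
Proof. by move=> e0 h [l hl]; exists l; exact: cder_near e0 h hl. Qed.

Definition inside a b c d w := (a < complex.Re w < b) && (c < complex.Im w < d).

Lemma inside_bdry a b c d w z : inside a b c d w -> bdry a b c d z -> z - w != 0.
Proof.
move=> /andP[/andP[h1 h2] /andP[h3 h4]] [_ h]; rewrite subr_eq0.
by apply/eqP => zw; move: h1 h2 h3 h4; rewrite -zw; case: h => ->; rewrite ltxx.
Qed.

Lemma inside_rect a b c d w : inside a b c d w -> rect a b c d w.
Proof. by move=> /andP[/andP[h1 h2] /andP[h3 h4]]; rewrite /rect !ltW. Qed.

Lemma inside_le a b c d w : inside a b c d w -> a <= b /\ c <= d.
Proof.
by move=> /andP[/andP[h1 h2] /andP[h3 h4]]; split; rewrite ltW// ?(lt_trans h1)// (lt_trans h3).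
Qed.

(** Four cuts detach the small square. Each piece cut off avoids [p +i* q], the only possible
    singularity, so [goursat] kills it. *)
Lemma rint_shrink f a b c d p q r : 0 < r ->
  a < p - r -> p + r < b -> c < q - r -> q + r < d ->
  (forall z, rect a b c d z -> z != p +i* q -> chol f z) ->
  rint f a b c d = rint f (p - r) (p + r) (q - r) (q + r).
Proof.
move=> r0 h1 h2 h3 h4 hf.
have [e1 e2 e3] : [/\ a <= p - r, p - r <= p + r & p + r <= b] by split; lra.
have [e4 e5 e6] : [/\ c <= q - r, q - r <= q + r & q + r <= d] by split; lra.
have e7 := le_trans e2 e3; have e8 := le_trans e5 e6.
have e9 := le_trans e1 e7; have e10 := le_trans e4 e8.
have e11 := le_trans e1 e2; have e12 := le_trans e4 e5.
have hs a' b' c' d' : a <= a' -> a' <= b' -> b' <= b -> c <= c' -> c' <= d' -> d' <= d ->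
    (forall z, bdry a' b' c' d' z -> z != p +i* q) -> sides f a' b' c' d'.
  move=> k1 k2 k3 k4 k5 k6 hne; apply: bdry_sides => // z hz; apply: chol_ccont.
  by apply: hf; [apply: rectS (bdry_rect hz)|apply: hne].
have hg a' b' c' d' : a <= a' -> a' <= b' -> b' <= b -> c <= c' -> c' <= d' -> d' <= d ->
    (forall z, rect a' b' c' d' z -> z != p +i* q) -> rint f a' b' c' d' = 0.
  move=> k1 k2 k3 k4 k5 k6 hne; apply: goursat => // z hz.
  by apply: hf; [apply: rectS hz|apply: hne].
have E1 : rint f a b c d = rint f (p - r) b c d.
  rewrite (@rint_splitx _ f (p - r)); last 2 first.
  - by apply/andP; split.
  - apply: hs => //.
    by move=> [x y] [_ /= h]; rewrite eq_complex /=; apply/negP => /andP[/eqP ? /eqP ?]; case: h => ?; lra.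
  rewrite hg ?add0r//.
  by move=> [x y] /andP[/= h _]; rewrite eq_complex /=; apply/negP => /andP[/eqP ? /eqP ?]; lra.
have E2 : rint f (p - r) b c d = rint f (p - r) (p + r) c d.
  rewrite (@rint_splitx _ f (p + r)); last 2 first.
  - by apply/andP; split.
  - apply: hs => //.
    by move=> [x y] [_ /= h]; rewrite eq_complex /=; apply/negP => /andP[/eqP ? /eqP ?]; case: h => ?; lra.
  rewrite (hg (p + r)) ?addr0//.
  by move=> [x y] /andP[/= h _]; rewrite eq_complex /=; apply/negP => /andP[/eqP ? /eqP ?]; lra.
have E3 : rint f (p - r) (p + r) c d = rint f (p - r) (p + r) (q - r) d.
  rewrite (@rint_splity _ f (q - r)); last 2 first.
  - by apply/andP; split.
  - apply: hs => //.
    by move=> [x y] [_ /= h]; rewrite eq_complex /=; apply/negP => /andP[/eqP ? /eqP ?]; case: h => ?; lra.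
  rewrite hg ?add0r//.
  by move=> [x y] /andP[/= _ h]; rewrite eq_complex /=; apply/negP => /andP[/eqP ? /eqP ?]; lra.
rewrite E1 E2 E3 (@rint_splity _ f (q + r)); last 2 first.
- by apply/andP; split.
- apply: hs => //.
  by move=> [x y] [_ /= h]; rewrite eq_complex /=; apply/negP => /andP[/eqP ? /eqP ?]; case: h => ?; lra.
rewrite [X in _ + X]hg ?addr0//.
by move=> [x y] /andP[/= _ h]; rewrite eq_complex /=; apply/negP => /andP[/eqP ? /eqP ?]; lra.
Qed.

Lemma inside_margin a b c d p q : inside a b c d (p +i* q) -> exists2 r : R, 0 < r &
  forall s, s <= r -> [/\ a < p - s, p + s < b, c < q - s & q + s < d].
Proof.
move=> /andP[/andP[/= h1 h2] /andP[h3 h4]].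
exists (Num.min (Num.min (p - a) (b - p)) (Num.min (q - c) (d - q)) / 2).
  by rewrite divr_gt0// !lt_min !subr_gt0 h1 h2 h3 h4.
move=> s; rewrite ler_pdivlMr// !le_min => /andP[/andP[k1 k2] /andP[k3 k4]].
by split; lra.
Qed.

(** Removable singularities in integral form: the contour is moved to a square of half-side s around
    w, where a bounded function over a length O(s) contributes O(s). *)
Lemma goursat_pt f a b c d w M (e : R) : inside a b c d w -> 0 < e ->
  (forall z, rect a b c d z -> z != w -> chol f z) ->
  (forall z, n1 (z - w) < e -> z != w -> n1 (f z) <= M) -> rint f a b c d = 0.
Proof.
case: w => p q hin e0 hf hM; apply: n1_eq0; apply/eqP; rewrite eq_le n1_ge0 andbT.
have [r r0 hr] := inside_margin hin.
apply/ler_addgt0Pr => e' e'0; rewrite add0r.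
have M0 : 0 < `|M| + 1 by rewrite ltr_wpDl.
(* In turn: the square stays inside the rectangle, it stays where f is bounded (n1 <= 2 s < e), and
   2 * |M| * 4 s <= e'. *)
set s := Num.min (Num.min r (e / 4)) (e' / (8 * (`|M| + 1))).
have s0 : 0 < s by rewrite !lt_min r0 !divr_gt0// mulr_gt0.
have sr : s <= r by rewrite !ge_min lexx.
have se : s <= e / 4 by rewrite !ge_min lexx orbT.
have se' : s <= e' / (8 * (`|M| + 1)) by rewrite !ge_min lexx orbT.
have [k1 k2 k3 k4] := hr s sr.
rewrite (rint_shrink s0 k1 k2 k3 k4 hf).
have ne z : bdry (p - s) (p + s) (q - s) (q + s) z -> z != p +i* q.
  rewrite -subr_eq0; apply: inside_bdry; rewrite /inside /=.
  by apply/andP; split; apply/andP; split; lra.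
have hne z : bdry (p - s) (p + s) (q - s) (q + s) z -> chol f z.
  move=> hz; apply: hf; last exact: ne.
  by apply: rectS (bdry_rect hz); exact: ltW.
have hb z : bdry (p - s) (p + s) (q - s) (q + s) z -> n1 (f z) <= `|M|.
  move=> hz; apply: le_trans (ler_norm _); apply: hM; last exact: ne.
  case: z hz => x y [/andP[/= /andP[? ?] /andP[? ?]] _]; rewrite n1_ri.
  have : `|x - p| <= s by rewrite ler_norml; lra.
  have : `|y - q| <= s by rewrite ler_norml; lra.
  lra.
have hsd : sides f (p - s) (p + s) (q - s) (q + s).
  by apply: bdry_sides => [||z /hne/chol_ccont//]; lra.
have := @n1_rint R f (p - s) (p + s) (q - s) (q + s) `|M| _ _ hsd hb.
move=> /(_ _ _)H; apply: le_trans (H _ _) _; try lra.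
move: se'; rewrite ler_pdivlMr ?mulr_gt0//.
have := normr_ge0 M; nra.
Qed.

End CauchyFormula.

Section CauchyFormula.
Variable R : realType.
Local Notation C := (R[i]).
Implicit Types (f g : C -> C) (a b c d x y p q r : R) (z w v : C).

(** On a square centred at the pole, the values of 1 / z on opposite sides differ by the kernel 2 r
    / (u^2 + r^2), whose primitive is an arctangent. *)
Lemma invc_diff_h (u r : R) : 0 < r ->
  (u +i* - r)^-1 - (u +i* r)^-1 = 0 +i* (2 * r / (u ^+ 2 + r ^+ 2)) :> C.
Proof.
move=> r0; have n0 : u ^+ 2 + r ^+ 2 != 0 by rewrite gt_eqF// ltr_wpDl ?sqr_ge0// exprn_gt0.
apply/eqP; rewrite eq_complex /=; apply/andP; split; apply/eqP; rewrite ?sqrrN; field => //.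
Qed.

Lemma invc_diff_v (u r : R) : 0 < r ->
  (r +i* u)^-1 - (- r +i* u)^-1 = (2 * r / (u ^+ 2 + r ^+ 2)) +i* 0 :> C.
Proof.
move=> r0; have n0 : u ^+ 2 + r ^+ 2 != 0 by rewrite gt_eqF// ltr_wpDl ?sqr_ge0// exprn_gt0.
have n1' : r ^+ 2 + u ^+ 2 != 0 by rewrite addrC.
apply/eqP; rewrite eq_complex /=; apply/andP; split; apply/eqP; rewrite ?sqrrN; field; rewrite ?n0 ?n1' //.
Qed.

Lemma atan_scaled p r x : 0 < r ->
  is_derive x 1 (fun x => 2 * atan ((x - p) / r)) (2 * r / ((x - p) ^+ 2 + r ^+ 2)).
Proof.
move=> r0.
have hd : is_derive x 1 (fun x : R => (x - p) / r) (r^-1).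
  apply: is_derive_eq; rewrite /GRing.scale /=.
  by rewrite mulr0 add0r subr0 mulr1.
have h := @is_derive1_comp R atan (fun x : R => (x - p) / r) x _ _ (is_derive1_atan ((x - p) / r)) hd.
have hh : is_derive x 1 (fun x => 2 * atan ((x - p) / r)) (2 * ((1 + ((x - p) / r) ^+ 2)^-1 * r^-1)).
  exact: (@is_deriveZ R R R _ 2 x 1 _ h).
apply: is_derive_eq hh _.
have n0 : (x - p) ^+ 2 + r ^+ 2 != 0 by rewrite gt_eqF// ltr_wpDl ?sqr_ge0// exprn_gt0.
have n2 : 1 + ((x - p) / r) ^+ 2 != 0 by rewrite gt_eqF// ltr_wpDr ?sqr_ge0.
by move: n0 n2; set u := x - p; move: u => u n0 n2; field; rewrite n0 gt_eqF.
Qed.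

Lemma Rint_atan p r : 0 < r ->
  (\int[@lebesgue_measure R]_(x in `[p - r, p + r]) (2 * r / ((x - p) ^+ 2 + r ^+ 2)))%R = pi.
Proof.
move=> r0; have H (x : R) : p - r <= x <= p + r -> is_derive x 1 (fun x => 2 * atan ((x - p) / r)) (2 * r / ((x - p) ^+ 2 + r ^+ 2)).
  by move=> _; exact: atan_scaled.
rewrite (Rint_FTC _ _ H); first last.
- move=> x _.
  have n0 : (x - p) ^+ 2 + r ^+ 2 != 0 by rewrite gt_eqF// ltr_wpDl ?sqr_ge0// exprn_gt0.
  apply: cvgM; first exact: cvg_cst.
  apply: cvgV => //; apply: cvgD; last exact: cvg_cst.
  by apply: cvgM; apply: cvgB; [exact: cvg_id|exact: cvg_cst|exact: cvg_id|exact: cvg_cst].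
- lra.
have -> : (p + r - p) / r = 1 by field; rewrite gt_eqF.
have -> : (p - r - p) / r = -1 by field; rewrite gt_eqF.
rewrite atanN atan1; lra.
Qed.

Definition tpi : C := 2%:R * 'i%C * pi%:C.

Lemma tpi_neq0 : tpi != 0.
Proof.
rewrite !mulf_neq0// ?pnatr_eq0//.
- by rewrite eq_complex /= oner_eq0 andbF.
- by rewrite eq_complex /= negb_and gt_eqF ?pi_gt0.
Qed.

(** After shrinking to a centred square, each pair of opposite sides contributes i pi by
    [Rint_atan]. *)
Lemma rint_inv a b c d w : inside a b c d w -> rint (fun z => (z - w)^-1) a b c d = tpi.
Proof.
case: w => p q hin.
have [r r0 hr] := inside_margin hin.
have [k1 k2 k3 k4] := hr r (lexx r).
have hol z : z != p +i* q -> chol (fun z => (z - (p +i* q))^-1) z.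
  by move=> zw; eexists; apply: cderV (cder_subr _ _) _; rewrite subr_eq0.
rewrite (rint_shrink r0 k1 k2 k3 k4) => [|z _ zw]; last exact: hol.
have [s1 s2 s3 s4] : sides (fun z => (z - (p +i* q))^-1) (p - r) (p + r) (q - r) (q + r).
  apply: bdry_sides => [||z hz]; try lra.
  apply: chol_ccont; apply: hol; rewrite -subr_eq0; apply: inside_bdry hz.
  by rewrite /inside /=; apply/andP; split; apply/andP; split; lra.
rewrite /rint -!cintB//.
have H (x : R) : ((x +i* (q - r)) - (p +i* q))^-1 - ((x +i* (q + r)) - (p +i* q))^-1 =
    0 +i* (2 * r / ((x - p) ^+ 2 + r ^+ 2)).
  rewrite -(invc_diff_h (x - p) r0); congr (_^-1 - _^-1); apply/eqP; rewrite eq_complex /=;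
  by apply/andP; split; apply/eqP; ring.
have V (y : R) : (((p + r) +i* y) - (p +i* q))^-1 - (((p - r) +i* y) - (p +i* q))^-1 =
    (2 * r / ((y - q) ^+ 2 + r ^+ 2)) +i* 0.
  rewrite -(invc_diff_v (y - q) r0); congr (_^-1 - _^-1); apply/eqP; rewrite eq_complex /=;
  by apply/andP; split; apply/eqP; ring.
have Z (u v : R) : u <= v -> (\int[@lebesgue_measure R]_(x in `[u, v]) (0:R))%R = 0.
  move=> uv; rewrite (@Rint_FTC _ _ _ _ (fun=> 0 : R) uv _ (fun _ _ => is_derive_cst _ _ _)) ?subrr//.
  by move=> x _; exact: cvg_cst.
rewrite (cint_ext (g := fun x => 0 +i* (2 * r / ((x - p) ^+ 2 + r ^+ 2)))); last by move=> x _; exact: H.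
rewrite (cint_ext (a := q - r) (g := fun y => (2 * r / ((y - q) ^+ 2 + r ^+ 2)) +i* 0)); last by move=> x _; exact: V.
have hp : p - r <= p + r by lra.
have hq : q - r <= q + r by lra.
rewrite /cint /= !Rint_atan// !Z//.
rewrite /tpi; apply/eqP; rewrite eq_complex /=; apply/andP; split; apply/eqP; ring.
Qed.

Lemma sides_hol f a b c d : a <= b -> c <= d -> (forall z, rect a b c d z -> chol f z) -> sides f a b c d.
Proof. by move=> ab cd hf; apply: bdry_sides => // z /bdry_rect/hf/chol_ccont. Qed.

Lemma sides_invX n a b c d w : inside a b c d w -> sides (fun z => ((z - w) ^+ n)^-1) a b c d.
Proof.
move=> hin; have [ab cd] := inside_le hin.
apply: bdry_sides => // z hz; apply: chol_ccont; have := inside_bdry hin hz => zw.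
by eexists; apply: cderV (cderX n (cder_subr w z)) _; rewrite expf_eq0 (negbTE zw) andbF.
Qed.

Lemma sides_inv a b c d w : inside a b c d w -> sides (fun z => (z - w)^-1) a b c d.
Proof. by move=> /(sides_invX 1). Qed.

(** The difference quotient of f at w is bounded near w, so its integral vanishes by [goursat_pt];
    what remains is f w times [rint_inv]. *)
Lemma cauchy_rect f a b c d w : inside a b c d w -> (forall z, rect a b c d z -> chol f z) ->
  rint (fun z => f z / (z - w)) a b c d = tpi * f w.
Proof.
move=> hin hf; have [ab cd] := inside_le hin.
have sf := sides_hol ab cd hf; have si := sides_inv hin.
have E : rint (fun z => (f z - f w) / (z - w)) a b c d = 0.
  have /chol_cderiv/cderP/(_ _ ltr01)[e e0 he] := hf _ (inside_rect hin).
  apply: (@goursat_pt _ _ _ _ _ _ w ((1 + n1 (cderiv f w)) * 2) e) => //.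
  - move=> z hz zw; apply: chol_div (chol_subr _ _) _; last by rewrite subr_eq0.
    exact: cholB (hf _ hz) (chol_cst _ _).
  - move=> z ze zw; have := he z ze; rewrite mul1r => h.
    have h2 : n1 (f z - f w) <= (1 + n1 (cderiv f w)) * n1 (z - w).
      have -> : f z - f w = (f z - f w - cderiv f w * (z - w)) + cderiv f w * (z - w) by rewrite subrK.
      by apply: le_trans (n1D _ _) _; have := n1M (cderiv f w) (z - w); lra.
    have zw0 : 0 < n1 (z - w) by rewrite n1_gt0// subr_eq0.
    apply: le_trans (n1M _ _) _.
    apply: le_trans (ler_pM (n1_ge0 _) (n1_ge0 _) h2 (n1V _)) _.
    by rewrite le_eqVlt; apply/orP; left; apply/eqP; field; rewrite gt_eqF.
have := E; rewrite (rint_ext (g := fun z => f z / (z - w) - f w * (z - w)^-1))//; last first.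
  by move=> z _; rewrite mulrBl.
rewrite rintB; last 2 first.
- exact: (sidesM sf si).
- exact: (sidesZ _ si).
by rewrite rintZ// rint_inv// => /eqP; rewrite subr_eq0 => /eqP ->; rewrite mulrC.
Qed.

End CauchyFormula.

(** * Analyticity and zeros *)

Section Analyticity.
Variable R : realType.
Local Notation C := (R[i]).
Implicit Types (f g : C -> C) (a b c d x y p q r : R) (z w v : C).

Lemma scont_bounded a b (f : R -> C) : a <= b -> scont a b f ->
  exists M, forall x, a <= x <= b -> n1 (f x) <= M.
Proof.
move=> ab hf; have [c _ hc] := EVT_max ab (continuous_sub_within (scont_n1 hf)).
by exists (n1 (f c)) => x xab; apply: (hc x); rewrite in_itv.
Qed.

Lemma sides_bounded f a b c d : a <= b -> c <= d -> sides f a b c d ->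
  exists2 M, 0 < M & forall z, bdry a b c d z -> n1 (f z) <= M.
Proof.
move=> ab cd [f1 f2 f3 f4].
have [M1 h1] := scont_bounded ab f1; have [M2 h2] := scont_bounded ab f2.
have [M3 h3] := scont_bounded cd f3; have [M4 h4] := scont_bounded cd f4.
exists (`|M1| + `|M2| + `|M3| + `|M4| + 1) => [|[x y] [/andP[/= xab ycd] h]].
  by rewrite ltr_wpDl// !addr_ge0.
have L (u v s t : R) : `|u| + `|v| + `|s| + `|t| + 1 >= u /\ `|u| + `|v| + `|s| + `|t| + 1 >= v /\
   `|u| + `|v| + `|s| + `|t| + 1 >= s /\ `|u| + `|v| + `|s| + `|t| + 1 >= t.
  have := ler_norm u; have := ler_norm v; have := ler_norm s; have := ler_norm t.
  have := normr_ge0 u; have := normr_ge0 v; have := normr_ge0 s; have := normr_ge0 t.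
  by move=> *; split; [lra|split; [lra|split; lra]].
have [L1 [L2 [L3 L4]]] := L M1 M2 M3 M4.
case: h => ->.
- by apply: le_trans L3; exact: h3.
- by apply: le_trans L4; exact: h4.
- by apply: le_trans L1; exact: h1.
- by apply: le_trans L2; exact: h2.
Qed.

Definition margin r a b c d w :=
  [&& a <= complex.Re w - r, complex.Re w + r <= b, c <= complex.Im w - r & complex.Im w + r <= d].

Lemma inside_has_margin a b c d w : inside a b c d w -> exists2 r, 0 < r & margin r a b c d w.
Proof.
case: w => p q h; have [r r0 hr] := inside_margin h; exists r => //.
by have [h1 h2 h3 h4] := hr r (lexx r); rewrite /margin /= !ltW.
Qed.

Lemma margin_dist r a b c d w z : margin r a b c d w -> bdry a b c d z -> r <= n1 (z - w).
Proof.
case: z w => x y [p q] /and4P[/= h1 h2 h3 h4] [_ /= h]; rewrite n1_ri.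
have := ler_norm (x - p); have := ler_norm (p - x); have := ler_norm (y - q); have := ler_norm (q - y).
have := normr_ge0 (x - p); have := normr_ge0 (y - q).
by rewrite (distrC p) (distrC q); case: h => ->; lra.
Qed.

Lemma margin_inside r a b c d w v : margin r a b c d w -> n1 (v - w) < r -> inside a b c d v.
Proof.
case: v w => x y [p q] /and4P[/= h1 h2 h3 h4]; rewrite n1_ri /inside /= => h.
have := ler_norm (x - p); have := ler_norm (p - x); have := ler_norm (y - q); have := ler_norm (q - y).
have := normr_ge0 (x - p); have := normr_ge0 (y - q).
rewrite (distrC p) (distrC q) => *.
by apply/andP; split; apply/andP; split; lra.
Qed.

Lemma n1V_le z r : 0 < r -> r <= n1 z -> n1 z^-1 <= 2 / r.
Proof.
move=> r0 h; apply: le_trans (n1V _) _.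
by rewrite ler_wpM2l// lef_pV2 ?posrE// (lt_le_trans r0).
Qed.

(** Differentiation under the integral sign: a remainder that is quadratic in v - w, uniformly on
    the boundary, survives integration. *)
Lemma cder_rint f (k : C -> C -> C) (k' : C -> C) a b c d w (e K : R) :
  a <= b -> c <= d -> 0 < e -> sides f a b c d ->
  (forall v, n1 (v - w) < e -> sides (k v) a b c d) -> sides k' a b c d ->
  (forall v z, n1 (v - w) < e -> bdry a b c d z ->
     n1 (k v z - k w z - (v - w) * k' z) <= K * n1 (v - w) ^+ 2) ->
  cder (fun v => rint (fun z => f z * k v z) a b c d) w (rint (fun z => f z * k' z) a b c d).
Proof.
move=> ab cd e0 sf sk sk' hK; apply/cderP => e1 e10.
have [M M0 hM] := sides_bounded ab cd sf.
set P := (b - a) + (d - c).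
have P0 : 0 <= P by rewrite /P; lra.
have W0 : 0 < 2 * M * (`|K| + 1) * (P + 1).
  by rewrite !mulr_gt0// ltr_wpDl.
exists (Num.min e (e1 / (2 * M * (`|K| + 1) * (P + 1)))) => [|v].
  by rewrite lt_min e0 divr_gt0.
rewrite lt_min => /andP[v1 v2].
have sw : sides (k w) a b c d by apply: sk; rewrite subrr n1_0.
have sv := sk _ v1.
set E := fun z => f z * (k v z - k w z - (v - w) * k' z).
have sE : sides E a b c d.
  exact: (sidesM sf (sidesB (sidesB sv sw) (sidesZ (v - w) sk'))).
have -> : rint (fun z => f z * k v z) a b c d - rint (fun z => f z * k w z) a b c d -
    rint (fun z => f z * k' z) a b c d * (v - w) = rint E a b c d.
  rewrite mulrC -rintZ; last exact: (sidesM sf sk').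
  rewrite -rintB; [|exact: (sidesM sf sv)|exact: (sidesM sf sw)].
  rewrite -rintB; first by apply: rint_ext => // z _; rewrite /E; ring.
    exact: (sidesB (sidesM sf sv) (sidesM sf sw)).
  exact: (sidesZ _ (sidesM sf sk')).
have bE : n1 (rint E a b c d) <= 2 * (M * (`|K| * n1 (v - w) ^+ 2)) * P.
  apply: n1_rint => // z hz; apply: le_trans (n1M _ _) _.
  apply: ler_pM; [exact: n1_ge0|exact: n1_ge0|exact: hM|].
  apply: le_trans (hK _ _ v1 hz) _; rewrite ler_wpM2r ?sqr_ge0//; exact: ler_norm.
apply: le_trans bE _.
move: v2; rewrite ltr_pdivlMr// => v2.
have n0 := n1_ge0 (v - w).
have -> : 2 * (M * (`|K| * n1 (v - w) ^+ 2)) * P = (n1 (v - w) * (2 * M * `|K| * P)) * n1 (v - w) by ring.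
rewrite ler_wpM2r//; apply: le_trans (ltW v2); rewrite ler_wpM2l// -!mulrA.
rewrite ler_wpM2l// ler_wpM2l ?(ltW M0)//.
by apply: ler_pM => //; rewrite lerDl.
Qed.

Section CauchyKernels.
Variables (f : C -> C) (a b c d : R) (w : C).
Hypotheses (hin : inside a b c d w) (sf : sides f a b c d).

Lemma cder_rint_inv :
  cder (fun v => rint (fun z => f z * (z - v)^-1) a b c d) w
    (rint (fun z => f z * ((z - w) ^+ 2)^-1) a b c d).
Proof.
have [ab cd] := inside_le hin; have [r r0 hr] := inside_has_margin hin.
have r2 : 0 < r / 2 by lra.
have S v : n1 (v - w) < r / 2 -> sides (fun z => (z - v)^-1) a b c d.
  by move=> hv; apply: sides_inv; apply: margin_inside hr _; lra.
suff K v z : n1 (v - w) < r / 2 -> bdry a b c d z ->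
    n1 ((z - v)^-1 - (z - w)^-1 - (v - w) * ((z - w) ^+ 2)^-1) <=
    (2 / r * (2 / r) * (2 / (r / 2))) * n1 (v - w) ^+ 2.
  exact: (cder_rint ab cd r2 sf S (sides_invX 2 hin) K).
move=> hv hz; have zr := margin_dist hr hz.
have zv : r / 2 <= n1 (z - v).
  by have := n1D (z - v) (v - w); rewrite addrA subrK; lra.
have z0 : z - w != 0 by apply: inside_bdry hz.
have v0 : z - v != 0 by apply: contraTneq zv => ->; rewrite n1_0 -ltNge.
have -> : (z - v)^-1 - (z - w)^-1 - (v - w) * ((z - w) ^+ 2)^-1 =
   ((z - w)^-1 * (z - w)^-1 * (z - v)^-1) * ((v - w) * (v - w)).
  by field; rewrite ?z0 ?v0.
apply: le_trans (n1M _ _) _; apply: ler_pM; rewrite ?n1_ge0 ?n1M//.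
apply: le_trans (n1M _ _) _; apply: ler_pM; rewrite ?n1_ge0 ?n1V_le//.
by apply: le_trans (n1M _ _) _; apply: ler_pM; rewrite ?n1_ge0 ?n1V_le.
Qed.

(** Differentiates the integral formula for f', which makes f' holomorphic in turn
    ([chol_deriv]). *)
Lemma cder_rint_inv2 :
  cder (fun v => rint (fun z => f z * ((z - v) ^+ 2)^-1) a b c d) w
    (rint (fun z => f z * (2 * ((z - w) ^+ 3)^-1)) a b c d).
Proof.
have [ab cd] := inside_le hin; have [r r0 hr] := inside_has_margin hin.
have r2 : 0 < r / 2 by lra.
set A := 2 / r; set B := 2 / (r / 2).
have S v : n1 (v - w) < r / 2 -> sides (fun z => ((z - v) ^+ 2)^-1) a b c d.
  by move=> hv; apply: sides_invX; apply: margin_inside hr _; lra.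
suff K v z : n1 (v - w) < r / 2 -> bdry a b c d z ->
    n1 (((z - v) ^+ 2)^-1 - ((z - w) ^+ 2)^-1 - (v - w) * (2 * ((z - w) ^+ 3)^-1)) <=
    ((A * A) * (B * B) + 2 * ((A * A) * (A * B))) * n1 (v - w) ^+ 2.
  exact: (cder_rint ab cd r2 sf S (sidesZ 2 (sides_invX 3 hin)) K).
move=> hv hz; have zr := margin_dist hr hz.
have zv : r / 2 <= n1 (z - v).
  by have := n1D (z - v) (v - w); rewrite addrA subrK; lra.
have z0 : z - w != 0 by apply: inside_bdry hz.
have v0 : z - v != 0 by apply: contraTneq zv => ->; rewrite n1_0 -ltNge.
(* Since Y - X = (v - w) X Y, the remainder is exactly (v - w)^2 (X^2 Y^2 + 2 X^3 Y); A and B bound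
   X and Y. *)
set X := (z - w)^-1; set Y := (z - v)^-1.
have -> : ((z - v) ^+ 2)^-1 - ((z - w) ^+ 2)^-1 - (v - w) * (2 * ((z - w) ^+ 3)^-1) =
   ((X * X) * (Y * Y) + ((X * X) * (X * Y) + (X * X) * (X * Y))) * ((v - w) * (v - w)).
  by rewrite /X /Y; field; rewrite ?z0 ?v0.
have hX : n1 X <= A by exact: n1V_le.
have hY : n1 Y <= B by exact: n1V_le.
have P (s t : C) (s' t' : R) : n1 s <= s' -> n1 t <= t' -> n1 (s * t) <= s' * t'.
  by move=> h1 h2; apply: le_trans (n1M _ _) _; apply: ler_pM; rewrite ?n1_ge0.
apply: (@P) ; last exact: n1M.
apply: le_trans (n1D _ _) _; apply: lerD; first by apply: (@P); apply: (@P).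
apply: le_trans (n1D _ _) _; rewrite mulrDl mul1r; apply: lerD; by apply: (@P); apply: (@P).
Qed.

End CauchyKernels.

Section CauchyDerivative.
Variables (f : C -> C) (a b c d : R).
Hypothesis hf : forall z, rect a b c d z -> chol f z.

Lemma cauchy_value w : inside a b c d w -> f w = (tpi R)^-1 * rint (fun z => f z * (z - w)^-1) a b c d.
Proof. by move=> hin; rewrite (cauchy_rect hin hf) mulrA mulVf ?tpi_neq0// mul1r. Qed.

Lemma cauchy_deriv w : inside a b c d w ->
  cder f w ((tpi R)^-1 * rint (fun z => f z * ((z - w) ^+ 2)^-1) a b c d).
Proof.
move=> hin; have [ab cd] := inside_le hin; have [r r0 hr] := inside_has_margin hin.
apply: cder_near r0 _ (cderZ (tpi R)^-1 (cder_rint_inv hin (sides_hol ab cd hf))) => v hv.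
by rewrite -cauchy_value//; exact: margin_inside hr hv.
Qed.

Lemma chol_deriv w : inside a b c d w -> chol (cderiv f) w.
Proof.
move=> hin; have [ab cd] := inside_le hin; have [r r0 hr] := inside_has_margin hin.
eexists; apply: cder_near r0 _ (cderZ (tpi R)^-1 (cder_rint_inv2 hin (sides_hol ab cd hf))) => v hv.
by rewrite (cder_cderiv (cauchy_deriv (margin_inside hr hv))).
Qed.

Lemma cauchy_value_bound w r M : 0 < r -> margin r a b c d w -> inside a b c d w ->
  (forall z, bdry a b c d z -> n1 (f z) <= M) ->
  n1 (f w) <= n1 (tpi R)^-1 * (2 * (M * (2 / r)) * ((b - a) + (d - c))).
Proof.
move=> r0 hr hin hM; have [ab cd] := inside_le hin.
rewrite (cauchy_value hin); apply: le_trans (n1M _ _) _; rewrite ler_wpM2l ?n1_ge0//.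
apply: n1_rint => //; first exact: (sidesM (sides_hol ab cd hf) (sides_inv hin)).
move=> z hz; apply: le_trans (n1M _ _) _; apply: ler_pM; rewrite ?n1_ge0 ?hM//.
by apply: n1V_le => //; exact: margin_dist hr hz.
Qed.

Lemma cauchy_deriv_bound w r M : 0 < r -> margin r a b c d w -> inside a b c d w ->
  (forall z, bdry a b c d z -> n1 (f z) <= M) ->
  n1 (cderiv f w) <= n1 (tpi R)^-1 * (2 * (M * (2 / r * (2 / r))) * ((b - a) + (d - c))).
Proof.
move=> r0 hr hin hM; have [ab cd] := inside_le hin.
rewrite (cder_cderiv (cauchy_deriv hin)); apply: le_trans (n1M _ _) _; rewrite ler_wpM2l ?n1_ge0//.
apply: n1_rint => //; first exact: (sidesM (sides_hol ab cd hf) (sides_invX 2 hin)).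
move=> z hz; apply: le_trans (n1M _ _) _; apply: ler_pM; rewrite ?n1_ge0 ?hM//.
rewrite expr2 invfM; apply: le_trans (n1M _ _) _.
by apply: ler_pM; rewrite ?n1_ge0//; apply: n1V_le => //; exact: margin_dist hr hz.
Qed.

End CauchyDerivative.

Lemma square_margin r w : 0 < r ->
  let: (a, b, c, d) := (complex.Re w - r, complex.Re w + r, complex.Im w - r, complex.Im w + r) in
  margin r a b c d w /\ inside a b c d w.
Proof.
move=> r0; rewrite /margin /inside !lexx; split => //.
by apply/andP; split; apply/andP; split; lra.
Qed.

Definition square r w := rect (complex.Re w - r) (complex.Re w + r) (complex.Im w - r) (complex.Im w + r).

Lemma square_n1 r w z : square r w z -> n1 (z - w) <= 2 * r.
Proof.
case: z w => x y [p q] /andP[/= /andP[h1 h2] /andP[h3 h4]]; rewrite n1_ri.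
have : `|x - p| <= r by rewrite ler_norml; lra.
have : `|y - q| <= r by rewrite ler_norml; lra.
lra.
Qed.

Definition divq f w v : C := if v == w then cderiv f w else (f v - f w) / (v - w).

Lemma divqE f w v : f v = f w + (v - w) * divq f w v.
Proof.
rewrite /divq; case: eqVneq => [->|vw]; first by rewrite subrr mul0r addr0.
by rewrite mulrC mulfVK ?subr_eq0// addrC subrK.
Qed.

Lemma chol_divq_neq f w v : chol f v -> v != w -> chol (divq f w) v.
Proof.
move=> hf vw.
apply: (@chol_near _ (fun t => (f t - f w) / (t - w)) _ v (n1 (v - w))).
- by rewrite n1_gt0// subr_eq0.
- move=> t ht; rewrite /divq ifN//; apply: contraTneq ht => ->.
  by rewrite n1BC ltxx.
- apply: chol_div; [exact: cholB hf (chol_cst _ _)|exact: chol_subr|by rewrite subr_eq0].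
Qed.

(** Subtracting Cauchy's formulas at v and w exhibits the quotient as the Cauchy integral at v of f
    z / (z - w). For this, continuity on the boundary is enough, and [cder_rint_inv] differentiates
    it at w. *)
Lemma chol_divq f w r : 0 < r -> (forall v, n1 (v - w) < r -> chol f v) -> chol (divq f w) w.
Proof.
move=> r0 hr; have r4 : 0 < r / 4 by lra.
have [mg hin] := square_margin w r4.
have hf z : square (r / 4) w z -> chol f z.
  by move=> /square_n1 h; apply: hr; lra.
have [ab cd] := inside_le hin.
have sf := sides_hol ab cd hf.
set a := _ - _ in mg hin hf ab sf; set b := _ + _ in mg hin hf ab sf.
set c := complex.Im _ - _ in mg hin hf cd sf; set d := complex.Im _ + _ in mg hin hf cd sf.
have sg := sidesM sf (sides_inv hin).
have h := cderZ (tpi R)^-1 (cder_rint_inv hin sg).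
eexists; apply: cder_near r4 _ h => v hv.
have vin := margin_inside mg hv.
rewrite /divq; case: eqVneq => [->|vw].
  rewrite (cder_cderiv (cauchy_deriv hf hin)); congr (_ * _).
  by apply: rint_ext => // z _; rewrite expr2 invfM mulrA.
rewrite (cauchy_value hf vin) (cauchy_value hf hin) -mulrBr -mulrA; congr (_ * _).
have vw0 : v - w != 0 by rewrite subr_eq0.
rewrite -rintB; [|exact: (sidesM sf (sides_inv vin))|exact: (sidesM sf (sides_inv hin))].
rewrite mulrC -rintZ; last first.
  exact: (sidesB (sidesM sf (sides_inv vin)) (sidesM sf (sides_inv hin))).
apply: rint_ext => // z hz.
have z1 := inside_bdry vin hz; have z2 := inside_bdry hin hz.
by field; rewrite z1 z2.
Qed.

Definition entire f := forall z, chol f z.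

Lemma entire_divq f w : entire f -> entire (divq f w).
Proof.
move=> hf v; have [->|vw] := eqVneq v w; first exact: (chol_divq ltr01).
exact: chol_divq_neq.
Qed.

Lemma entire_deriv f : entire f -> entire (cderiv f).
Proof.
move=> hf w; have [_ hin] := square_margin w (@ltr01 R).
by apply: chol_deriv hin => z _; exact: hf.
Qed.

(* If [f] is divisible by every power of [z - w], Cauchy's formula for the
   quotients on a large square gives [|f z| <= A / 2 ^ m] for all [m]. *)
Lemma entire_order f w : entire f ->
  (exists m h, [/\ entire h, h w != 0 & forall z, f z = (z - w) ^+ m * h z]) \/ (forall z, f z = 0).
Proof.
move=> hf.
pose P m := exists h, entire h /\ forall z, f z = (z - w) ^+ m * h z.
have P0 : P 0%N by exists f; split => // z; rewrite expr0 mul1r.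
have [h|/existsNP[m hm]] := pselect (forall m, P m); last first.
  left.
  (* The last power that divides f; if the cofactor vanished at w, [divq] would extract one more
     factor. *)
  have [k [h [hh hE]] hk] : exists2 k, P k & ~ P k.+1.
    elim: m hm => [//|m ih] hm; have [/ih//|/contrapT pm] := pselect (~ P m).
    by exists m.
  exists k, h; split => //; apply/eqP => hw0; apply: hk.
  exists (divq h w); split; first exact: entire_divq.
  by move=> z; rewrite hE exprSr -mulrA {1}(divqE h w z) hw0 add0r.
right => z; apply: n1_eq0; apply/eqP; rewrite eq_le n1_ge0 andbT.
(* Boundary points of the square around z are at distance at least r from z, hence at least rho = 4
   n1 (z - w) + 1 from w. This gives n1 (z - w) * (2 / rho) <= 1 / 2, where the 2 comes from
   [n1V]. *)
set r := 5 * n1 (z - w) + 1.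
have r0 : 0 < r by rewrite /r; have := n1_ge0 (z - w); lra.
have [mg hin] := square_margin z r0; have [ab cd] := inside_le hin.
have [M M0 hM] := sides_bounded ab cd (sides_hol ab cd (fun t _ => hf t)).
set A := n1 (tpi R)^-1 * (2 * (2 / r) * ((complex.Re z + r - (complex.Re z - r)) + (complex.Im z + r - (complex.Im z - r)))) * M.
have A0 : 0 <= A.
  rewrite /A mulr_ge0 ?(ltW M0)// mulr_ge0 ?n1_ge0// !mulr_ge0// ?invr_ge0 ?ltW//.
  lra.
have key m : n1 (f z) <= A / 2 ^+ m.
  have [g [hg gE]] := h m.
  set rho := 4 * n1 (z - w) + 1.
  have rho0 : 0 < rho by rewrite /rho; have := n1_ge0 (z - w); lra.
  have gM t : bdry (complex.Re z - r) (complex.Re z + r) (complex.Im z - r) (complex.Im z + r) t ->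
      n1 (g t) <= M * (2 / rho) ^+ m.
    move=> ht; have tz := margin_dist mg ht.
    have tw : rho <= n1 (t - w).
      by have := n1D (t - w) (w - z); rewrite addrA subrK (n1BC w z); rewrite /rho /r in tz *; lra.
    have tw0 : t - w != 0 by apply: contraTneq tw => ->; rewrite n1_0 -ltNge.
    have -> : g t = f t * (t - w)^-1 ^+ m.
      by rewrite gE mulrAC -exprMn mulfV// expr1n mul1r.
    apply: le_trans (n1M _ _) _; apply: ler_pM; rewrite ?n1_ge0 ?hM//.
    elim: (m) => [|k ih]; first by rewrite !expr0 n1_1.
    rewrite !exprS; apply: le_trans (n1M _ _) _; apply: ler_pM; rewrite ?n1_ge0//.
    exact: n1V_le.
  have gz := cauchy_value_bound (fun t _ => hg t) r0 mg hin gM.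
  rewrite gE; apply: le_trans (n1M _ _) _.
  have wz : n1 ((z - w) ^+ m) <= n1 (z - w) ^+ m.
    elim: (m) => [|k ih]; first by rewrite !expr0 n1_1.
    by rewrite !exprS; apply: le_trans (n1M _ _) _; apply: ler_pM; rewrite ?n1_ge0.
  apply: le_trans (ler_pM (n1_ge0 _) (n1_ge0 _) wz gz) _.
  have -> : n1 (z - w) ^+ m * (n1 (tpi R)^-1 * (2 * (M * (2 / rho) ^+ m * (2 / r)) *
     (complex.Re z + r - (complex.Re z - r) + (complex.Im z + r - (complex.Im z - r))))) =
     A * (n1 (z - w) * (2 / rho)) ^+ m.
    rewrite [(n1 (z - w) * (2 / rho)) ^+ m]exprMn /A; move: ((2 / rho) ^+ m) => X; move: (n1 (z - w) ^+ m) => Y.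
    move: (n1 (tpi R)^-1) => T; move: (_ + _ : R) => W; ring.
  rewrite ler_wpM2l// -exprVn lerXn2r// ?nnegrE ?mulr_ge0 ?n1_ge0 ?invr_ge0 ?(ltW rho0)//.
  by rewrite mulrA ler_pdivrMr// /rho; have := n1_ge0 (z - w); lra.
apply/ler_addgt0Pr => e e0; rewrite add0r.
set k := (Num.truncn (A / e)).+1.
apply: le_trans (key k) _; rewrite ler_pdivrMr ?exprn_gt0// mulrC -ler_pdivrMr//.
apply: ltW; apply: lt_trans (truncnS_gt _) _.
by rewrite -natrX ltr_nat ltn_expl.
Qed.

End Analyticity.

(** * Zero orders, the residue theorem for logarithmic derivatives, finiteness of zeros *)

Section Residues.
Variable R : realType.
Local Notation C := (R[i]).
Implicit Types (f g : C -> C) (a b c d x y p q r : R) (z w v : C).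

Lemma has_zero_orderP f z n : has_zero_order f z n <->
  exists h e, [/\ 0 < e, forall w, n1 (w - z) < e -> chol h w, h z != 0 &
    forall w, n1 (w - z) < e -> f w = (w - z) ^+ n * h w].
Proof.
split=> [[h [/nbhs_n1[d d0 hd] h0 /nbhs_n1[e e0 he]]]|[h [e [e0 h1 h2 h3]]]].
  exists h, (Num.min d e); split => //; first by rewrite lt_min d0.
    by move=> w; rewrite lt_min => /andP[/hd/derivable_cderP].
  by move=> w; rewrite lt_min => /andP[_ /he].
exists h; split => //; apply/nbhs_n1; exists e => //.
by move=> w /h1/derivable_cderP.
Qed.

Lemma ccont_punctured f z (e : R) : ccont f z -> 0 < e ->
  (forall w, n1 (w - z) < e -> w != z -> f w = 0) -> f z = 0.
Proof.
move=> hf e0 h; apply/eqP; apply: contraT => /n1_gt0/hf[d d0 hd].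
set t := Num.min d e / 2.
have t0 : 0 < t by rewrite divr_gt0// lt_min d0.
have wz : z + t%:C - z = t%:C by rewrite addrC addKr.
have tn : `|t| < d /\ `|t| < e.
  by rewrite gtr0_norm// /t !ltr_pdivrMr// !gt_min; split;
   [have : d < d * 2 by lra|have : e < e * 2 by lra] => ->; rewrite ?orbT.
have := hd (z + t%:C); rewrite wz n1C => /(_ tn.1); rewrite h ?wz ?n1C; last 2 first.
- exact: tn.2.
- rewrite -subr_eq0 wz; apply/eqP => [[/eqP]]; exact/negP/lt0r_neq0.
by rewrite sub0r n1N ltxx.
Qed.

(** Cancelling (w - z)^m leaves h = (w - z)^(n - m) h' off z, and by continuity at z, where the
    right side vanishes and h does not. *)
Lemma has_zero_order_lt f z m n : has_zero_order f z m -> has_zero_order f z n -> (m < n)%N -> False.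
Proof.
move=> /has_zero_orderP[h [e [e0 h1 h2 h3]]] /has_zero_orderP[h' [e' [e'0 h1' _ h3']]] mn.
move/negP : h2; apply.
have hc : chol (fun w => h w - (w - z) ^+ (n - m) * h' w) z.
  apply: cholB; first by apply: h1; rewrite subrr n1_0.
  by apply: cholM; [apply: cholX; exact: chol_subr|apply: h1'; rewrite subrr n1_0].
have := ccont_punctured (e := Num.min e e') (chol_ccont hc).
rewrite lt_min e0 e'0 => /(_ isT) H.
have : h z - (z - z) ^+ (n - m) * h' z = 0.
  apply: H => w; rewrite lt_min => /andP[we we'] wz.
  have w0 : (w - z) ^+ m != 0 by rewrite expf_eq0 subr_eq0 (negbTE wz) andbF.
  apply: (mulfI w0); rewrite mulr0 mulrBr -h3// mulrA -exprD subnKC 1?ltnW// -h3'// subrr.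
  by [].
by rewrite subrr expr0n subn_eq0 leqNgt mn mul0r subr0 => ->.
Qed.

Lemma has_zero_order_uniq f z m n : has_zero_order f z m -> has_zero_order f z n -> m = n.
Proof.
move=> hm hn; case: (ltngtP m n) => // mn.
  by case: (has_zero_order_lt hm hn mn).
by case: (has_zero_order_lt hn hm mn).
Qed.

Lemma zero_orderE f z n : has_zero_order f z n -> zero_order f z = n.
Proof.
move=> h; rewrite /zero_order; case: xgetP => [m _ hm|/(_ n)//].
exact: has_zero_order_uniq hm h.
Qed.

Lemma has_zero_order0 f z : entire f -> f z != 0 -> has_zero_order f z 0.
Proof.
move=> hf f0; apply/has_zero_orderP; exists f, 1; split => // w _.
by rewrite expr0 mul1r.
Qed.

(** The local factorization becomes global: [entire_order] supplies a global one, whose exponent is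
    the given n by uniqueness of the order. *)
Lemma entire_factor f z n : entire f -> has_zero_order f z n ->
  exists h, [/\ entire h, h z != 0 & forall w, f w = (w - z) ^+ n * h w].
Proof.
move=> hf hn; have [[m [h [h1 h2 h3]]]|f0] := entire_order z hf.
  exists h; split => // w; rewrite h3; congr (_ ^+ _ * _).
  apply: has_zero_order_uniq hn; apply/has_zero_orderP; exists h, 1; split => //.
move/has_zero_orderP : hn => [h [e [e0 h1 h2 h3]]].
case/negP: h2; apply/eqP; apply: (ccont_punctured (e := e)) => //.
  by apply: chol_ccont; apply: h1; rewrite subrr n1_0.
move=> w we wz; have := h3 w we; rewrite f0 => /esym/eqP.
by rewrite mulf_eq0 expf_eq0 subr_eq0 (negbTE wz) andbF /= => /eqP.
Qed.

Lemma entire_has_order f z w : entire f -> f w != 0 -> exists n, has_zero_order f z n.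
Proof.
move=> hf fw; have [[m [h [h1 h2 h3]]]|f0] := entire_order z hf.
  by exists m; apply/has_zero_orderP; exists h, 1; split.
by rewrite f0 eqxx in fw.
Qed.

(** Induction on the zeros: dividing out (z - z0)^m splits the logarithmic derivative into m / (z -
    z0), settled by [cauchy_rect], and that of the entire quotient, which has one zero less in the
    list. When none is left, [goursat] applies. *)
Lemma residue_rect f g a b c d (s : seq C) (m : C -> nat) : a <= b -> c <= d ->
  entire f -> (forall z, rect a b c d z -> chol g z) -> uniq s ->
  (forall z, z \in s -> inside a b c d z /\ has_zero_order f z (m z)) ->
  (forall z, rect a b c d z -> f z = 0 -> z \in s) ->
  rint (fun z => g z * (cderiv f z / f z)) a b c d = tpi R * \sum_(z <- s) (m z)%:R * g z.
Proof.
move=> ab cd; elim: s f => [|z0 s ih] f hf hg us hs h0.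
  rewrite big_nil mulr0; apply: goursat => // z hz.
  have fz : f z != 0 by apply/eqP => /(h0 _ hz).
  by apply: cholM; [exact: hg|apply: chol_div => //; exact: entire_deriv].
move: us => /= /andP[z0s us].
have [z0in z0m] := hs z0 (mem_head _ _).
have [h [hh hz0 hE]] := entire_factor hf z0m.
have fb z : bdry a b c d z -> f z != 0.
  move=> hz; apply/eqP => /(h0 _ (bdry_rect hz)) /hs[zin _].
  by have := inside_bdry zin hz; rewrite subrr eqxx.
have hb z : bdry a b c d z -> h z != 0.
  by move=> /fb; rewrite hE mulf_eq0 negb_or => /andP[].
have sg := sides_hol ab cd hg.
have sgh : sides (fun z => g z * (cderiv h z / h z)) a b c d.
  apply: bdry_sides => // z hz; apply: chol_ccont; apply: cholM; first by apply: hg; case: hz.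
  apply: chol_div; [exact: entire_deriv|exact: hh|exact: hb].
have sgz : sides (fun z => g z * (z - z0)^-1) a b c d by exact: (sidesM sg (sides_inv z0in)).
rewrite big_cons (rint_ext (g := fun z => (m z0)%:R * (g z * (z - z0)^-1) + g z * (cderiv h z / h z)))//; last first.
  move=> z hz.
  have zz : z - z0 != 0 by exact: inside_bdry hz.
  have hz' := hb z hz.
  have D : cder f z ((m z0)%:R * (z - z0) ^+ (m z0).-1 * 1 * h z + (z - z0) ^+ (m z0) * cderiv h z).
    apply: (@cder_ext _ (fun w => (w - z0) ^+ (m z0) * h w)) => [w|]; first by rewrite hE.
    exact: (cderM (cderX (m z0) (cder_subr z0 z)) (chol_cderiv (hh z))).
  (* Order 0 is separated because [.-1] truncates there. *)
  rewrite (cder_cderiv D) hE; case: (m z0) => [|k] /=.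
    by rewrite !mul0r add0r !expr0 !mul1r add0r.
  have zk : (z - z0) ^+ k != 0 by rewrite expf_eq0 (negbTE zz) andbF.
  by rewrite exprS; field; rewrite zz zk hz'.
rewrite rintD; [|exact: (sidesZ _ sgz)|exact: sgh].
rewrite (rintZ _ sgz) (cauchy_rect z0in hg) mulrDr; congr (_ + _); first by ring.
apply: ih => //.
- move=> z zs; have [zin zm] := hs z (mem_behead (s := z0 :: s) zs); split => //.
  have zz0 : z - z0 != 0 by rewrite subr_eq0; apply: contraNneq z0s => <-.
  move/has_zero_orderP : zm => [k [e [e0 k1 k2 k3]]].
  (* Near another point z of the list, (t - z0)^m is invertible, so dividing by it preserves the
     order at z. *)
  apply/has_zero_orderP; exists (fun t => k t / (t - z0) ^+ m z0), (Num.min e (n1 (z - z0))).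
  have tz t : n1 (t - z) < n1 (z - z0) -> t - z0 != 0.
    rewrite subr_eq0 => ht; apply: contraTneq ht => ->.
    by rewrite n1BC ltxx.
  split.
  + by rewrite lt_min e0 n1_gt0.
  + move=> t; rewrite lt_min => /andP[/k1 kt /tz t0].
    apply: chol_div => //; first by apply: cholX; exact: chol_subr.
    by rewrite expf_eq0 (negbTE t0) andbF.
  + by rewrite mulf_eq0 invr_eq0 expf_eq0 (negbTE zz0) andbF orbF.
  + move=> t; rewrite lt_min => /andP[/k3 kt /tz t0].
    have t1 : (t - z0) ^+ m z0 != 0 by rewrite expf_eq0 (negbTE t0) andbF.
    by rewrite mulrA -kt hE mulrAC mulfV// mul1r.
- move=> z hz hz1; have := h0 z hz; rewrite hE hz1 mulr0 => /(_ erefl).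
  rewrite in_cons => /orP[/eqP zz|//].
  by move: hz0; rewrite -zz hz1 eqxx.
Qed.

Lemma isolated_zeros f w z : entire f -> f w != 0 ->
  exists2 e, 0 < e & forall v, n1 (v - z) < e -> v != z -> f v != 0.
Proof.
move=> hf fw; have [n hn] := entire_has_order z hf fw.
have [h [hh hz hE]] := entire_factor hf hn.
have [d d0 hd] := chol_ccont (hh z) (n1_gt0 hz).
exists d => // v /hd vz vz0; rewrite hE mulf_neq0//.
  by rewrite expf_eq0 subr_eq0 (negbTE vz0) andbF.
by apply: contraTneq vz => ->; rewrite sub0r n1N ltxx.
Qed.

Lemma compact_rect a b c d : compact [set z : Cplx R | rect a b c d z].
Proof.
have -> : [set z : Cplx R | rect a b c d z] =
   (fun u : R * R => (u.1 +i* u.2 : Cplx R)) @` (`[a, b]%classic `*` `[c, d]%classic).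
  apply/seteqP; split => [[x y] /andP[/= h1 h2]|_ [[x y] [/= h1 h2] <-]].
    by exists (x, y) => //=; rewrite !in_itv.
  by rewrite /rect /=; move: h1 h2; rewrite !in_itv /= => -> ->.
apply: continuous_compact; last by apply: compact_setX; exact: segment_compact.
apply: continuous_subspaceT => -[x y].
apply/(cvg_n1 (nbhs_filter (x, y))) => e e0.
have e2 : 0 < e / 2 by lra.
exists (ball x (e / 2), ball y (e / 2)); first by split; exact: nbhsx_ballx.
move=> [x' y'] [/=]; rewrite -!ball_normE /= n1_ri (distrC x) (distrC y); lra.
Qed.

(** Zeros are isolated, so the rectangle is covered by open sets containing no zero except possibly
    their centre; the centres of a finite subcover include all zeros. *)
Lemma finite_zeros f w a b c d : entire f -> f w != 0 ->
  exists2 s : seq C, uniq s & forall z, (z \in s) <-> (rect a b c d z /\ f z = 0).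
Proof.
move=> hf fw.
suff : finite_set [set z : C | rect a b c d z /\ f z = 0].
  move=> /finite_seqP[s hs]; exists (undup s); first exact: undup_uniq.
  move=> z; rewrite mem_undup; have : [set` s] z <-> [set z : C | rect a b c d z /\ f z = 0] z by rewrite hs.
  by [].
have := @compact_rect a b c d; rewrite compact_cover.
move=> /(_ C [set z | rect a b c d z] (fun z => [set v : Cplx R | v != z -> f v != 0]^°)).
case.
- by move=> z _; exact: open_interior.
- move=> z hz; exists z => //; have [e e0 he] := isolated_zeros z hf fw.
  by apply/nbhs_n1; exists e.
- move=> D' _ hD; apply: sub_finite_set (finite_fset D').
  move=> z /= [hz fz]; have [v vD /interior_subset/= hv] := hD z hz.
  have [->//|zv] := eqVneq z v.
  by have := hv zv; rewrite fz eqxx.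
Qed.

End Residues.

(** * The exponential and Jacobi's formula *)

Section ComplexExponential.
Variable R : realType.
Local Notation C := (R[i]).
Implicit Types (x y : R) (z w : C).

Lemma is_derive_rder (f : R -> R) x l : is_derive x 1 f l -> rder f x l.
Proof.
move=> [/cvg_ex[l' hl'] <-]; rewrite /derive (cvg_lim _ hl')// => e e0.
have H : nbhs (0 : R) [set h : R | h != 0 ->
    `|l' - h^-1 *: ((f \o shift x) (h *: 1) - f x)| < e].
  by move/cvgrPdist_lt : hl' => /(_ e e0).
move/nbhs_ballP : H => [d /= d0 hd]; exists d => // y yx.
have [->|yx0] := eqVneq y x; first by rewrite !subrr mulr0 subr0 normr0 mulr0.
have yx0' : y - x != 0 by rewrite subr_eq0.
have := hd (y - x); rewrite -ball_normE /= sub0r normrN => /(_ yx yx0').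
rewrite /= [(y - x) *: 1]mulr1 subrK => h.
have -> : f y - f x - l' * (y - x) = - (l' - (y - x)^-1 * (f y - f x)) * (y - x).
  by field.
by rewrite normrM normrN ler_wpM2r// ltW.
Qed.

Lemma cexp0 : cexp 0 = 1 :> C.
Proof.
by rewrite /cexp /= expR0 cos0 sin0; apply/eqP; rewrite eq_complex /= !mul0r mul1r subr0 addr0 mul1r !eqxx.
Qed.

Lemma cexpD z w : cexp (z + w) = cexp z * cexp w.
Proof.
case: z w => a b [c d]; rewrite /cexp /= expRD cosD sinD.
by apply/eqP; rewrite eq_complex /=; apply/andP; split; apply/eqP; ring.
Qed.

Lemma cexp_sqn z : complex.Re (cexp z) ^+ 2 + complex.Im (cexp z) ^+ 2 = expR (complex.Re z) ^+ 2.
Proof.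
by rewrite /cexp /= !mul0r subr0 addr0 !exprMn -mulrDr cos2Dsin2 mulr1.
Qed.

Lemma cder_cexp0 : cder (@cexp R) 0 1.
Proof.
apply/cderP => e e0.
(* The errors below add up to u |x| + 4 u |y| and two mixed terms of size at most (e / 8) |y|. The
   minimum with 1 keeps expR x below 2. *)
set u := Num.min e 1 / 8.
have u0 : 0 < u by rewrite divr_gt0// lt_min e0 ltr01.
have ue : u <= e / 8 by rewrite ler_wpM2r// ge_min lexx.
have u1 : u <= 1 / 8 by rewrite ler_wpM2r// ge_min lexx orbT.
have [d1 d10 h1] := is_derive_rder (is_derive_expR (0 : R)) u0.
have [d2 d20 h2] := is_derive_rder (is_derive_cos (0 : R)) u0.
have [d3 d30 h3] := is_derive_rder (is_derive_sin (0 : R)) u0.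
exists (Num.min (Num.min d1 d2) (Num.min d3 u)); first by rewrite !lt_min d10 d20 d30.
case=> x y; rewrite subr0 !lt_min => /andP[/andP[k1 k2] /andP[k3 k4]].
have nx : `|x| <= n1 (x +i* y) by exact: (Re_le_n1 (x +i* y)).
have ny : `|y| <= n1 (x +i* y) by exact: (Im_le_n1 (x +i* y)).
have := h1 x; rewrite subr0 => /(_ (le_lt_trans nx k1)).
have := h2 y; rewrite subr0 => /(_ (le_lt_trans ny k2)).
have := h3 y; rewrite subr0 => /(_ (le_lt_trans ny k3)).
rewrite expR0 cos0 sin0 mul1r oppr0 mul0r !subr0 mul1r => hs hc he; rewrite ?addr0 in hs.
have xu : `|x| <= u := ltW (le_lt_trans nx k4).
rewrite cexp0 /cexp /=.
set E := expR x in he *; set c := cos y in hc *; set s := sin y in hs *.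
have E2 : `|E| <= 2.
  have := ler_normD (E - 1 - x) (1 + x); have := ler_normD 1 x.
  rewrite normr1 (_ : E - 1 - x + (1 + x) = E); last by ring.
  have : u * `|x| <= u * u by rewrite ler_wpM2l// ltW.
  nra.
have A : `|E * c - 1 - x| <= u * `|x| + 2 * (u * `|y|).
  have -> : E * c - 1 - x = (E - 1 - x) + E * (c - 1) by ring.
  apply: le_trans (ler_normD _ _) _; apply: lerD => //.
  rewrite normrM; apply: ler_pM => //.
have B : `|E * s - y| <= 2 * (u * `|y|) + (u * `|x| + `|x|) * `|y|.
  have -> : E * s - y = E * (s - y) + (E - 1) * y by ring.
  apply: le_trans (ler_normD _ _) _; apply: lerD.
    rewrite normrM; apply: ler_pM => //.
  rewrite normrM ler_wpM2r//.
  have -> : E - 1 = (E - 1 - x) + x by rewrite subrK.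
  by apply: le_trans (ler_normD _ _) _; rewrite lerD2r.
have -> : (E%:C * (c +i* s) - 1 - 1 * (x +i* y)) = (E * c - 1 - x) +i* (E * s - y).
  by apply/eqP; rewrite eq_complex /=; apply/andP; split; apply/eqP; ring.
rewrite !n1_ri; apply: le_trans (lerD A B) _.
have x0 := normr_ge0 x; have y0 := normr_ge0 y.
have X1 : u * `|x| <= e / 8 * `|x| by rewrite ler_wpM2r.
have Y1 : u * `|y| <= e / 8 * `|y| by rewrite ler_wpM2r.
have XY : `|x| * `|y| <= e / 8 * `|y| by rewrite ler_wpM2r// (le_trans xu).
have ex : 0 <= e * `|x| by rewrite mulr_ge0// ltW.
have ey : 0 <= e * `|y| by rewrite mulr_ge0// ltW.
have UXY : u * `|x| * `|y| <= e / 8 * `|y|.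
  rewrite ler_wpM2r//; apply: le_trans ue.
  by rewrite ler_piMr// ?(ltW u0)//; lra.
nra.
Qed.

Lemma cder_cexp z : cder (@cexp R) z (cexp z).
Proof.
apply: (@cder_ext _ (fun w => cexp z * cexp (w - z))).
  by move=> w; rewrite -cexpD addrC subrK.
have h : cder (@cexp R) (z - z) 1 by rewrite subrr; exact: cder_cexp0.
apply: cder_eq (cderZ (cexp z) (cder_comp (g := fun t => t - z) (cder_subr z z) h)) _.
by rewrite !mulr1.
Qed.

End ComplexExponential.

Section JacobiFormula.
Variable R : realType.
Local Notation C := (R[i]).

Lemma cder_prod (I : eqType) (r : seq I) (f : I -> C -> C) (l : I -> C) z : uniq r ->
  (forall i, cder (f i) z (l i)) ->
  cder (fun w => \prod_(i <- r) f i w) z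
       (\sum_(i <- r) \prod_(j <- r) (if j == i then l j else f j z)).
Proof.
move=> ur h; elim: r ur => [_|i r ih /= /andP[ir ur]].
  rewrite big_nil; apply: cder_ext (cder_cst 1 z) => w; by rewrite big_nil.
apply: (@cder_ext _ (fun w => f i w * \prod_(j <- r) f j w)).
  by move=> w; rewrite big_cons.
apply: cder_eq (cderM (h i) (ih ur)) _.
rewrite big_cons big_cons eqxx; congr (_ * _ + _).
  rewrite !big_seq; apply: eq_bigr => j jr; rewrite ifN//.
  by apply: contraNneq ir => <-.
rewrite mulr_sumr !big_seq; apply: eq_bigr => j jr.
rewrite big_cons ifN//; by apply: contraNneq ir => ->.
Qed.

(** Leibniz's formula is differentiated one row at a time. The determinant with row i replaced by
    that of M' is expanded along this row, whose cofactors are those of M. *)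
Lemma cder_det n (M : C -> 'M[C]_n) (M' : 'M[C]_n) z :
  (forall i j, cder (fun w => M w i j) z (M' i j)) ->
  cder (fun w => \det (M w)) z (\tr (M' *m \adj (M z))).
Proof.
move=> h; rewrite /determinant.
have hs (s : 'S_n) : cder (fun w => (-1) ^+ s * \prod_i M w i (s i)) z
   ((-1) ^+ s * \sum_i \prod_j (if j == i then M' j (s j) else M z j (s j))).
  apply: cderZ; exact: (cder_prod (index_enum_uniq _) (fun i => h i (s i))).
apply: cder_eq; first by apply: cder_sum => s _; exact: hs.
under eq_bigr do rewrite mulr_sumr.
rewrite exchange_big /= /mxtrace; apply: eq_bigr => i _.
pose N := \matrix_(a < n, b < n) (if a == i then M' a b else M z a b).
transitivity (\det N).
  rewrite /determinant; apply: eq_bigr => s _; congr (_ * _); apply: eq_bigr => j _.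
  by rewrite mxE.
rewrite (expand_det_row N i) mxE; apply: eq_bigr => k _.
rewrite !mxE eqxx /cofactor; congr (_ * (_ * \det _)).
apply/matrixP => a b; rewrite !mxE ifN//.
by rewrite eq_sym; exact: neq_lift.
Qed.

End JacobiFormula.

(** * The secular determinant *)

Section PhaseReduction.
Variable R : realType.

Lemma cexp_i (x : R) : cexp ('i%C * x%:C) = cos x +i* sin x.
Proof.
have -> : 'i%C * x%:C = 0 +i* x.
  by apply/eqP; rewrite eq_complex /=; apply/andP; split; apply/eqP; ring.
rewrite /cexp /= expR0; by apply/eqP; rewrite eq_complex /= !mul0r !mul1r subr0 addr0 !eqxx.
Qed.

(** acos (cos x) lies in [0, pi] and has the right cosine; its sign is then chosen to match sin
    x. *)
Lemma phase_reduction (x : R) : exists2 t : R, - pi <= t <= pi &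
  cexp ('i%C * t%:C) = cexp ('i%C * x%:C).
Proof.
have hc : -1 <= cos x <= 1 by rewrite cos_geN1 cos_le1.
have [/andP[a0 api] ac] := acos_def hc.
have sq : sin (acos (cos x)) = `|sin x|.
  rewrite sin_acos// -sqrtr_sqr; congr Num.sqrt.
  by rewrite -(cos2Dsin2 x) addrAC subrr add0r.
have pi0 := pi_ge0 R.
have [s0|s0] := leP 0 (sin x).
  exists (acos (cos x)); first by rewrite api (le_trans _ a0)// oppr_le0.
  by rewrite !cexp_i ac sq ger0_norm.
exists (- acos (cos x)); first by rewrite lerN2 api (le_trans _ pi0)// oppr_le0.
by rewrite !cexp_i cosN sinN ac sq ltr0_norm// opprK.
Qed.

End PhaseReduction.

Section PhasedDeterminant.
Variables (R : realType) (Q : quantum_graph R).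
Local Notation C := (R[i]).
Local Notation n := #|bond Q|.
Implicit Types (th : 'rV[R]_n) (z : C).

Definition blen (j : 'I_n) : R := bond_len (enum_val j).

(* [U_mx] with an additional phase [th 0 j] on each bond; the phases
   parametrize the closure of the horizontal translates of [U_mx]. *)
Definition Uth th z : 'M[C]_n :=
  \matrix_(i, j) (S_mx Q i j * cexp ('i%C * (z * (blen j)%:C + (th 0 j)%:C))).

Definition Fth th z : C := \det (1%:M - Uth th z).

Lemma U_mx_phase0 z : U_mx Q z = Uth 0 z.
Proof.
apply/matrixP => i j; rewrite mxE (bigD1 j)//= big1 => [|k kj]; last first.
  by rewrite [D_mx _ _ _ _]mxE (negbTE kj) mulr0.
have z0 : ((0 : 'rV[R]_n) 0 j)%:C = 0 :> C by rewrite mxE.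
by rewrite addr0 [D_mx _ _ _ _]mxE eqxx [in RHS]mxE z0 addr0 mulrA.
Qed.

Lemma cder_phase th z j :
  cder (fun w => cexp ('i%C * (w * (blen j)%:C + (th 0 j)%:C))) z
    (cexp ('i%C * (z * (blen j)%:C + (th 0 j)%:C)) * ('i%C * (blen j)%:C)).
Proof.
have h : cder (fun w => 'i%C * (w * (blen j)%:C + (th 0 j)%:C)) z ('i%C * (blen j)%:C).
  apply: cderZ; apply: cder_eq (cderD (cderM (cder_id z) (cder_cst (blen j)%:C z)) (cder_cst _ z)) _.
  by rewrite mul1r mulr0 !addr0.
exact: (cder_comp h (cder_cexp _)).
Qed.

Lemma cder_Uth th z i j : cder (fun w => Uth th w i j) z (Uth th z i j * ('i%C * (blen j)%:C)).
Proof.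
apply: (@cder_ext _ (fun w => S_mx Q i j * cexp ('i%C * (w * (blen j)%:C + (th 0 j)%:C)))).
  by move=> w; rewrite [in RHS]mxE.
apply: cder_eq (cderZ (S_mx Q i j) (cder_phase th z j)) _.
by rewrite [in RHS]mxE mulrA.
Qed.

Lemma cder_IdU th z i j :
  cder (fun w => (1%:M - Uth th w) i j) z (- (Uth th z i j * ('i%C * (blen j)%:C))).
Proof.
apply: (@cder_ext _ (fun w => (1%:M : 'M[C]_n) i j - Uth th w i j)).
  by move=> w; rewrite [in RHS]mxE [X in _ = _ + X]mxE.
by apply: cder_eq (cderB (cder_cst _ z) (cder_Uth th z i j)) _; rewrite sub0r.
Qed.

Definition Fth' th z : C :=
  \tr ((\matrix_(i, j) - (Uth th z i j * ('i%C * (blen j)%:C))) *m \adj (1%:M - Uth th z)).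

Lemma cder_Fth th z : cder (Fth th) z (Fth' th z).
Proof. by apply: cder_det => i j; rewrite mxE; exact: cder_IdU. Qed.

Lemma entire_Fth th : entire (Fth th).
Proof. by move=> z; exists (Fth' th z); exact: cder_Fth. Qed.

Lemma U'_mxE z : U'_mx Q z = - \matrix_(i, j) - (Uth 0 z i j * ('i%C * (blen j)%:C)).
Proof.
apply/matrixP => i j; rewrite [LHS]mxE [in RHS]mxE [in RHS]mxE opprK.
have -> : (fun w => U_mx Q w i j) = (fun w => Uth 0 w i j).
  by apply/funext => w; rewrite U_mx_phase0.
exact: cder_cderiv (cder_Uth 0 z i j).
Qed.

Lemma trace_logderiv z : Fth 0 z != 0 ->
  \tr (U'_mx Q z *m invmx (1%:M - U_mx Q z)) = - (cderiv (Fth 0) z / Fth 0 z).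
Proof.
move=> F0; rewrite (cder_cderiv (cder_Fth 0 z)) /Fth' U'_mxE U_mx_phase0.
rewrite /invmx unitmxE unitfE F0 mulNmx (raddfN (@mxtrace _ _)); congr (- _).
by rewrite -scalemxAr /= mxtraceZ mulrC.
Qed.

Lemma res_multE z : res_mult Q z = zero_order (Fth 0) z.
Proof.
have E : (fun z => \det (1%:M - U_mx Q z)) = Fth 0.
  by apply/funext => w; rewrite U_mx_phase0.
by rewrite /res_mult E.
Qed.

Lemma Fth_translate (t : R) : exists2 th : 'rV[R]_n, (forall j, - pi <= th 0 j <= pi) &
  forall z, Fth 0 (z + t%:C) = Fth th z.
Proof.
have h (j : 'I_n) : exists s : R, - pi <= s <= pi /\
    cexp ('i%C * s%:C) = cexp ('i%C * (t * blen j)%:C).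
  by have [s s1 s2] := phase_reduction (t * blen j); exists s.
have /choice[u hu] := h.
exists (\row_j u j) => [j|z]; first by rewrite mxE; exact: (hu j).1.
congr (\det (_ - _)); apply/matrixP => i j; rewrite !mxE; congr (_ * _).
rewrite addr0 mulrDl mulrDr [in RHS]mulrDr !cexpD; congr (_ * _).
by rewrite (hu j).2 rmorphM.
Qed.

(** Squared modulus: unlike [n1] it is exactly multiplicative and a quadratic form, as energy
    balances require. *)
Definition sqn (z : C) : R := complex.Re z ^+ 2 + complex.Im z ^+ 2.

Lemma sqn_ge0 z : 0 <= sqn z. Proof. by rewrite addr_ge0 ?sqr_ge0. Qed.

Lemma sqn_eq0 z : sqn z = 0 -> z = 0.
Proof.
case: z => x y; rewrite /sqn /= => /eqP.
by rewrite paddr_eq0 ?sqr_ge0// !sqrf_eq0 => /andP[/eqP -> /eqP ->].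
Qed.

Lemma sqnM z w : sqn (z * w) = sqn z * sqn w.
Proof. by case: z w => a b [c d]; rewrite /sqn /=; ring. Qed.

(** A bond issuing from v is determined by its edge, because the two end points of an edge differ;
    conversely an edge at v has the form {v, u}. *)
Lemma card_orig (v : Q) : #|[set b : bond Q | orig b == v]%SET| = deg v.
Proof.
pose f (b : bond Q) := [set (val b).1; (val b).2]%SET.
have inj : {in [set b : bond Q | orig b == v]%SET &, injective f}.
  move=> b b'; rewrite !inE /orig => /eqP b1 /eqP b'1 ff.
  have ne (c : bond Q) : (val c).1 != (val c).2.
    by have := card_edge (valP c); rewrite cards2; case: eqP.
  have : (val b).2 \in f b' by rewrite -ff !inE eqxx orbT.
  rewrite !inE b'1 -b1 [_ == _.1]eq_sym (negbTE (ne b)) /= => /eqP e2.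
  apply: val_inj; rewrite [LHS]surjective_pairing [RHS]surjective_pairing.
  by congr (_, _); [rewrite b1 b'1|exact: e2].
rewrite -(card_in_imset inj); apply: eq_card => e; rewrite !inE.
apply/imsetP/idP => [[b]|/andP[ee ve]].
  rewrite !inE => /eqP bv ->; apply/andP; split; first exact: (valP b).
  by rewrite !inE -bv eqxx.
have /eqP/cards2P[x [y [xy eE]]] := card_edge ee.
have [u eu] : exists u, e = [set v; u]%SET.
  move: ve; rewrite eE !inE => /orP[/eqP ->|/eqP ->]; first by exists y.
  by exists x; rewrite finset.setUC.
have pe : [set v; u]%SET \in edges Q by rewrite -eu.
by exists (Sub (v, u) pe : bond Q); rewrite ?inE /orig /f ?SubK.
Qed.

End PhasedDeterminant.

(** * Energy balance at a single vertex *)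

Section VertexEnergy.
Variables (R : realType) (T : finType) (A : {set T}) (w : T -> R).
Let s := \sum_(b in A) w b.
Let d := (#|A|%:R : R).

(** Scattering at a vertex is c J - Id with J the all-ones matrix, so the energy changes only
    through the sum s. *)
Lemma vertex_energy (c : R) : \sum_(b in A) (c * s - w b) ^+ 2 =
  \sum_(b in A) w b ^+ 2 + s ^+ 2 * (d * c ^+ 2 - 2 * c).
Proof.
transitivity (\sum_(b in A) (((c * s) ^+ 2 - (2 * c * s) * w b) + w b ^+ 2)).
  by apply: eq_bigr => b _; ring.
rewrite big_split /= big_split /= sumr_const sumrN -mulr_sumr -/s -mulr_natl -/d; ring.
Qed.

(** Cauchy-Schwarz, obtained as non-negativity of the variance: c = 1 / d in [vertex_energy]. *)
Lemma sum_sqr_le : s ^+ 2 <= d * \sum_(b in A) w b ^+ 2.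
Proof.
have [d0|d0] := eqVneq #|A| 0%N.
  have A0 : A = finset.set0 by apply: cards0_eq.
  by rewrite /s /d A0 !big_set0 expr0n /= mulr0.
have dp : 0 < d by rewrite ltr0n lt0n.
have : 0 <= \sum_(b in A) (d^-1 * s - w b) ^+ 2 by apply: sumr_ge0 => b _; exact: sqr_ge0.
rewrite vertex_energy.
have -> : d * d^-1 ^+ 2 - 2 * d^-1 = - d^-1 by field; rewrite gt_eqF.
by rewrite mulrN subr_ge0 ler_pdivrMr// mulrC.
Qed.

(** For c = 2 / (n + d) the coefficient of s^2 is - 4 n / (n + d)^2: the leads take energy away. *)
Lemma vertex_energy_le (n : nat) :
  \sum_(b in A) (2 / (n + #|A|)%:R * s - w b) ^+ 2 <= \sum_(b in A) w b ^+ 2.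
Proof.
rewrite vertex_energy gerDl mulr_ge0_le0 ?sqr_ge0//.
rewrite natrD -/d; set m := (n%:R : R).
(* An isolated vertex without leads, where 2 / 0 = 0. *)
have [nd0|nd0] := eqVneq (m + d) 0; first by rewrite nd0 invr0 !mulr0 expr0n mulr0 subr0.
have -> : d * (2 / (m + d)) ^+ 2 - 2 * (2 / (m + d)) = - (4 * m * ((m + d)^-1) ^+ 2) by field.
by rewrite oppr_le0 mulr_ge0 ?sqr_ge0// mulr_ge0// ler0n.
Qed.

(** By Cauchy-Schwarz at least the fraction 1 - 4 n d / (n + d)^2 = (n - d)^2 / (n + d)^2 of the
    energy remains, and distinct integers satisfy (n - d)^2 >= 1. *)
Lemma vertex_energy_ge (n K : nat) : n != #|A| -> (n + #|A| <= K)%N ->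
  \sum_(b in A) w b ^+ 2 <= K%:R ^+ 2 * \sum_(b in A) (2 / (n + #|A|)%:R * s - w b) ^+ 2.
Proof.
move=> nA nK; rewrite vertex_energy.
set E := \sum_(b in A) w b ^+ 2.
have E0 : 0 <= E by apply: sumr_ge0 => b _; exact: sqr_ge0.
have md : 0 < ((n + #|A|)%:R : R).
  by rewrite ltr0n; case: n nA {nK} => [|n //]; case: #|A|.
have hs := sum_sqr_le; rewrite -/E in hs.
have mdK : ((n + #|A|)%:R : R) <= K%:R by rewrite ler_nat.
rewrite natrD -/d; rewrite natrD -/d in md mdK; set m := (n%:R : R) in md mdK *.
(* The sum of the two truncated differences is |n - d| as a natural number, which turns n <> d into
   a bound by 1. *)
have md1 : 1 <= (m - d) ^+ 2.
  have -> : (m - d) ^+ 2 = (((n - #|A|) + (#|A| - n)) ^ 2)%N%:R.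
    rewrite natrX; case: (leqP n #|A|) => h.
      by rewrite (eqP (_ : n - #|A| == 0)%N)// add0n natrB// -/m -/d -sqrrN opprB.
    by rewrite (eqP (_ : #|A| - n == 0)%N) ?addn0 ?natrB ?subn_eq0// ltnW.
  by rewrite ler1n expn_gt0 addn_gt0 !subn_gt0; case: ltngtP nA.
have -> : d * (2 / (m + d)) ^+ 2 - 2 * (2 / (m + d)) = - (4 * m * ((m + d)^-1) ^+ 2) by field; rewrite gt_eqF.
have m0 : 0 <= m by rewrite ler0n.
have h2 : E * ((m + d)^-1) ^+ 2 <= E + s ^+ 2 * - (4 * m * ((m + d)^-1) ^+ 2).
  have : s ^+ 2 * (4 * m * ((m + d)^-1) ^+ 2) <= (d * E) * (4 * m * ((m + d)^-1) ^+ 2).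
    by rewrite ler_wpM2r// !mulr_ge0 ?sqr_ge0 ?invr_ge0 ?(ltW md).
  have : E * ((m + d)^-1) ^+ 2 <= E * ((m - d) ^+ 2 * ((m + d)^-1) ^+ 2).
    by rewrite ler_wpM2l// ler_peMl// sqr_ge0.
  have -> : E * ((m - d) ^+ 2 * ((m + d)^-1) ^+ 2) = E - (d * E) * (4 * m * ((m + d)^-1) ^+ 2).
    by field; rewrite gt_eqF.
  lra.
apply: le_trans (ler_wpM2l (sqr_ge0 _) h2).
have -> : K%:R ^+ 2 * (E * ((m + d)^-1) ^+ 2) = E * (K%:R / (m + d)) ^+ 2 by rewrite exprMn; ring.
rewrite ler_peMr//; apply: exprn_ege1.
by rewrite ler_pdivlMr// mul1r.
Qed.

End VertexEnergy.

(** * Zero-free half-planes of the determinant *)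

Section Scattering.
Variables (R : realType) (Q : quantum_graph R).
Local Notation C := (R[i]).
Implicit Types (b : bond Q) (v : Q) (w x : bond Q -> C) (z : C).

Lemma rev_bondK : involutive (@rev_bond R Q).
Proof. by move=> b; apply: val_inj => /=; case: (val b). Qed.

Lemma bond_len_rev b : bond_len (rev_bond b) = bond_len b.
Proof. by rewrite /bond_len /= finset.setUC. Qed.

Lemma bond_len_gt0 b : 0 < bond_len b.
Proof. exact: len_gt0 (valP b). Qed.

Definition scat w b : C := \sum_b' (sigma b b')%:C * w b'.
Definition vcoef v : R := 2 / (leads v + deg v)%:R.
Definition vsum w v : C := \sum_(b | orig b == v) w b.

Lemma scatE w b : scat w b = (vcoef (orig b))%:C * vsum w (orig b) - w b.
Proof.
rewrite /scat (bigID (fun b' => orig b' == orig b)) /= [X in _ + X]big1 ?addr0; last first.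
  by move=> b' hb'; rewrite /sigma eq_sym hb' mul0r.
rewrite /vsum mulr_sumr (bigD1 b)//= [in RHS](bigD1 b)//=.
have -> : sigma b b = vcoef (orig b) - 1 by rewrite /sigma eqxx /= eqxx.
rewrite rmorphB /= mulrBl mul1r addrAC; congr (_ - _); congr (_ + _).
apply: eq_bigr => b' /andP[/eqP h1 h2]; congr (_%:C * _).
by rewrite /sigma h1 eqxx /= eq_sym h2.
Qed.

Lemma ReB (u t : C) : complex.Re (u - t) = complex.Re u - complex.Re t. Proof. by case: u t => ? ? []. Qed.
Lemma ImB (u t : C) : complex.Im (u - t) = complex.Im u - complex.Im t. Proof. by case: u t => ? ? []. Qed.
Lemma ReCl (r : R) (u : C) : complex.Re (r%:C * u) = r * complex.Re u.
Proof. by case: u => ? ?; rewrite /= mul0r subr0. Qed.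
Lemma ImCl (r : R) (u : C) : complex.Im (r%:C * u) = r * complex.Im u.
Proof. by case: u => ? ?; rewrite /= mul0r addr0. Qed.
Lemma Re_sum (I : Type) (r : seq I) (P : pred I) (f : I -> C) :
  complex.Re (\sum_(i <- r | P i) f i) = \sum_(i <- r | P i) complex.Re (f i).
Proof. by apply: (big_morph (@complex.Re R)) => // -[? ?] []. Qed.
Lemma Im_sum (I : Type) (r : seq I) (P : pred I) (f : I -> C) :
  complex.Im (\sum_(i <- r | P i) f i) = \sum_(i <- r | P i) complex.Im (f i).
Proof. by apply: (big_morph (@complex.Im R)) => // -[? ?] []. Qed.

Definition obonds v : {set bond Q} := [set b | orig b == v]%SET.

Lemma sum_obonds (S : nmodType) (F : bond Q -> S) v :
  \sum_(b in obonds v) F b = \sum_(b | orig b == v) F b.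
Proof. by apply: eq_bigl => b; rewrite inE. Qed.

Lemma sqn_scat w v : \sum_(b | orig b == v) sqn (scat w b) =
  \sum_(b in obonds v) (vcoef v * \sum_(b in obonds v) complex.Re (w b) - complex.Re (w b)) ^+ 2 +
  \sum_(b in obonds v) (vcoef v * \sum_(b in obonds v) complex.Im (w b) - complex.Im (w b)) ^+ 2.
Proof.
rewrite -big_split /= !sum_obonds; apply: eq_bigr => b /eqP bv.
by rewrite scatE bv /sqn ReB ImB ReCl ImCl /vsum Re_sum Im_sum.
Qed.

Lemma sqn_split w v : \sum_(b | orig b == v) sqn (w b) =
  \sum_(b in obonds v) complex.Re (w b) ^+ 2 + \sum_(b in obonds v) complex.Im (w b) ^+ 2.
Proof. by rewrite -big_split /= sum_obonds. Qed.

Lemma energy_le w : \sum_b sqn (scat w b) <= \sum_b sqn (w b).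
Proof.
rewrite (partition_big (@orig R Q) xpredT)//= [leRHS](partition_big (@orig R Q) xpredT)//=.
apply: ler_sum => v _; rewrite sqn_scat sqn_split /=.
have := vertex_energy_le (obonds v) (fun b => complex.Re (w b)) (leads v).
have := vertex_energy_le (obonds v) (fun b => complex.Im (w b)) (leads v).
rewrite (card_orig v : #|obonds v| = _); exact: (fun h1 h2 => lerD h2 h1).
Qed.

(* The vertex matrix has eigenvalues [-1] and [(d - n) / (d + n)] with [n != d]. *)
Lemma energy_ge w (K : nat) : unbalanced Q -> (forall v, leads v + deg v <= K)%N ->
  \sum_b sqn (w b) <= K%:R ^+ 2 * \sum_b sqn (scat w b).
Proof.
move=> unb hK; rewrite (partition_big (@orig R Q) xpredT)//= [X in _ * X](partition_big (@orig R Q) xpredT)//=.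
rewrite mulr_sumr; apply: ler_sum => v _; rewrite sqn_scat sqn_split /= mulrDr.
have := @vertex_energy_ge R _ (obonds v) (fun b => complex.Re (w b)) (leads v) K.
have := @vertex_energy_ge R _ (obonds v) (fun b => complex.Im (w b)) (leads v) K.
rewrite (card_orig v : #|obonds v| = _) => /(_ (unb v) (hK v)) h1 /(_ (unb v) (hK v)) h2; exact: lerD h2 h1.
Qed.

Definition bphase (th : 'rV[R]_#|bond Q|) z b : C :=
  cexp ('i%C * (z * (bond_len b)%:C + (th 0 (enum_rank b))%:C)).

(** x b is the amplitude leaving the origin of b; the amplitude arriving there left on the reversed
    bond and acquired the phase. Moving the reversal from [S_mx] to the wave leaves [scat], which
    acts vertex by vertex. *)
Lemma Fth_kernel th z : Fth th z = 0 -> exists2 x : bond Q -> C, (exists b, x b != 0) &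
  forall b, x b = scat (fun b' => bphase th z (rev_bond b') * x (rev_bond b')) b.
Proof.
(* [det0P] yields a row vector, so the transpose is taken to get a right null vector. *)
rewrite /Fth -det_tr => /eqP/det0P[v v0 hv].
exists (fun b => v 0 (enum_rank b)).
  by move/rV0Pn : v0 => [j]; exists (enum_val j); rewrite enum_valK.
move=> b; have E : \sum_j v 0 j * (1%:M - Uth th z) (enum_rank b) j = 0.
  have := congr1 (fun M : 'rV[C]_#|bond Q| => M 0 (enum_rank b)) hv.
  rewrite [(0 : 'rV[C]_#|bond Q|) _ _]mxE mxE => H; rewrite -[RHS]H.
  by apply: eq_bigr => j _; rewrite [in RHS]mxE.
have K j : (1%:M - Uth th z) (enum_rank b) j =
    (1%:M : 'M[C]_#|bond Q|) (enum_rank b) j - Uth th z (enum_rank b) j.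
  by rewrite [LHS]mxE [X in _ + X = _]mxE.
move: E; under eq_bigr => j _ do rewrite K mulrBr.
rewrite big_split /= sumrN => /eqP; rewrite subr_eq0 => /eqP.
rewrite (bigD1 (enum_rank b))//= big1 ?addr0; last first.
  by move=> j jb; rewrite mxE eq_sym (negbTE jb) mulr0.
rewrite mxE eqxx mulr1 => ->.
rewrite /scat (reindex_inj (inv_inj rev_bondK)) /=.
rewrite (reindex_onto (@enum_rank (bond Q)) enum_val) /=; last by move=> j _; rewrite enum_valK.
rewrite (eq_bigl xpredT) => [|b']; last by rewrite enum_rankK eqxx.
apply: eq_bigr => b' _; rewrite !mxE !enum_rankK rev_bondK /bphase /blen enum_rankK.
by rewrite mulrC mulrA.
Qed.

Lemma sqn_bphase th z b : sqn (bphase th z b) = expR (- (complex.Im z * bond_len b)) ^+ 2.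
Proof.
rewrite /sqn /bphase cexp_sqn; congr (expR _ ^+ 2).
by case: z => ? ? /=; ring.
Qed.

Lemma wave_energy th z x : \sum_b sqn (bphase th z (rev_bond b) * x (rev_bond b)) =
  \sum_b expR (- (complex.Im z * bond_len b)) ^+ 2 * sqn (x b).
Proof.
rewrite [RHS](reindex_inj (inv_inj rev_bondK)) /=.
by apply: eq_bigr => b _; rewrite sqnM sqn_bphase.
Qed.

Lemma sqn_sum_contra x (u : bond Q -> R) : (exists b, x b != 0) -> (forall b, 0 < u b) ->
  \sum_b u b * sqn (x b) <= 0 -> False.
Proof.
move=> [b xb] hu hs; move/negP : xb; apply; apply/eqP/sqn_eq0.
have h0 b' : 0 <= u b' * sqn (x b') by rewrite mulr_ge0 ?sqn_ge0// ltW.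
have : \sum_b u b * sqn (x b) = 0 by apply/eqP; rewrite eq_le hs sumr_ge0.
move=> /eqP; rewrite psumr_eq0// => /allP /(_ b (mem_index_enum _)) /=.
by rewrite mulf_eq0 gt_eqF//= => /eqP.
Qed.

(** Travelling along b multiplies the energy by exp (- 2 Im z L_b) < 1 and scattering does not
    increase it, so a stationary wave vanishes. The real phases [th] do not affect moduli. *)
Lemma Fth_neq0_up (th : 'rV[R]_#|bond Q|) z : 0 < complex.Im z -> Fth th z != 0.
Proof.
move=> z0; apply/eqP => /Fth_kernel[x x0 hx].
apply: (@sqn_sum_contra x (fun b => 1 - expR (- (complex.Im z * bond_len b)) ^+ 2) x0).
  move=> b; rewrite subr_gt0 expr_lt1 ?expR_ge0// -expR0 ltr_expR.
  by rewrite oppr_lt0 mulr_gt0// bond_len_gt0.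
under eq_bigr do rewrite mulrBl mul1r.
rewrite sumrB -(wave_energy th) subr_le0.
apply: le_trans (energy_le _); apply: ler_sum => b _; by rewrite -hx.
Qed.

(** Im z < Y says exp (- Im z Lmin) > D + n0, and longer bonds amplify more since Im z < 0.
    Travelling thus gains more than the factor (D + n0)^2 that scattering can lose by
    [energy_ge]. *)
Lemma Fth_neq0_down (th : 'rV[R]_#|bond Q|) z (D n0 : nat) (Lmin Lmax : R) : (0 < n0)%N -> (0 < D)%N -> 0 < Lmin ->
  bounded_data Q D n0 Lmin Lmax -> unbalanced Q ->
  complex.Im z < Y_bound D n0 Lmin -> Fth th z != 0.
Proof.
move=> n00 D0 L0 [hv he] unb zY; apply/eqP => /Fth_kernel[x x0 hx].
have K1 : 1 <= ((D + n0)%:R : R) by rewrite ler1n addn_gt0 D0.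
have K0 : 0 < ((D + n0)%:R : R) by rewrite (lt_le_trans _ K1).
apply: (@sqn_sum_contra x (fun b => expR (- (complex.Im z * bond_len b)) ^+ 2 - (D + n0)%:R ^+ 2) x0).
  move=> b; rewrite subr_gt0 ltr_pXn2r ?nnegrE ?expR_ge0 ?ler0n//.
  rewrite -[ltLHS]lnK ?posrE// ltr_expR.
  have /andP[Lb _] := he _ (valP b); rewrite -[len _]/(bond_len b) in Lb.
  have ln0 : 0 <= ln ((D + n0)%:R : R) by exact: ln_ge0.
  have h : ln ((D + n0)%:R : R) < - complex.Im z * Lmin.
    by move: zY; rewrite /Y_bound ltrNr ltr_pdivrMr.
  apply: lt_le_trans h _; rewrite -mulNr ler_wpM2l//.
  by have := zY; rewrite /Y_bound => h; rewrite oppr_ge0; apply: le_trans (ltW h) _;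
    rewrite oppr_le0 divr_ge0// ltW.
under eq_bigr do rewrite mulrBl.
rewrite sumrB -(wave_energy th) -mulr_sumr subr_le0.
have hK v : (leads v + deg v <= D + n0)%N.
  by have [h1 h2] := hv v; rewrite addnC leq_add.
apply: le_trans (energy_ge _ unb hK) _.
by rewrite ler_wpM2l ?sqr_ge0//; apply: ler_sum => b _; rewrite -hx.
Qed.

End Scattering.

(** * Resonances from zeros of the determinant *)

Section WaveSolutions.
Variables (R : realType) (Q : quantum_graph R).
Local Notation C := (R[i]).
Implicit Types (b : bond Q) (v : Q) (z u al be : C) (L : R).

(** The second term is anchored at the far end, so that reversing the bond exchanges [al] and
    [be]. *)
Definition wave z al be L u : C :=
  al * cexp ('i%C * z * u) + be * cexp ('i%C * z * (L%:C - u)).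

(** The derivative is again a wave, with amplitudes multiplied by iz and - iz, so the same lemma
    gives the second derivative. *)
Lemma cder_wave z al be L u :
  cder (wave z al be L) u (wave z ('i%C * z * al) (- ('i%C * z * be)) L u).
Proof.
have h1 : cder (fun t => 'i%C * z * t) u ('i%C * z).
  by apply: cder_eq (cderZ ('i%C * z) (cder_id u)) _; rewrite mulr1.
have h2 : cder (fun t => 'i%C * z * (L%:C - t)) u (- ('i%C * z)).
  apply: cder_eq (cderZ ('i%C * z) (cderB (cder_cst L%:C u) (cder_id u))) _.
  by rewrite sub0r mulrN1.
apply: cder_eq (cderD (cderZ al (cder_comp h1 (cder_cexp _))) (cderZ be (cder_comp h2 (cder_cexp _)))) _.
rewrite /wave; ring.
Qed.

Lemma deriv_within_cder (A : set R) (G G' : C -> C) :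
  (forall u, cder G u (G' u)) ->
  deriv_within A (fun t : R => G t%:C : Cplx R) (fun t : R => G' t%:C : Cplx R).
Proof.
move=> h t At.
have key : ((fun y => (G y%:C - G t%:C) / (y - t)%:C) : R -> Cplx R) @ t^' --> (G' t%:C : Cplx R).
  apply/cvg_n1 => e e0.
  have e2 : 0 < e / 2 by lra.
  have /cderP/(_ _ e2)[d d0 hd] := h t%:C.
  apply/nbhs_ballP; exists d => // y /=; rewrite -ball_normE /= distrC => yt y0.
  have yt0 : (y - t)%:C != 0 by rewrite fmorph_eq0 subr_eq0.
  have := hd y%:C; rewrite -rmorphB /= n1C => /(_ yt) hy.
  have -> : (G y%:C - G t%:C) / (y - t)%:C - G' t%:C =
    (y - t)^-1%:C * (G y%:C - G t%:C - G' t%:C * (y - t)%:C).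
    have F (p q k : C) : k != 0 -> p / k - q = k^-1 * (p - q * k) by move=> k0; field.
    by rewrite (F _ _ _ yt0); congr (_ * _); rewrite fmorphV.
  rewrite n1Cl normrV ?unitfE ?subr_eq0// mulrC ltr_pdivrMr ?normr_gt0 ?subr_eq0//.
  apply: le_lt_trans hy _; rewrite ltr_pM2r ?normr_gt0 ?subr_eq0//; lra.
apply: cvg_trans key; apply: cvg_app; exact: cvg_within.
Qed.

Lemma within_continuous_cder (A : set R) (G G' : C -> C) :
  (forall u, cder G u (G' u)) -> {within A, continuous (fun t : R => G t%:C : Cplx R)}.
Proof.
move=> h; apply: continuous_subspaceT => t.
apply/(cvg_n1 (nbhs_filter t)) => e e0.
have [d d0 hd] := cder_ccont (h t%:C) e0.
apply/nbhs_ballP; exists d => // y /=; rewrite -ball_normE /= distrC => yt.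
by apply: hd; rewrite -rmorphB n1C.
Qed.

(** On leads the length 0 is a filler: [be] vanishes there. *)
Definition hlen (b : hbond Q) : R := if b is inl b then bond_len b else 0.

Lemma wave_resonance z (al be : hbond Q -> C) (phi : Q -> C) :
  (exists (b : hbond Q) x, hdom b x /\ wave z (al b) (be b) (hlen b) x%:C != 0) ->
  (forall b : bond Q, be (inl b) = al (inl (rev_bond b))) ->
  (forall l, be (inr l) = 0) ->
  (forall b : hbond Q, al b + be b * cexp ('i%C * z * (hlen b)%:C) = phi (horig b)) ->
  (forall v, \sum_(b : hbond Q | horig b == v)
     ('i%C * z) * (al b - be b * cexp ('i%C * z * (hlen b)%:C)) = 0) ->
  is_resonance Q z.
Proof.
move=> hne hrev hlead hphi hcur.
pose f (b : hbond Q) (x : R) : Cplx R := wave z (al b) (be b) (hlen b) x%:C.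
pose f1 (b : hbond Q) (x : R) : Cplx R := wave z ('i%C * z * al b) (- ('i%C * z * be b)) (hlen b) x%:C.
pose f2 (b : hbond Q) (x : R) : Cplx R := wave z ('i%C * z * ('i%C * z * al b)) (- ('i%C * z * - ('i%C * z * be b))) (hlen b) x%:C.
have f0 (b : hbond Q) : f b 0 = phi (horig b).
  rewrite /f /wave -hphi; congr (_ + _ * cexp _); last by rewrite subr0.
  by rewrite mulr0 cexp0 mulr1.
exists f, f1, f2; split; first exact: hne.
split.
  move=> b; split.
  - by apply: deriv_within_cder => u; exact: cder_wave.
  - by apply: deriv_within_cder => u; exact: cder_wave.
  - by apply: (@within_continuous_cder _ _ _) => u; exact: cder_wave.
split.
  move=> b x _; rewrite /f /wave /= bond_len_rev hrev (hrev (rev_bond b)) rev_bondK rmorphB /= addrC.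
  by congr (_ * cexp (_ * _) + _ * cexp (_ * _)); rewrite opprB addrC subrK.
split; first by move=> b b' e; rewrite !f0 e.
split.
  move=> v; rewrite -[RHS](hcur v); apply: eq_bigr => b _.
  by rewrite /f1 /wave mulr0 subr0 cexp0; ring.
split.
  move=> b x _; rewrite /f2 /f /wave.
  have i2 : 'i%C * 'i%C = -1 :> C by rewrite -expr2 sqr_i.
  have E (t : C) : 'i%C * z * ('i%C * z * t) = - (z ^+ 2 * t).
    by rewrite [LHS](_ : _ = ('i%C * 'i%C) * (z ^+ 2 * t)); [rewrite i2 mulN1r|ring].
  by rewrite mulrN opprK !E; ring.
move=> l x _; rewrite f0 -hphi /f /wave !hlead !mul0r !addr0.
by [].
Qed.

(** The constant function 1, split into halves on bonds and purely outgoing on leads. At z = 0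
    amplitudes x and - x give the zero function, so the construction of [root_is_resonance] could
    degenerate. *)
Lemma zero_is_resonance b : is_resonance Q 0.
Proof.
apply: (@wave_resonance 0 (fun h : hbond Q => if h is inl _ then 2^-1 else 1) (fun h : hbond Q => if h is inl _ then 2^-1 else 0) (fun=> 1)) => //.
- exists (inl b), 0; split; first by rewrite /= lexx ltW// bond_len_gt0.
  rewrite /wave !mulr0 !mul0r cexp0 !mulr1.
  have -> : 2^-1 + 2^-1 = 1 :> C by field.
  exact: oner_neq0.
- by move=> [b'|l] /=; [rewrite mulr0 mul0r cexp0; field|rewrite mul0r addr0].
- by move=> v; rewrite big1// => b' _; rewrite mulr0 mul0r.
Qed.

Lemma sum_leads v (a : C) : \sum_(l : lead Q | tag l == v) a = (leads v)%:R * a.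
Proof.
transitivity (\sum_(i < leads v) a); last by rewrite sumr_const card_ord mulr_natl.
have := @sig_big_dep C 0 +%R Q (fun v => 'I_(leads v)) (pred1 v) (fun _ => xpredT) (fun _ _ => a).
rewrite big_pred1_eq => ->.
by apply: eq_bigl => l; rewrite andbT.
Qed.

(** x b and w b are the outgoing and incoming amplitudes at the origin of b. Their sum is the common
    vertex value phi, and the definition of phi by (n + d) phi = 2 (sum of w) is exactly current
    conservation. *)
Lemma root_is_resonance z : z != 0 -> Fth (0 : 'rV[R]_#|bond Q|) z = 0 -> is_resonance Q z.
Proof.
move=> z0 /Fth_kernel[x [b0 xb0] hx].
set w := fun b => bphase 0 z (rev_bond b) * x (rev_bond b).
have wE b : w b = x (rev_bond b) * cexp ('i%C * z * (bond_len b)%:C).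
  by rewrite /w /bphase mxE bond_len_rev addr0 mulrC mulrA.
pose phi v := (vcoef v)%:C * vsum w v.
have hphi b : x b + w b = phi (orig b) by rewrite hx -/w scatE subrK.
pose al (b : hbond Q) := match b with inl b => x b | inr l => phi (tag l) end.
pose be (b : hbond Q) := if b is inl b then x (rev_bond b) else 0.
have iz : 'i%C * z != 0 by rewrite mulf_neq0// eq_complex /= oner_eq0 andbF.
apply: (@wave_resonance z al be phi) => //.
(* If the wave vanished on all of b0, its value and derivative at 0 would give x + w = 0 and x - w =
   0, hence x b0 = 0. *)
- apply: contrapT => hn.
  have h0 t : 0 <= t <= bond_len b0 -> wave z (x b0) (x (rev_bond b0)) (bond_len b0) t%:C = 0.
    by move=> ht; apply/eqP; apply: contrapT => /negP h; apply: hn; exists (inl b0), t.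
  have L0 := bond_len_gt0 b0.
  have k1 : x b0 + w b0 = 0.
    have := h0 0; rewrite lexx ltW// => /(_ isT); rewrite /wave mulr0 cexp0 mulr1 subr0.
    by rewrite -wE.
  have D : cder (wave z (x b0) (x (rev_bond b0)) (bond_len b0)) 0 ('i%C * z * (x b0 - w b0)).
    apply: cder_eq (cder_wave _ _ _ _ _) _.
    by rewrite /wave mulr0 cexp0 subr0 wE; ring.
  have k2 : 'i%C * z * (x b0 - w b0) = 0.
    apply: n1_eq0; apply/eqP; rewrite eq_le n1_ge0 andbT.
    apply/ler_addgt0Pr => e e0; rewrite add0r.
    move/cderP : D => /(_ _ e0)[d d0 hd].
    set t := Num.min (bond_len b0) (d / 2).
    have t0 : 0 < t by rewrite lt_min L0 divr_gt0.
    have := hd t%:C; rewrite subr0 n1C gtr0_norm// => /(_ _).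
    rewrite (h0 t); last by rewrite ltW// ge_min lexx.
    rewrite -[0]/((0 : R)%:C) (h0 0); last by rewrite lexx ltW.
    rewrite subr0 sub0r n1N mulrC n1Cl gtr0_norm// mulrC ler_pM2r//; apply.
    by rewrite gt_min; apply/orP; right; rewrite ltr_pdivrMr// ltr_pMr// ltr1n.
  move/eqP: k2; rewrite mulf_eq0 (negbTE iz) /= subr_eq0 => /eqP xw.
  move/negP : xb0; apply; move/eqP : k1; rewrite -xw -mulr2n -mulr_natl mulf_eq0 pnatr_eq0.
  by [].
- by case=> [b|l] /=; [rewrite -wE hphi|rewrite mul0r addr0].
- move=> v; rewrite big_sumType /=.
  under [X in X + _]eq_bigr => b bv do rewrite -wE.
  under [X in _ + X]eq_bigr => l /eqP lv do rewrite lv mul0r subr0.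
  rewrite sum_leads.
  have -> : \sum_(b | orig b == v) 'i%C * z * (x b - w b) =
    'i%C * z * ((deg v)%:R * phi v - 2 * vsum w v).
    rewrite -mulr_sumr; congr (_ * _).
    transitivity (\sum_(b | orig b == v) (phi v - 2 * w b)).
      by apply: eq_bigr => b /eqP bv; rewrite -bv -hphi; ring.
    rewrite sumrB; congr (_ - _); last by rewrite -mulr_sumr.
    rewrite -(card_orig v) -sum1_card natr_sum mulr_suml.
    rewrite [RHS](eq_bigl (fun b => orig b == v)); last by move=> b; rewrite inE.
    by apply: eq_bigr => b _; rewrite mul1r.
  have [d0|d0] := eqVneq (leads v + deg v)%N 0%N.
    have [lv dv] : leads v = 0%N /\ deg v = 0%N by move/eqP: d0; rewrite addn_eq0 => /andP[/eqP -> /eqP ->].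
    have s0 : vsum w v = 0.
      rewrite /vsum big_pred0// => b; apply/negP => bv.
      have := card_orig v; rewrite dv => /eqP; rewrite cards_eq0 => /eqP/setP/(_ b).
      by rewrite !inE bv.
    by rewrite lv dv s0 !mul0r mulr0 subr0 mulr0 addr0.
  have E : ((leads v)%:R + (deg v)%:R) * phi v = 2 * vsum w v.
    rewrite /phi /vcoef mulrA -natrD fmorph_div !rmorph_nat mulrCA divff ?mulr1//.
    by rewrite pnatr_eq0.
  have -> : 'i%C * z * ((deg v)%:R * phi v - 2 * vsum w v) + (leads v)%:R * ('i%C * z * phi v) =
    'i%C * z * (((leads v)%:R + (deg v)%:R) * phi v - 2 * vsum w v) by ring.
  by rewrite E subrr mulr0.
Qed.

(** Places the zeros of F in the index set of the sum. At z = 0 the null vector supplies the bond on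
    which the constant wave lives. *)
Lemma Fth0_Res z : Fth (0 : 'rV[R]_#|bond Q|) z = 0 -> Res Q z.
Proof.
move=> h; have [z0|z0] := eqVneq z 0; last exact: root_is_resonance.
by have [x [b _] _] := Fth_kernel h; rewrite z0; exact: zero_is_resonance b.
Qed.

End WaveSolutions.

(** * Uniform estimates by compactness *)

Section FilterSums.
Variables (R : realType) (T : Type) (F : set_system T) (FF : Filter F).

Lemma cvg_csum (I : Type) (r : seq I) (f : I -> T -> Cplx R) (l : I -> Cplx R) :
  (forall i, f i x @[x --> F] --> l i) ->
  (\sum_(i <- r) f i x) @[x --> F] --> (\sum_(i <- r) l i).
Proof.
move=> h; elim: r => [|i r ih].
  rewrite big_nil; under eq_fun do rewrite big_nil; exact: cvg_cst.
rewrite big_cons; under eq_fun do rewrite big_cons.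
exact: (@cvgD _ (Cplx R) _ _ _ _ _ _ _ (h i) ih).
Qed.

Lemma cvg_cprod (I : Type) (r : seq I) (f : I -> T -> Cplx R) (l : I -> Cplx R) :
  (forall i, f i x @[x --> F] --> l i) ->
  (\prod_(i <- r) (f i x : R[i]) : Cplx R) @[x --> F] --> (\prod_(i <- r) (l i : R[i]) : Cplx R).
Proof.
move=> h; elim: r => [|i r ih].
  rewrite big_nil; under eq_fun do rewrite big_nil; exact: cvg_cst.
rewrite big_cons; under eq_fun do rewrite big_cons.
exact: (@cvgM (R[i]) _ _ _ _ _ _ _ (h i) ih).
Qed.

End FilterSums.

Section PhaseCompactness.
Variables (R : realType) (Q : quantum_graph R).
Local Notation C := (R[i]).
Local Notation n := #|bond Q|.
Local Notation F0 := (Fth (0 : 'rV[R]_n)).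

Lemma Fth_joint (p : 'rV[R]_n * Cplx R) :
  {for p, continuous (fun q : 'rV[R]_n * Cplx R => Fth q.1 q.2 : Cplx R)}.
Proof.
have entry i j : ((1%:M - Uth q.1 q.2) i j : Cplx R) @[q --> p] --> ((1%:M - Uth p.1 p.2) i j : Cplx R).
  have E q : (1%:M - Uth (Q:=Q) q.1 q.2) i j = (1%:M : 'M[C]_n) i j -
      S_mx Q i j * cexp ('i%C * (q.2 * (blen j)%:C + (q.1 0 j)%:C)).
    by rewrite [LHS]mxE [X in _ + X = _]mxE [X in - X]mxE.
  rewrite E; under eq_fun do rewrite E.
  apply: (@cvgB _ (Cplx R)); first exact: cvg_cst.
  apply: (@cvgM (R[i])); first exact: cvg_cst.
  apply: (@cvg_comp _ _ _ (fun q : 'rV[R]_n * Cplx R => 'i%C * (q.2 * (blen j)%:C + (q.1 0 j)%:C) : Cplx R) (@cexp R : Cplx R -> Cplx R) _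
     (nbhs ('i%C * (p.2 * (blen j)%:C + (p.1 0 j)%:C) : Cplx R))); last first.
    exact: (cder_cont (cder_cexp _)).
  apply: (@cvgM (R[i])); first exact: cvg_cst.
  apply: (@cvgD _ (Cplx R)).
    by apply: (@cvgM (R[i])); [exact: cvg_snd|exact: cvg_cst].
  apply/cvg_n1 => e e0.
  have h : (fun q : 'rV[R]_n * Cplx R => q.1 0 j) @ p --> p.1 0 j.
    apply: (@cvg_comp _ _ _ (fun q : 'rV[R]_n * Cplx R => q.1) (fun M : 'rV[R]_n => M 0 j) _ (nbhs p.1)).
      exact: cvg_fst.
    exact: coord_continuous.
  move/cvgrPdist_lt : h => /(_ e e0); apply: filterS => q.
  by rewrite -rmorphB n1C distrC.
rewrite /prop_for /continuous_at /Fth /determinant.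
apply: cvg_csum => s; apply: (@cvgM (R[i])); first exact: cvg_cst.
by apply: cvg_cprod => i; exact: entry.
Qed.

Lemma Fth_line_cont (x : R) (p : 'rV[R]_n * R) :
  {for p, continuous (fun q : 'rV[R]_n * R => n1 (Fth q.1 (x +i* q.2)) : R)}.
Proof.
pose f (q : 'rV[R]_n * R) : 'rV[R]_n * Cplx R := (q.1, x +i* q.2 : Cplx R).
have cf : {for p, continuous f}.
  apply: (@cvg_pair _ _ _ _ (nbhs p.1) (nbhs (x +i* p.2 : Cplx R))); first exact: cvg_fst.
  apply/cvg_n1 => e e0.
  have /cvgrPdist_lt/(_ e e0) : (fun q : 'rV[R]_n * R => q.2) @ p --> p.2 by exact: cvg_snd.
  by apply: filterS => q; rewrite /= n1_ri subrr normr0 add0r distrC.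
have cg := @continuous_comp _ _ _ f (fun q : 'rV[R]_n * Cplx R => Fth q.1 q.2 : Cplx R) p cf (@Fth_joint (f p)).
exact: (@continuous_comp _ (Cplx R) R _ (@n1 R) p cg (@n1_cont R _)).
Qed.

Definition cube : set 'rV[R]_n := [set th | forall j, `[- pi, pi]%classic (th 0 j)].

Lemma compact_cube : compact cube.
Proof.
have := @rV_compact R n (fun=> `[- pi, pi]%classic) (fun _ => @segment_compact _ _ _).
by [].
Qed.

(* Translating [F0] horizontally changes only the phases, which range over a
   compact cube: pointwise estimates on [Fth] become uniform ones on [F0]. *)
Lemma uniform_estimate (r a b : R) (P : R -> R -> Prop) :
  (forall th, cube th -> exists2 x, 0 <= x <= r & forall y, a <= y <= b ->
     \forall v \near n1 (Fth th (x +i* y)) & c \near 0^'+, P c v) ->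
  exists2 c : R, 0 < c & forall t, exists2 x, t <= x <= t + r &
    forall y, a <= y <= b -> P c (n1 (F0 (x +i* y))).
Proof.
move=> h.
pose G (c : R) (th : 'rV[R]_n) := exists2 x, 0 <= x <= r & forall y, a <= y <= b -> P c (n1 (Fth th (x +i* y))).
have : \forall c \near (0 : R)^'+, cube `<=` G c.
  (* Compactness is used twice: the segment [a, b] gives a common threshold for c near one fixed
     [th], then the cube gives one for all phases. *)
  apply: ((compact_near_coveringP cube).1 compact_cube) => th /h[x hx hy].
  have : filter_prod (nbhs th) (0 : R)^'+
      [set p | `[a, b]%classic `<=` (fun y => P p.2 (n1 (Fth p.1 (x +i* y))))].
    have /compact_near_coveringP K := @segment_compact _ a b.
    apply: (K _ (filter_prod (nbhs th) (0 : R)^'+) (fun p y => P p.2 (n1 (Fth p.1 (x +i* y))))).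
    move=> y; rewrite /= in_itv /= => /hy hP.
    have cc := @Fth_line_cont x (th, y).
    case: hP => -[A B] /= [hA hB] hAB.
    have [[A1 A2] /= [hA1 hA2] hA12] := cc _ hA.
    exists (A2, [set p | A1 p.1 /\ B p.2]) => /=.
      by split => //; exists (A1, B).
    move=> [y' [th' c']] /= [h1 [h2 h3]].
    by apply: (hAB (n1 (Fth th' (x +i* y')), c')); split => //; exact: (hA12 (th', y')).
  move=> [[A B] /= [hA hB] hAB].
  exists (A, B) => //= -[th' c'] /= [h1 h2].
  exists x => // y hyab; have := hAB (th', c') (conj h1 h2) y.
  by rewrite /= in_itv /=; apply.
move=> hc; have [c [c0 hcc]] : exists c : R, 0 < c /\ cube `<=` G c.
  near (0 : R)^'+ => c; exists c; split => //.
  by near: c.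
exists c => // t; have [th hth hF] := Fth_translate Q t.
have [x /andP[x0 xr] hy] : G c th by apply: hcc => j; rewrite /= in_itv /=; exact: hth.
exists (t + x); first by apply/andP; split; lra.
move=> y /hy; rewrite -hF; congr (P c (n1 (F0 _))).
by apply/eqP; rewrite eq_complex /= addrC addr0 !eqxx.
Unshelve. all: by end_near.
Qed.

(** Pigeonhole: there is one more equally spaced point in [0, 1) than the list has entries. *)
Lemma seq_avoid (l : seq R) : exists2 x : R, 0 <= x <= 1 & x \notin l.
Proof.
pose f (k : nat) : R := k%:R / (size l).+1%:R.
have finj : injective f.
  move=> i j /(congr1 (fun x => x * (size l).+1%:R)).
  by rewrite /f !mulfVK ?pnatr_eq0// => /eqP; rewrite eqr_nat => /eqP.
have : ~~ all (mem l) [seq f k | k <- iota 0 (size l).+1].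
  apply/negP => /allP h.
  have := uniq_leq_size _ h; rewrite map_inj_uniq// iota_uniq => /(_ isT).
  by rewrite size_map size_iota ltnn.
move=> /allPn[x /mapP[k]]; rewrite mem_iota /= add0n => /= kl -> hx.
exists (f k) => //; rewrite divr_ge0//= ler_pdivrMr ?ltr0n// mul1r ler_nat.
exact: ltnW.
Qed.

(** One point of the upper half-plane witnesses that no phased determinant vanishes identically, as
    [finite_zeros] requires. *)
Lemma Fth_not0 (th : 'rV[R]_n) : Fth th 'i%C != 0.
Proof. by apply: Fth_neq0_up => /=. Qed.

(* For fixed phases, any abscissa avoiding those of the finitely many zeros will do. *)
Lemma lower_bound_vertical (a b : R) : exists2 c : R, 0 < c & forall t, exists2 x, t <= x <= t + 1 &
  forall y, a <= y <= b -> c <= n1 (F0 (x +i* y)).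
Proof.
apply: (@uniform_estimate 1 a b (fun c v => c <= v)) => th _.
have [s us hs] := finite_zeros 0 1 a b (@entire_Fth R Q th) (Fth_not0 th).
have [x x01 xl] := seq_avoid [seq complex.Re z | z <- s].
exists x => // y yab.
have F0y : Fth th (x +i* y) != 0.
  apply/eqP => Fz; move/negP : xl; apply; apply/mapP; exists (x +i* y) => //.
  by apply/hs; rewrite /rect /= x01 yab.
have m0 := n1_gt0 F0y; set m := n1 _ in m0 *.
exists ([set v | m / 2 < v], [set c | c < m / 2]) => /=.
  by split; [apply: lt_nbhsr; lra|apply: nbhs_right_lt; lra].
by move=> [v c] /= [h1 h2]; lra.
Qed.

(** With r = 0 in [uniform_estimate] the abscissa is imposed: F is bounded below at every x because
    all its phased versions are non-zero at abscissa 0. *)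
Lemma lower_bound_horizontal (y : R) : (forall th : 'rV[R]_n, Fth th (0 +i* y) != 0) ->
  exists2 c : R, 0 < c & forall x, c <= n1 (F0 (x +i* y)).
Proof.
move=> hF.
have [|c c0 h] := @uniform_estimate 0 y y (fun c v => c <= v).
  move=> th _; exists 0; first by rewrite lexx.
  move=> y' /andP[y1 y2]; have -> : y' = y by apply/eqP; rewrite eq_le y1 y2.
  have m0 := n1_gt0 (hF th); set m := n1 _ in m0 *.
  exists ([set v | m / 2 < v], [set c | c < m / 2]) => /=.
    by split; [apply: lt_nbhsr; lra|apply: nbhs_right_lt; lra].
  by move=> [v c] /= [h1 h2]; lra.
exists c => // x; have [x' /andP[x1 x2] /(_ y)] := h x.
rewrite lexx => /(_ isT); suff -> : x' = x by [].
by apply/eqP; rewrite eq_le x1 andbT; lra.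
Qed.

(** [uniform_estimate] produces small constants, so the upper bound is sought in the form c |F| <=
    1. *)
Lemma upper_bound_strip (a b : R) : exists2 M : R, 0 < M & forall z, a <= complex.Im z <= b -> n1 (F0 z) <= M.
Proof.
have [|c c0 h] := @uniform_estimate 0 a b (fun c v => c * v <= 1).
  move=> th _; exists 0; first by rewrite lexx.
  move=> y yab; set m := n1 _.
  have m0 : 0 < m + 1 by rewrite ltr_wpDl// n1_ge0.
  exists ([set v | v < m + 1], [set c | 0 < c /\ c < (m + 1)^-1]) => /=.
    split; first by apply: lt_nbhsl; lra.
    by apply: filterI; [exact: nbhs_right_gt|apply: nbhs_right_lt; rewrite invr_gt0].
  move=> [v c] /= [h1 [h2 h3]].
  apply: (@le_trans _ _ (c * (m + 1))); first by rewrite ler_wpM2l ?ltW.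
  by rewrite -ler_pdivlMr// div1r ltW.
exists (c^-1) => [|[x y] hy]; first by rewrite invr_gt0.
have [x' /andP[x1 x2] /(_ y hy)] := h x.
have -> : x' = x by apply/eqP; rewrite eq_le x1 andbT; lra.
by rewrite mulrC -ler_pdivlMr// div1r.
Qed.

(** Cauchy's estimate on squares of half-side 1, whose half perimeter is the 4 in the constant;
    hence the strip widened by 1. *)
Lemma deriv_bound_strip (a b : R) : exists2 M : R, 0 < M & forall z, a <= complex.Im z <= b -> n1 (cderiv F0 z) <= M.
Proof.
have [M M0 hM] := upper_bound_strip (a - 1) (b + 1).
exists (n1 (tpi R)^-1 * (2 * (M * (2 / 1 * (2 / 1))) * 4) + 1).
  by rewrite ltr_wpDl// !mulr_ge0 ?n1_ge0// ltW.
move=> z hz; have [mg hin] := square_margin z (@ltr01 R).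
have := cauchy_deriv_bound (fun w _ => entire_Fth (0 : 'rV[R]_n) w) ltr01 mg hin (M := M).
have -> : complex.Re z + 1 - (complex.Re z - 1) + (complex.Im z + 1 - (complex.Im z - 1)) = 4 by ring.
move=> H; apply: le_trans (H _) _; last by rewrite lerDl.
move=> w [/andP[_ /andP[w1 w2]] _]; apply: hM.
by move/andP : hz => [z1 z2]; apply/andP; split; lra.
Qed.

End PhaseCompactness.

(** * Local averages and the sub-mean-value inequality *)

Section LocalAverage.
Variables (R : realType) (rho : R).
Local Notation mu := (@lebesgue_measure R).

Definition band : set (measurableTypeR R * measurableTypeR R) := [set p | `|p.1 - p.2| <= rho].

Lemma measurable_band : measurable band.
Proof.
have mf : measurable_fun setT (fun p : measurableTypeR R * measurableTypeR R => `|p.1 - p.2|).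
  apply: measurableT_comp => //; apply: measurable_funB => //.
have := mf measurableT `]-oo, rho]%classic (measurable_itv _).
rewrite setTI; congr measurable; apply/seteqP; split => p /=; by rewrite /band /= in_itv.
Qed.

Definition chi (x u : R) : \bar R := (\1_band (x, u))%:E.

Lemma chi_ge0 x u : (0 <= chi x u)%E.
Proof. by rewrite lee_fin indicE ler0n. Qed.

Lemma chiE x u : chi x u = if `|x - u| <= rho then 1%E else 0%E.
Proof.
by rewrite /chi indicE; case: ifPn => h; [rewrite mem_set|rewrite memNset//; exact/negP].
Qed.

Lemma measurable_chi2 : measurable_fun setT (fun p : measurableTypeR R * measurableTypeR R => chi p.1 p.2).
Proof.
apply/measurable_EFinP.
suff -> : (fun p : measurableTypeR R * measurableTypeR R => \1_band (p.1, p.2)) = (\1_band : _ -> R).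
  exact: measurable_indic measurable_band.
by apply/funext => -[].
Qed.

Lemma measurable_chi x : measurable_fun setT (chi x : measurableTypeR R -> \bar R).
Proof.
exact: (measurableT_comp measurable_chi2 (@pair1_measurable _ _ _ _ x)).
Qed.

Lemma measurable_chi1 u : measurable_fun setT ((fun x => chi x u) : measurableTypeR R -> \bar R).
Proof.
exact: (measurableT_comp measurable_chi2 (@pair2_measurable _ _ _ _ u)).
Qed.

Lemma int_chi u : (\int[mu]_x chi x u <= (2 * `|rho|)%R%:E)%E.
Proof.
have -> : (fun x => chi x u) = (fun x => (\1_(`[u - rho, u + rho]%classic) x)%:E).
  apply/funext => x.
  have E : band (x, u) <-> `[u - rho, u + rho]%classic x.
    rewrite /band /= in_itv /= ler_norml.
    by split=> /andP[h1 h2]; apply/andP; split; lra.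
  by rewrite /chi !indicE; congr ((nat_of_bool _)%:R%:E); apply/idP/idP; rewrite !inE => /E.
rewrite integral_indic// setIT.
rewrite [leLHS](lebesgue_measure_itv `[u - rho, u + rho]) /= lte_fin.
case: ifPn => _; last by rewrite lee_fin mulr_ge0.
rewrite -EFinB lee_fin; have := ler_norm rho; lra.
Qed.

Variable G : measurableTypeR R -> \bar R.
Hypotheses (mG : measurable_fun setT G) (G0 : forall u, (0 <= G u)%E)
  (Gfin : (\int[mu]_u G u < +oo)%E).

(** The integral of G over the window of half-width [rho] around x. The indicator kernel extends it
    to the whole line, so that Tonelli's theorem applies. *)
Definition smear (x : R) : \bar R := (\int[mu]_u (G u * chi x u))%E.

Lemma measurable_Gchi x : measurable_fun setT (fun u => G u * chi x u)%E.
Proof. by apply: emeasurable_funM => //; exact: measurable_chi. Qed.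

Lemma smear_ge0 x : (0 <= smear x)%E.
Proof. by apply: integral_ge0 => u _; rewrite mule_ge0// chi_ge0. Qed.

Lemma chi_le1 x u : (chi x u <= 1)%E.
Proof. by rewrite chiE; case: ifP. Qed.

Lemma smear_le x : (smear x <= \int[mu]_u G u)%E.
Proof.
apply: ge0_le_integral => //.
- by move=> u _; rewrite mule_ge0// chi_ge0.
- exact: measurable_Gchi.
- by move=> u _; rewrite -[leRHS]mule1 lee_wpmul2l// chi_le1.
Qed.

Lemma smear_fin x : (smear x < +oo)%E.
Proof. exact: le_lt_trans (smear_le x) Gfin. Qed.

Lemma measurable_Gchi2 : measurable_fun setT
  (fun p : measurableTypeR R * measurableTypeR R => G p.2 * chi p.1 p.2)%E.
Proof.
apply: emeasurable_funM; last exact: measurable_chi2.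
exact: measurableT_comp.
Qed.

Lemma Gchi2_ge0 (p : measurableTypeR R * measurableTypeR R) : (0 <= G p.2 * chi p.1 p.2)%E.
Proof. by rewrite mule_ge0// chi_ge0. Qed.

Lemma measurable_smear : measurable_fun setT (smear : measurableTypeR R -> \bar R).
Proof.
exact: (@measurable_fun_fubini_tonelli_F _ _ _ _ R mu _ measurable_Gchi2 Gchi2_ge0).
Qed.

(** By Tonelli: a point u lies in the windows of a set of x of length at most 2 |rho|. *)
Lemma int_smear : (\int[mu]_x smear x < +oo)%E.
Proof.
have -> : (\int[mu]_x smear x)%E = (\int[mu]_u \int[mu]_x (G u * chi x u))%E.
  exact: (@fubini_tonelli _ _ _ _ R mu mu _ measurable_Gchi2 Gchi2_ge0).
apply: (@le_lt_trans _ _ (\int[mu]_u (G u * (2 * `|rho|)%R%:E))%E).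
  apply: ge0_le_integral => //.
  - by move=> u _; apply: integral_ge0 => x _; rewrite mule_ge0// chi_ge0.
  - exact: (@measurable_fun_fubini_tonelli_G _ _ _ _ R mu _ measurable_Gchi2 Gchi2_ge0).
  - exact: emeasurable_funM.
  - move=> u _; rewrite ge0_integralZl//.
    + by rewrite lee_wpmul2l// int_chi.
    + exact: measurable_chi1.
    + by move=> x _; exact: chi_ge0.
rewrite ge0_integralZr//.
by rewrite muleC; apply: lte_mul_pinfty.
Qed.

(** Dominated convergence with majorant G: any given u is eventually outside the window around x_
    k. *)
Lemma smear_cvg0 (x_ : nat -> R) : (`|x_ k| @[k --> \oo] --> +oo) ->
  smear (x_ k) @[k --> \oo] --> 0%E.
Proof.
move=> hx.
have [|||||_ _] := @dominated_convergence _ _ R mu setT measurableT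
   (fun k u => G u * chi (x_ k) u)%E (cst 0%E) G.
- by move=> k; exact: measurable_Gchi.
- exact: measurable_cst.
- apply: aeW => u _.
  apply: cvg_near_cst.
  have /cvgryPge/(_ (`|(u : R)| + rho + 1)) := hx; apply: filterS => k hk.
  rewrite chiE ifF ?mule0//; apply/negbTE; rewrite -ltNge.
  have := ler_normD (x_ k - u) u; rewrite subrK; lra.
- apply/integrableP; split => //.
  by under eq_integral do rewrite gee0_abs//.
- apply: aeW => u k _; rewrite gee0_abs ?mule_ge0 ?chi_ge0//.
  by rewrite -[leRHS]mule1 lee_wpmul2l// chi_le1.
by rewrite integral_cst// mul0e.
Qed.

(** Sum and integral are exchanged: a point u is covered by windows of total weight at most N. This
    converts a local count of zeros into summability. *)
Lemma sum_smear_le (I : Type) (s : seq I) (m : I -> nat) (x : I -> R) (N : R) :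
  0 <= N -> (forall u : R, \sum_(i <- s) (m i)%:R * (`|x i - u| <= rho)%R%:R <= N) ->
  (\sum_(i <- s) (m i)%:R%:E * smear (x i) <= N%:E * \int[mu]_u G u)%E.
Proof.
move=> N0 hN.
have h i : ((m i)%:R%:E * smear (x i) = \int[mu]_u ((m i)%:R%:E * (G u * chi (x i) u)))%E.
  rewrite ge0_integralZl//; first exact: measurable_Gchi.
  by move=> u _; rewrite mule_ge0// chi_ge0.
under eq_bigr do rewrite h.
rewrite -ge0_integral_sum//; last 2 first.
- move=> i; apply: emeasurable_funM; [exact: measurable_cst|exact: measurable_Gchi].
- by move=> i u _; rewrite !mule_ge0// ?lee_fin// chi_ge0.
rewrite -ge0_integralZl//.
apply: ge0_le_integral => //.
- by move=> u _; apply: sume_ge0 => i _; rewrite !mule_ge0// ?lee_fin// chi_ge0.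
- apply: emeasurable_sum => i.
  by apply: emeasurable_funM; [exact: measurable_cst|exact: measurable_Gchi].
- by apply: emeasurable_funM => //; exact: measurable_cst.
move=> u _.
have -> : (\sum_(i <- s) ((m i)%:R%:E * (G u * chi (x i) u)) =
   (\sum_(i <- s) (m i)%:R * (`|x i - u| <= rho)%R%:R)%R%:E * G u)%E.
  rewrite -sumEFin ge0_sume_distrl.
    by apply: eq_bigr => i _; rewrite chiE EFinM muleCA muleC; case: ifP.
  by move=> i _; rewrite lee_fin mulr_ge0.
by rewrite lee_wpmul2r// lee_fin.
Qed.

End LocalAverage.

(** * Pointwise bounds for holomorphic integrable functions *)

Section SubMeanValue.
Variables (R : realType).
Local Notation C := (R[i]).
Local Notation mu := (@lebesgue_measure R).

(** Otherwise the integral would be at least J + e; the surplus e makes this a contradiction. *)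
Lemma exists_le_average (u v J e : R) (f : measurableTypeR R -> \bar R) : u < v -> 0 < e ->
  measurable_fun setT f -> (forall x, (0 <= f x)%E) ->
  (\int[mu]_(x in `[u, v]) f x <= J%:E)%E ->
  exists2 t : R, u <= t <= v & (f t <= ((J + e) / (v - u))%R%:E)%E.
Proof.
move=> uv e0 mf f0 fJ; apply: contrapT => hn.
have h t : u <= t <= v -> (((J + e) / (v - u))%R%:E <= f t)%E.
  by move=> ht; rewrite leNgt; apply/negP => /ltW hlt; apply: hn; exists t.
have J0 : 0 <= J by rewrite -lee_fin; apply: le_trans fJ; apply: integral_ge0.
have : (\int[mu]_(x in `[u, v]) cst ((J + e) / (v - u))%R%:E x <= \int[mu]_(x in `[u, v]) f x)%E.
  apply: ge0_le_integral => //.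
  - by move=> x _; rewrite lee_fin divr_ge0 ?subr_ge0 ?(ltW uv)// addr_ge0 ?(ltW e0).
  - exact: measurable_funTS.
rewrite integral_cst//.
have key (m : \bar R) : m = (v - u)%:E ->
    (((J + e) / (v - u))%R%:E * m <= \int[mu]_(x in `[u, v]) f x)%E -> False.
  move=> ->; rewrite -EFinM mulfVK ?subr_eq0 ?gt_eqF// => hle.
  by have := le_trans hle fJ; rewrite lee_fin; lra.
by apply: key; rewrite [LHS](lebesgue_measure_itv `[u, v]) /= lte_fin uv.
Qed.

Lemma ler_mul_div1 (v j e : R) : 0 <= v -> 0 <= e -> j <= e / (v + 1) -> v * j <= e.
Proof.
move=> v0 e0 hj; have v1 : 0 < v + 1 by rewrite ltr_wpDl.
apply: le_trans (ler_wpM2l v0 hj) _.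
by rewrite mulrCA ler_piMr// ler_pdivrMr// mul1r lerDl.
Qed.

Lemma n1_four (x1 x2 x3 x4 : C) (N : R) : n1 x1 <= N -> n1 x2 <= N -> n1 x3 <= N -> n1 x4 <= N ->
  n1 (x1 - x2) + n1 (x3 - x4) <= 4 * N.
Proof. by move=> h1 h2 h3 h4; have := n1B x1 x2; have := n1B x3 x4; lra. Qed.

Variables (a b rho : R) (g : C -> C).
Hypotheses (rho0 : 0 < rho) (hg : holomorphic_on (strip a b) g) (Lg : L1_strip a b g).

Let A : set (measurableTypeR R * measurableTypeR R) := [set p | strip a b (p.1 +i* p.2)].

Let mA : measurable A.
Proof.
have -> : A = setT `*` `]a, b[%classic.
  apply/seteqP; split=> -[x y]; rewrite /A /strip /= in_itv /=; first by move=> h; split.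
  by move=> [].
exact: measurableX.
Qed.

(** Extended by 0 outside the strip, so that slices are integrals over full lines. *)
Definition strip_norm : measurableTypeR R * measurableTypeR R -> \bar R :=
  (fun p => (n1 (g (p.1 +i* p.2)))%:E) \_ A.

Lemma strip_norm_integrable : ((mu \x mu)%E).-integrable setT strip_norm.
Proof.
apply/(integrable_mkcond _ mA).
have [/integrable_abse h1 /integrable_abse h2] := Lg.
by have := integrableD mA h1 h2; apply: eq_integrable.
Qed.

Lemma measurable_strip_norm : measurable_fun setT strip_norm.
Proof. by have /integrableP[] := strip_norm_integrable. Qed.

Lemma strip_norm_ge0 p : (0 <= strip_norm p)%E.
Proof. by rewrite /strip_norm patchE; case: ifP => // _; rewrite lee_fin n1_ge0. Qed.

Lemma strip_normE x y : a < y < b -> strip_norm (x, y) = (n1 (g (x +i* y)))%:E.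
Proof. by move=> h; rewrite /strip_norm patchE mem_set. Qed.

Definition vslice : measurableTypeR R -> \bar R := fubini_F mu strip_norm.

Lemma measurable_vslice : measurable_fun setT vslice.
Proof. exact: (@measurable_fun_fubini_tonelli_F _ _ _ _ R mu _ measurable_strip_norm strip_norm_ge0). Qed.

Lemma vslice_ge0 x : (0 <= vslice x)%E.
Proof. by apply: integral_ge0 => y _; exact: strip_norm_ge0. Qed.

Lemma vslice_fin : (\int[mu]_x vslice x < +oo)%E.
Proof.
rewrite -(@fubini_tonelli1 _ _ _ _ R mu mu _ measurable_strip_norm strip_norm_ge0).
have /integrableP[_] := strip_norm_integrable; apply: le_lt_trans.
by under [leRHS]eq_integral do rewrite gee0_abs ?strip_norm_ge0//.
Qed.

Let J x0 := smear rho vslice x0.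

Lemma vslice_local x0 u v : x0 - rho <= u -> v <= x0 + rho -> (\int[mu]_(x in `[u, v]) vslice x <= J x0)%E.
Proof.
move=> h1 h2; rewrite integral_mkcond; apply: ge0_le_integral => //.
- by move=> x _; rewrite patchE; case: ifP => // _; exact: vslice_ge0.
- by apply/(measurable_restrictT _ _).1 => //; apply: measurable_funTS; exact: measurable_vslice.
- exact: (measurable_Gchi rho measurable_vslice).
move=> x _; rewrite patchE; case: ifPn => [|_]; last by rewrite mule_ge0 ?vslice_ge0 ?chi_ge0.
rewrite inE /= in_itv /= => /andP[k1 k2]; rewrite chiE ifT ?mule1//.
by rewrite ler_norml; apply/andP; split; lra.
Qed.

Let hchi x0 (p : measurableTypeR R * measurableTypeR R) : \bar R := (strip_norm p * chi rho x0 p.1)%E.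

Let mhchi x0 : measurable_fun setT (hchi x0).
Proof.
apply: emeasurable_funM; first exact: measurable_strip_norm.
exact: (measurableT_comp (measurable_chi rho x0)).
Qed.

Let hchi_ge0 x0 p : (0 <= hchi x0 p)%E.
Proof. by rewrite mule_ge0 ?strip_norm_ge0 ?chi_ge0. Qed.

(** Horizontal slices are cut to |x - x0| <= rho, so that they integrate to the local mass J x0 and
    not to the full L^1 norm; smallness for large |x0| depends on this. *)
Definition hslice x0 : measurableTypeR R -> \bar R := fubini_G mu (hchi x0).

Lemma measurable_hslice x0 : measurable_fun setT (hslice x0).
Proof. exact: (@measurable_fun_fubini_tonelli_G _ _ _ _ R mu _ (mhchi x0) (hchi_ge0 x0)). Qed.

Lemma hslice_ge0 x0 y : (0 <= hslice x0 y)%E.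
Proof. by apply: integral_ge0 => x _; exact: hchi_ge0. Qed.

Lemma hslice_local x0 u v : (\int[mu]_(y in `[u, v]) hslice x0 y <= J x0)%E.
Proof.
apply: (@le_trans _ _ (\int[mu]_y hslice x0 y)%E).
  apply: ge0_subset_integral => //; first exact: measurable_hslice.
  by move=> y _; exact: hslice_ge0.
rewrite -(@fubini_tonelli2 _ _ _ _ R mu mu _ (mhchi x0) (hchi_ge0 x0)).
rewrite (@fubini_tonelli1 _ _ _ _ R mu mu _ (mhchi x0) (hchi_ge0 x0)).
rewrite le_eqVlt; apply/orP; left; apply/eqP.
apply: eq_integral => x _; rewrite /fubini_F /hchi /=.
rewrite ge0_integralZr ?chi_ge0//.
- exact: (measurableT_comp measurable_strip_norm (@pair1_measurable _ _ _ _ x)).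
- by move=> y _; exact: strip_norm_ge0.
Qed.

Lemma seg_bound (u v M B : R) (f k : R -> C) (Phi : \bar R) : 0 <= B ->
  scont u v f -> scont u v k -> (forall x, u <= x <= v -> n1 (k x) <= B) ->
  (\int[mu]_(x in `[u, v]) (n1 (f x))%:E <= Phi)%E -> (Phi <= M%:E)%E ->
  n1 (cint u v (fun x => f x * k x)) <= M * B.
Proof.
move=> B0 sf sk hB h1 h2.
apply: le_trans (n1_cint (scontM sf sk)) _.
have ib := itgZ B (measurable_itv `[u, v]) (itg_n1 sf).
apply: le_trans (le_Rintegral _ (itg_n1 (scontM sf sk)) ib _) _ => //.
  move=> x; rewrite /= in_itv /= => /hB hx; apply: le_trans (n1M _ _) _.
  by rewrite mulrC ler_wpM2r ?n1_ge0.
rewrite RintegralZl//; last exact: itg_n1.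
rewrite mulrC ler_wpM2r// -lee_fin /Rintegral fineK; first exact: le_trans h2.
exact: integrable_fin_num (itg_n1 sf).
Qed.

Lemma chol_strip z : strip a b z -> chol g z.
Proof. by move=> /hg/derivable_cderP. Qed.

(** Four sides, each carrying an integral of |g| of at most j / (rho / 2) against a Cauchy kernel of
    at most 2 / (rho / 2), make 32 j / rho^2. *)
Definition smear_const : R := n1 (tpi R)^-1 * (32 / rho ^+ 2).

(* The four sides of the rectangle in Cauchy's formula are chosen by averaging,
   so that the integral of [|g|] over each is at most the mean value. *)
Lemma submean (x0 y0 : R) : a < y0 - rho -> y0 + rho < b ->
  n1 (g (x0 +i* y0)) <= smear_const * fine (J x0).
Proof.
move=> ha hb.
have fJ : J x0 \is a fin_num.
  rewrite ge0_fin_numE; first exact: smear_fin measurable_vslice vslice_ge0 vslice_fin _.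
  exact: smear_ge0 vslice_ge0 _.
have JE : J x0 = (fine (J x0))%:E by rewrite fineK.
set j := fine (J x0) in JE *.
apply/ler_addgt0Pr => e e0.
set K := smear_const.
have K0 : 0 < K + 1.
  by rewrite ltr_wpDl// mulr_ge0 ?n1_ge0// divr_ge0 ?sqr_ge0.
(* The slack d allowed in the averages is chosen so that K d <= e. *)
have d0 : 0 < e / (K + 1) by rewrite divr_gt0.
set d := e / (K + 1) in d0.
have r2 : 0 < rho / 2 by rewrite divr_gt0.
have vs u v : u < v -> x0 - rho <= u -> v <= x0 + rho ->
    exists2 t : R, u <= t <= v & (vslice t <= ((j + d) / (v - u))%R%:E)%E.
  move=> uv h1 h2; apply: exists_le_average => //.
  - exact: measurable_vslice.
  - exact: vslice_ge0.
  - by rewrite -JE; exact: vslice_local.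
have hs u v : u < v -> exists2 t : R, u <= t <= v & (hslice x0 t <= ((j + d) / (v - u))%R%:E)%E.
  move=> uv; apply: exists_le_average => //.
  - exact: measurable_hslice.
  - exact: hslice_ge0.
  - by rewrite -JE; exact: hslice_local.
(* Each side is taken between rho / 2 and rho from the centre: far enough to bound the kernel, close
   enough to stay in the window and in the strip. *)
have [l1 /andP[l11 l12]] := vs (x0 - rho) (x0 - rho / 2) ltac:(lra) ltac:(lra) ltac:(lra).
have [l2 /andP[l21 l22]] := vs (x0 + rho / 2) (x0 + rho) ltac:(lra) ltac:(lra) ltac:(lra).
have [b1 /andP[b11 b12]] := hs (y0 - rho) (y0 - rho / 2) ltac:(lra).
have [b2 /andP[b21 b22]] := hs (y0 + rho / 2) (y0 + rho) ltac:(lra).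
have -> : x0 + rho - (x0 + rho / 2) = rho / 2 by field.
have -> : x0 - rho / 2 - (x0 - rho) = rho / 2 by field.
have -> : y0 + rho - (y0 + rho / 2) = rho / 2 by field.
have -> : y0 - rho / 2 - (y0 - rho) = rho / 2 by field.
set M := (j + d) / (rho / 2) => B2 B1 L2 L1.
have mg : margin (rho / 2) l1 l2 b1 b2 (x0 +i* y0).
  by apply/and4P; split => /=; lra.
have hin : inside l1 l2 b1 b2 (x0 +i* y0).
  by apply/andP; split; apply/andP; split => /=; lra.
have [lle ble] := inside_le hin.
have hb1 : a < b1 < b by apply/andP; split; lra.
have hb2 : a < b2 < b by apply/andP; split; lra.
have hrect z : rect l1 l2 b1 b2 z -> chol g z.
  case: z => x y /andP[_ /andP[/= z1 z2]]; apply: chol_strip; rewrite /strip /=.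
  have /andP[p1 _] := hb1; have /andP[_ p2] := hb2.
  by rewrite (lt_le_trans p1 z1) (le_lt_trans z2 p2).
have [f1 f2 f3 f4] := sides_hol lle ble hrect.
have [k1 k2 k3 k4] := sides_inv hin.
have hk z : bdry l1 l2 b1 b2 z -> n1 (z - (x0 +i* y0))^-1 <= 2 / (rho / 2).
  by move=> hz; apply: n1V_le => //; exact: margin_dist mg hz.
have B0 : 0 <= 2 / (rho / 2) by rewrite divr_ge0// ltW.
have hseg y : (y = b1 \/ y = b2) -> (hslice x0 y <= M%:E)%E ->
    scont l1 l2 (fun x => g (x +i* y)) -> scont l1 l2 (fun x => ((x +i* y) - (x0 +i* y0))^-1) ->
    n1 (cint l1 l2 (fun x => g (x +i* y) * ((x +i* y) - (x0 +i* y0))^-1)) <= M * (2 / (rho / 2)).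
  move=> hy hM sf sk; apply: (seg_bound B0 sf sk) hM.
    move=> x hx; apply: hk; rewrite /bdry /rect /= hx; split.
      by case: hy => ->; rewrite lexx ?andbT.
    by case: hy => ->; [constructor 3|constructor 4].
  rewrite integral_mkcond; apply: ge0_le_integral => //.
  - by move=> x _; rewrite patchE; case: ifP => // _; rewrite lee_fin n1_ge0.
  - apply/(measurable_restrictT _ _).1 => //.
    by have /integrableP[] := itg_n1 sf.
  - exact: (measurableT_comp (mhchi x0) (@pair2_measurable _ _ _ _ y)).
  move=> x _; rewrite patchE; case: ifPn => [|_]; last exact: hchi_ge0.
  rewrite inE /= in_itv /= => /andP[q1 q2]; rewrite /hchi chiE ifT /=.
    by rewrite strip_normE ?mule1//; case: hy => ->.
  by rewrite ler_norml; apply/andP; split; lra.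
have vseg x : (x = l1 \/ x = l2) -> (vslice x <= M%:E)%E ->
    scont b1 b2 (fun y => g (x +i* y)) -> scont b1 b2 (fun y => ((x +i* y) - (x0 +i* y0))^-1) ->
    n1 (cint b1 b2 (fun y => g (x +i* y) * ((x +i* y) - (x0 +i* y0))^-1)) <= M * (2 / (rho / 2)).
  move=> hx hM sf sk; apply: (seg_bound B0 sf sk) hM.
    move=> y hy; apply: hk; rewrite /bdry /rect /= hy; split.
      by case: hx => ->; rewrite lexx ?andbT.
    by case: hx => ->; [constructor 1|constructor 2].
  rewrite integral_mkcond; apply: ge0_le_integral => //.
  - by move=> y _; rewrite patchE; case: ifP => // _; rewrite lee_fin n1_ge0.
  - apply/(measurable_restrictT _ _).1 => //.
    by have /integrableP[] := itg_n1 sf.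
  - exact: (measurableT_comp measurable_strip_norm (@pair1_measurable _ _ _ _ x)).
  move=> y _; rewrite patchE; case: ifPn => [|_]; last exact: strip_norm_ge0.
  rewrite inE /= in_itv /= => /andP[q1 q2]; rewrite strip_normE//.
  have /andP[p1 _] := hb1; have /andP[_ p2] := hb2.
  by rewrite (lt_le_trans p1 q1) (le_lt_trans q2 p2).
have E1 := hseg _ (or_introl erefl) B1 f1 k1.
have E2 := hseg _ (or_intror erefl) B2 f2 k2.
have E3 := vseg _ (or_introl erefl) L1 f3 k3.
have E4 := vseg _ (or_intror erefl) L2 f4 k4.
have := cauchy_value hrect hin => ->.
apply: (@le_trans _ _ (n1 (tpi R)^-1 * (4 * (M * (2 / (rho / 2)))))).
  apply: le_trans (n1M _ _) _; rewrite ler_wpM2l ?n1_ge0// /rint.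
  apply: le_trans (n1D _ _) _; rewrite n1i.
  exact: n1_four E1 E2 E4 E3.
have -> : n1 (tpi R)^-1 * (4 * (M * (2 / (rho / 2)))) = K * j + K * d.
  by rewrite /M /K /smear_const; field; rewrite gt_eqF.
rewrite lerD2l; apply: ler_mul_div1 => //; last exact: ltW.
by rewrite /K /smear_const mulr_ge0 ?n1_ge0// divr_ge0 ?sqr_ge0.
Qed.

End SubMeanValue.

(** * Passing to the limit *)

Section UnorderedSums.
Variables (R : realType) (T : choiceType).

Lemma ler_sum_support (s t : seq T) (f : T -> R) : uniq s -> uniq t -> (forall z, 0 <= f z) ->
  (forall z, z \in s -> f z != 0 -> z \in t) ->
  \sum_(z <- s) f z <= \sum_(z <- t) f z.
Proof.
move=> us ut f0 st; pose s' := [seq z <- s | f z != 0].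
have -> : \sum_(z <- s) f z = \sum_(z <- s') f z.
  rewrite big_filter (bigID (fun z => f z != 0)) /= [X in _ + X]big1 ?addr0//.
  by move=> z /negPn/eqP.
have -> : \sum_(z <- s') f z = \sum_(z <- t | z \in s') f z.
  rewrite -[RHS]big_filter; apply: perm_big; apply: uniq_perm; rewrite ?filter_uniq// => z.
  rewrite [in RHS]mem_filter; case: (boolP (z \in s')) => //= zs.
  by move: zs; rewrite mem_filter => /andP[z0 zs]; rewrite (st _ zs z0).
by rewrite big_mkcond; apply: ler_sum => z _; case: ifP.
Qed.

Section Exhaustion.
Variables (A : set T) (Z : nat -> seq T).
Hypotheses (uZ : forall n, uniq (Z n)) (ZA : forall n z, z \in Z n -> A z)
  (ZS : forall n m, (n <= m)%N -> {subset Z n <= Z m}).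

(** The sets Z n may miss points of A where f vanishes, such as resonances of multiplicity 0. A
    finite subset of A is therefore compared with Z n on the support of f only. *)
Lemma esum_exhaustion (f : T -> R) (B : R) : (forall z, 0 <= f z) ->
  (forall z, A z -> f z != 0 -> exists n, z \in Z n) ->
  (forall n, \sum_(z <- Z n) f z <= B) ->
  (\esum_(z in A) (f z)%:E < +oo)%E /\
  forall e, 0 < e -> exists n0, forall n, (n0 <= n)%N ->
    `|\sum_(z <- Z n) f z - fine (\esum_(z in A) (f z)%:E)%E| <= e.
Proof.
move=> f0 fZ fB.
have sumZ n : (\sum_(z \in [set` Z n]) (f z)%:E = (\sum_(z <- Z n) f z)%:E)%E.
  by rewrite -fsbig_seq// sumEFin.
have up F : fsets A F -> exists n0, forall n, (n0 <= n)%N ->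
    (\sum_(z \in F) (f z)%:E <= (\sum_(z <- Z n) f z)%:E)%E.
  move=> [finF FA].
  have [s us sF] : exists2 s, uniq s & [set` s] = F.
    have /finite_seqP[s hs] := finF; exists (undup s); first exact: undup_uniq.
    by rewrite hs; apply/seteqP; split => z /=; rewrite mem_undup.
  have [n0 hn0] : exists n0, forall z, z \in s -> f z != 0 -> z \in Z n0.
    have : forall z, z \in s -> A z by move=> z zs; apply: FA; rewrite -sF.
    elim: (s) => [_|z l ih hl]; first by exists 0%N.
    have [|n1 h1] := ih; first by move=> w wl; apply: hl; rewrite in_cons wl orbT.
    have [fz|fz] := eqVneq (f z) 0.
      exists n1 => w; rewrite in_cons => /orP[/eqP ->|wl]; last exact: h1.
      by rewrite fz eqxx.
    have [n2 h2] := fZ z (hl _ (mem_head _ _)) fz.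
    exists (maxn n1 n2) => w; rewrite in_cons => /orP[/eqP -> _|wl wf].
      exact: ZS (leq_maxr _ _) _ h2.
    exact: ZS (leq_maxl _ _) _ (h1 _ wl wf).
  exists n0 => n n0n; rewrite -sF -fsbig_seq// sumEFin lee_fin.
  by apply: ler_sum_support => // z zs zf; exact: ZS n0n _ (hn0 _ zs zf).
have lo n : ((\sum_(z <- Z n) f z)%:E <= \esum_(z in A) (f z)%:E)%E.
  rewrite -sumZ; apply: esum_ge; exists [set` Z n] => //.
  by split; [exact: finite_seq|move=> z /ZA].
have hB : (\esum_(z in A) (f z)%:E <= B%:E)%E.
  apply: ge_ereal_sup => _ [F hF <-].
  have [n0 h] := up F hF; apply: le_trans (h n0 (leqnn _)) _.
  by rewrite lee_fin.
have fin : \esum_(z in A) (f z)%:E \is a fin_num.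
  rewrite ge0_fin_numE ?(le_lt_trans hB) ?ltry//.
  by apply: esum_ge0 => z _; rewrite lee_fin.
split; first exact: le_lt_trans hB (ltry _).
move=> e e0; set E := (\esum_(z in A) (f z)%:E)%E in lo hB fin *.
have [F hF hlt] : exists2 F, fsets A F & (E - e%:E < \sum_(z \in F) (f z)%:E)%E.
  have := @ub_ereal_sup_adherent R [set (\sum_(x \in F) (f x)%:E)%E | F in fsets A] e e0 fin.
  by move=> [_ [F hF <-] h]; exists F.
have [n0 h] := up F hF; exists n0 => n n0n.
have h1 := lo n; have h2 := le_trans (ltW hlt) (h n n0n).
rewrite -(fineK fin) lee_fin in h1; rewrite -(fineK fin) -EFinB lee_fin in h2.
by rewrite ler_norml; apply/andP; split; lra.
Qed.

End Exhaustion.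

End UnorderedSums.

Section SumLimits.
Variable R : realType.
Local Notation C := (R[i]).
Variables (A : set C) (Z : nat -> seq C).
Hypotheses (uZ : forall n, uniq (Z n)) (ZA : forall n z, z \in Z n -> A z)
  (ZS : forall n m, (n <= m)%N -> {subset Z n <= Z m}).

Lemma rsum_exhaustion (u : C -> R) (B : R) :
  (forall z, A z -> u z != 0 -> exists n, z \in Z n) ->
  (forall n, \sum_(z <- Z n) `|u z| <= B) ->
  summable A (fun z => (u z)%:E) /\
  forall e, 0 < e -> exists n0, forall n, (n0 <= n)%N ->
    `|\sum_(z <- Z n) u z - rsum A u| <= e.
Proof.
move=> uZn uB.
have pos (v : C -> R) : (forall z, v z = u z \/ v z = - u z) ->
    forall e, 0 < e -> exists n0, forall n, (n0 <= n)%N ->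
    `|\sum_(z <- Z n) Num.max (v z) 0 - fine (\esum_(z in A) (Num.max (v z) 0)%:E)%E| <= e.
  move=> hv; apply: (esum_exhaustion uZ ZA ZS (B := B) _ _ _).2.
  - by move=> z; rewrite le_max lexx orbT.
  - move=> z Az h; apply: uZn => //; apply: contraNneq h => u0.
    by case: (hv z) => ->; rewrite u0 ?oppr0 maxxx.
  - move=> n; apply: le_trans (uB n); apply: ler_sum => z _.
    by rewrite ge_max normr_ge0 andbT; case: (hv z) => ->; rewrite ?ler_norm// -normrN ler_norm.
split.
  apply: (esum_exhaustion uZ ZA ZS (B := B) _ _ uB).1 => [z|z Az]; first exact: normr_ge0.
  by rewrite normr_eq0; exact: uZn.
move=> e e0; have e2 : 0 < e / 2 by rewrite divr_gt0.
have [n1 h1] := pos u (fun z => or_introl erefl) _ e2.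
have [n2 h2] := pos (fun z => - u z) (fun z => or_intror erefl) _ e2.
exists (maxn n1 n2) => n; rewrite geq_max => /andP[/h1 k1 /h2 k2].
have -> : \sum_(z <- Z n) u z = \sum_(z <- Z n) Num.max (u z) 0 - \sum_(z <- Z n) Num.max (- u z) 0.
  rewrite -sumrB; apply: eq_bigr => z _.
  case: (leP (u z) 0) => hu; case: (leP (- u z) 0) => hu'; lra.
rewrite /rsum.
set p := \sum_(z <- Z n) _ in k1 *; set q := \sum_(z <- Z n) _ in k2 *.
set P := fine _ in k1 *; set S := fine _ in k2 *.
have -> : p - q - (P - S) = (p - P) - (q - S) by ring.
by apply: le_trans (ler_normB _ _) _; lra.
Qed.

Lemma csum_exhaustion (f : C -> C) (B : R) :
  (forall z, A z -> f z != 0 -> exists n, z \in Z n) ->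
  (forall n, \sum_(z <- Z n) n1 (f z) <= B) ->
  csummable A f /\
  forall e, 0 < e -> exists n0, forall n, (n0 <= n)%N ->
    n1 (\sum_(z <- Z n) f z - csum A f) <= e.
Proof.
move=> fZ fB.
have [||s1 h1] := @rsum_exhaustion (fun z => complex.Re (f z)) B.
- by move=> z Az h; apply: fZ => //; apply: contraNneq h => ->.
- by move=> n; apply: le_trans (fB n); apply: ler_sum => z _; exact: Re_le_n1.
have [||s2 h2] := @rsum_exhaustion (fun z => complex.Im (f z)) B.
- by move=> z Az h; apply: fZ => //; apply: contraNneq h => ->.
- by move=> n; apply: le_trans (fB n); apply: ler_sum => z _; exact: Im_le_n1.
split; first by split.
move=> e e0; have e2 : 0 < e / 2 by rewrite divr_gt0.
have [n1' k1] := h1 _ e2; have [n2' k2] := h2 _ e2.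
exists (maxn n1' n2') => n; rewrite geq_max => /andP[/k1 l1 /k2 l2].
rewrite /n1 ReB ImB Re_sum Im_sum /csum /=.
lra.
Qed.

End SumLimits.

Section LineLimits.
Variable R : realType.
Local Notation C := (R[i]).
Local Notation mu := (@lebesgue_measure R).
Variables (a_ b_ : nat -> R).
Hypotheses (ha : forall n, a_ n <= - n%:R) (hb : forall n, n%:R <= b_ n).

(** Dominated convergence. The end points are merely pushed to infinity, because they will be
    abscissae chosen by [lower_bound_vertical]. *)
Lemma Rint_limit (f : R -> R) : mu.-integrable setT (EFin \o f) ->
  forall e : R, 0 < e -> exists n0, forall n, (n0 <= n)%N ->
    `|(\int[mu]_(x in `[a_ n, b_ n]) f x)%R - (\int[mu]_x f x)%R| <= e.
Proof.
move=> fi e e0.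
have fin : (\int[mu]_x (f x)%:E)%E \is a fin_num by exact: integrable_fin_num.
have h : (\int[mu]_x (((EFin \o f) \_ `[a_ n, b_ n]) x))%E @[n --> \oo] --> (\int[mu]_x (f x)%:E)%E.
  apply: (@dominated_cvg _ _ R mu setT measurableT _ _ (fun x => `|(f x)%:E|%E)) => //.
  - move=> n; apply/(measurable_restrictT _ _).1 => //; apply: measurable_funTS.
    by have /integrableP[] := fi.
  - move=> x _; apply: cvg_near_cst.
    exists (Num.truncn `|x|).+1 => // n /= hn.
    have xn : `|x| < n%:R.
      by apply: lt_le_trans (truncnS_gt _) _; rewrite ler_nat.
    rewrite patchE mem_set//= in_itv /=.
    move: xn; rewrite ltr_norml => /andP[x1 x2].
    by apply/andP; split; [apply: le_trans (ha n) _; rewrite ltW|apply: le_trans (hb n); rewrite ltW].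
  - exact: integrable_abse.
  - by move=> n x _; rewrite patchE; case: ifP => // _; rewrite abse0.
move: h; rewrite -(fineK fin) => /fine_cvg /cvgrPdist_le/(_ e e0)[n0 _ hn].
exists n0 => n /hn /=; rewrite distrC => hh; rewrite /Rintegral.
by rewrite [in leLHS](_ : (\int[mu]_(x in `[a_ n, b_ n]) (f x)%:E =
  \int[mu]_x ((EFin \o f) \_ `[a_ n, b_ n]) x)%E) // integral_mkcond.
Qed.

Lemma cint_limit (f : R -> C) : cintegrable f ->
  forall e : R, 0 < e -> exists n0, forall n, (n0 <= n)%N -> n1 (cint (a_ n) (b_ n) f - cintegral f) <= e.
Proof.
move=> [f1 f2] e e0; have e2 : 0 < e / 2 by rewrite divr_gt0.
have [m1 h1] := Rint_limit f1 e2; have [m2 h2] := Rint_limit f2 e2.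
exists (maxn m1 m2) => n; rewrite geq_max => /andP[/h1 l1 /h2 l2].
by rewrite /n1 /=; lra.
Qed.

End LineLimits.

(** * Counting of zeros and the limit of growing rectangles *)

Section TraceFormula.
Variables (R : realType) (Q : quantum_graph R).
Local Notation C := (R[i]).
Local Notation mu := (@lebesgue_measure R).
Local Notation F := (Fth (0 : 'rV[R]_#|bond Q|)).

Lemma F_neq0_unitmx z : (1%:M - U_mx Q z \in unitmx) = (F z != 0).
Proof. by rewrite unitmxE unitfE U_mx_phase0. Qed.

Lemma res_mult0 z : F z != 0 -> res_mult Q z = 0%N.
Proof.
move=> h; rewrite res_multE; apply: zero_orderE.
by apply: has_zero_order0 => //; exact: entire_Fth.
Qed.

(** F is entire and non-zero at i, so the order exists at every point and the default value of
    [zero_order] is never what is read. *)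
Lemma res_mult_order z : has_zero_order F z (res_mult Q z).
Proof.
have [n hn] := entire_has_order z (@entire_Fth R Q 0) (Fth_not0 0).
by rewrite res_multE (zero_orderE hn).
Qed.

Lemma residue_F g a b c d : a <= b -> c <= d -> (forall z, rect a b c d z -> chol g z) ->
  (forall z, bdry a b c d z -> F z != 0) ->
  exists s : seq C, [/\ uniq s, forall z, (z \in s) <-> (rect a b c d z /\ F z = 0) &
    rint (fun z => g z * (cderiv F z / F z)) a b c d = tpi R * \sum_(z <- s) (res_mult Q z)%:R * g z].
Proof.
move=> ab cd hg hb.
have [s us hs] := finite_zeros a b c d (@entire_Fth R Q 0) (Fth_not0 0).
exists s; split => //; apply: residue_rect => //.
- exact: entire_Fth.
- move=> z /hs[hz Fz]; split; last exact: res_mult_order.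
  have nb : ~ bdry a b c d z by move=> /hb; rewrite Fz eqxx.
  have /andP[/andP[h1 h2] /andP[h3 h4]] := hz.
  apply/andP; split; apply/andP; split; rewrite lt_neqAle ?h1 ?h2 ?h3 ?h4 andbT;
    apply/eqP => E; apply: nb; split => //; rewrite E;
    by [constructor 1|constructor 2|constructor 3|constructor 4].
- by move=> z h1 h2; apply/hs.
Qed.

Lemma logderiv_bound z (M c : R) : 0 < c -> c <= n1 (F z) -> n1 (cderiv F z) <= M ->
  n1 (cderiv F z / F z) <= M * (2 / c).
Proof.
move=> c0 hc hM; apply: le_trans (n1M _ _) _.
by apply: ler_pM; rewrite ?n1_ge0//; exact: n1V_le.
Qed.

Variables (D n0 : nat) (Lmin Lmax y1 y2 eps : R) (g : C -> C).
Hypotheses (D0 : (0 < D)%N) (n00 : (0 < n0)%N) (L0 : 0 < Lmin)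
  (bd : bounded_data Q D n0 Lmin Lmax) (unb : unbalanced Q)
  (hy1 : y1 <= Y_bound D n0 Lmin) (hy2 : 0 <= y2) (eps0 : 0 < eps)
  (hg : holomorphic_on (strip (y1 - eps) (y2 + eps)) g)
  (Lg : L1_strip (y1 - eps) (y2 + eps) g)
  (line1 : y1 = Y_bound D n0 Lmin -> line_integral_defined Q g y1)
  (line2 : y2 = 0 -> line_integral_defined Q g y2).

Lemma Y_bound_lt0 : Y_bound D n0 Lmin < 0.
Proof.
rewrite /Y_bound oppr_lt0 divr_gt0// ln_gt0//.
by rewrite ltr1n -[2%N]/(1 + 1)%N leq_add.
Qed.

Lemma y1_lt_y2 : y1 < y2.
Proof. by apply: le_lt_trans hy1 _; apply: lt_le_trans Y_bound_lt0 hy2. Qed.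

Lemma F_below (th : 'rV[R]_#|bond Q|) z : complex.Im z < Y_bound D n0 Lmin -> Fth th z != 0.
Proof. exact: Fth_neq0_down n00 D0 L0 bd unb. Qed.

(** Strictly below [Y_bound] the energy estimate decides; on that line itself non-vanishing is the
    invertibility contained in [line1]. *)
Lemma F_line1 x : F (x +i* y1) != 0.
Proof.
move: hy1; rewrite le_eqVlt => /orP[/eqP/line1[h _]|h]; last exact: F_below.
by have := h x; rewrite F_neq0_unitmx.
Qed.

Lemma F_line2 x : F (x +i* y2) != 0.
Proof.
move: hy2; rewrite le_eqVlt => /orP[/eqP/esym/line2[h _]|h]; last exact: Fth_neq0_up.
by have := h x; rewrite F_neq0_unitmx.
Qed.

Lemma F_zero_strip z : F z = 0 -> y1 < complex.Im z < y2.
Proof.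
case: z => x y Fz /=; apply/andP; split.
- rewrite ltNge le_eqVlt; apply/negP => /orP[/eqP yE|yl].
    by have := F_line1 x; rewrite -yE Fz eqxx.
  by have := @F_below 0 (x +i* y) (lt_le_trans yl hy1); rewrite Fz eqxx.
- rewrite ltNge le_eqVlt; apply/negP => /orP[/eqP yE|yl].
    by have := F_line2 x; rewrite yE Fz eqxx.
  by have := @Fth_neq0_up R Q 0 (x +i* y) (le_lt_trans hy2 yl); rewrite Fz eqxx.
Qed.

(** Less than [eps], so that the mean value inequality stays in the domain of g; at most 1, so that
    windows fit into the rectangles of [count_zeros]. *)
Definition radius : R := Num.min (eps / 2) 1.

Lemma radius_gt0 : 0 < radius. Proof. by rewrite lt_min ltr01 andbT divr_gt0. Qed.
Lemma radius_lt : radius < eps.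
Proof. by rewrite gt_min ltr_pdivrMr// ltr_pMr// ltr1n. Qed.
Lemma radius_le1 : radius <= 1. Proof. by rewrite ge_min lexx orbT. Qed.

Let G := vslice (y1 - eps) (y2 + eps) g.
Let J (x : R) : R := fine (smear radius G x).
Let K := smear_const radius.

Let mG := measurable_vslice Lg.
Let G0 (x : measurableTypeR R) : (0 <= G x)%E := vslice_ge0 _ _ _ x.
Let Gfin := vslice_fin Lg.

Let K0 : 0 <= K.
Proof. by rewrite /K /smear_const mulr_ge0 ?n1_ge0// divr_ge0 ?sqr_ge0. Qed.

Let J0 x : 0 <= J x.
Proof. by apply: fine_ge0; exact: smear_ge0. Qed.

Let smear_fin_num x : smear radius G x \is a fin_num.
Proof. by rewrite ge0_fin_numE ?smear_ge0//; exact: smear_fin. Qed.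

Let g_le_J x y : y1 <= y <= y2 -> n1 (g (x +i* y)) <= K * J x.
Proof.
move=> /andP[h1 h2]; have r := radius_lt.
by apply: (submean radius_gt0 hg Lg); lra.
Qed.

Let chol_g z : y1 <= complex.Im z <= y2 -> chol g z.
Proof.
move=> /andP[h1 h2]; apply: (chol_strip hg); rewrite /strip /=.
by have e := eps0; apply/andP; split; lra.
Qed.

Let chol_logderiv z : F z != 0 -> chol (fun w => cderiv F w / F w) z.
Proof.
by move=> h; apply: chol_div => //; [apply: entire_deriv; exact: entire_Fth|exact: entire_Fth].
Qed.

Let in_window (x x0 a b : R) : `|x - x0| <= 1 -> a <= x0 - 3 + 1 -> x0 + 2 <= b -> a <= x <= b.
Proof. by rewrite ler_norml => /andP[h1 h2] h3 h4; apply/andP; split; lra. Qed.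

(** Argument principle on a rectangle of bounded size around x0. Its horizontal sides lie at y1 - 1
    and y2 + 1, strictly in the zero-free half-planes, where |F| has uniform lower bounds even if y1
    and y2 are extreme. *)
Lemma count_zeros : exists2 N : R, 0 <= N & forall (x0 : R) (s : seq C), uniq s ->
  \sum_(z <- s) (res_mult Q z)%:R * (`|complex.Re z - x0| <= radius)%R%:R <= N.
Proof.
have [c1 c10 h1] := lower_bound_vertical Q (y1 - 1) (y2 + 1).
have [|c2 c20 h2] := @lower_bound_horizontal R Q (y1 - 1).
  by move=> th; apply: F_below; rewrite /= (lt_le_trans _ hy1)// gtrBl.
have [|c3 c30 h3] := @lower_bound_horizontal R Q (y2 + 1).
  by move=> th; apply: Fth_neq0_up; rewrite /= (le_lt_trans hy2)// ltrDl.
have [M M0 hM] := deriv_bound_strip Q (y1 - 1) (y2 + 1).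
set c := Num.min c1 (Num.min c2 c3).
have c0 : 0 < c by rewrite !lt_min c10 c20.
have y12 := y1_lt_y2.
have ydiff : y1 - 1 <= y2 + 1 by lra.
set N := n1 (tpi R)^-1 * (2 * (M * (2 / c)) * (6 + (y2 + 1 - (y1 - 1)))).
have N0 : 0 <= N.
  rewrite /N mulr_ge0 ?n1_ge0// !mulr_ge0 ?(ltW M0) ?invr_ge0 ?(ltW c0)//; lra.
exists N => // x0 s us.
(* The vertical sides lie in [x0 - 3, x0 - 2] and [x0 + 2, x0 + 3]: they enclose the window, and the
   width is at most the 6 appearing in N. *)
have [a /andP[a1 a2] ha] := h1 (x0 - 3); have [b /andP[b1 b2] hb] := h1 (x0 + 2).
have ab : a <= b by lra.
have Fb z : bdry a b (y1 - 1) (y2 + 1) z -> c <= n1 (F z).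
  case: z => x y [/andP[/= xab yab] h]; rewrite /c !ge_min; move: xab yab.
  case: h => -> xab yab; apply/orP.
  - by left; exact: ha.
  - by left; exact: hb.
  - by right; rewrite h2.
  - by right; rewrite h3 orbT.
have Fb0 z : bdry a b (y1 - 1) (y2 + 1) z -> F z != 0.
  by move=> /Fb h; apply: contraTneq h => ->; rewrite n1_0 -ltNge.
have [S [uS hS E]] := residue_F (g := fun=> 1) ab ydiff (fun z _ => chol_cst 1 z) Fb0.
pose T : nat := \sum_(z <- S) res_mult Q z.
have TE : \sum_(z <- S) (res_mult Q z)%:R * 1 = (T%:R : R)%:C.
  by rewrite /T natr_sum rmorph_sum /=; apply: eq_bigr => z _; rewrite mulr1 rmorph_nat.
have TN : T%:R <= N.
  have -> : (T%:R : R) = n1 (T%:R : R)%:C by rewrite n1C ger0_norm.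
  rewrite -TE -[X in n1 X](mulKf (tpi_neq0 R)) -E.
  apply: le_trans (n1M _ _) _; rewrite ler_wpM2l ?n1_ge0//.
  have sd : sides (fun z => 1 * (cderiv F z / F z)) a b (y1 - 1) (y2 + 1).
    apply: bdry_sides => // z /Fb0 hz; apply: chol_ccont.
    by apply: cholM; [exact: chol_cst|exact: chol_logderiv].
  apply: le_trans (n1_rint ab ydiff sd (M := M * (2 / c)) _) _.
    move=> z hz; rewrite mul1r; apply: logderiv_bound => //; first exact: Fb.
    by apply: hM; case: hz => /andP[].
  apply: ler_wpM2l; last by rewrite lerD2r; lra.
  by rewrite !mulr_ge0 ?(ltW M0) ?invr_ge0 ?(ltW c0).
apply: le_trans TN.
have -> : (T%:R : R) = \sum_(z <- S) (res_mult Q z)%:R by rewrite natr_sum.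
apply: (@le_trans _ _ (\sum_(z <- S) (res_mult Q z)%:R * (`|complex.Re z - x0| <= radius)%R%:R)).
  apply: ler_sum_support => // z zs.
  rewrite mulf_eq0 negb_or !pnatr_eq0 => /andP[m0 k0].
  have Fz : F z = 0 by apply/eqP; apply: contraNT m0 => /res_mult0 ->.
  have zr : `|complex.Re z - x0| <= radius by apply: contraNT k0 => /negbTE ->.
  apply/hS; split => //; have /andP[z1 z2] := F_zero_strip Fz.
  apply/andP; split; first exact: in_window (le_trans zr radius_le1) a2 b1.
  by rewrite !ltW// ?(lt_trans _ z1) ?(lt_trans z2)// ?gtrBl// ltrDl.
by apply: ler_sum => z _; rewrite ler_piMr// lern1 leq_b1.
Qed.

(** Each |g z| is at most K times the mass of g in the window around Re z, and by [count_zeros]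
    these windows overlap with total multiplicity at most N. *)
Lemma sum_res_bound : exists B : R, forall s : seq C, uniq s ->
  \sum_(z <- s) n1 ((res_mult Q z)%:R * g z) <= B.
Proof.
have [N N0 hN] := count_zeros.
exists (K * (N * fine (\int[mu]_u G u)%E)) => s us.
have Gf : (\int[mu]_u G u)%E \is a fin_num.
  by rewrite ge0_fin_numE//; apply: integral_ge0.
have h := @sum_smear_le R radius G mG G0 C s (res_mult Q) (@complex.Re R) N N0 (fun u => hN u s us).
have h' : \sum_(z <- s) (res_mult Q z)%:R * J (complex.Re z) <= N * fine (\int[mu]_u G u)%E.
  rewrite -lee_fin EFinM (fineK Gf); apply: le_trans h.
  rewrite -sumEFin le_eqVlt; apply/orP; left; apply/eqP; apply: eq_bigr => z _.
  by rewrite EFinM /J fineK.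
apply: (@le_trans _ _ (\sum_(z <- s) K * ((res_mult Q z)%:R * J (complex.Re z)))); last first.
  by rewrite -mulr_sumr ler_wpM2l.
apply: ler_sum => z _; rewrite mulrCA.
have -> : ((res_mult Q z)%:R : C) = ((res_mult Q z)%:R : R)%:C by rewrite rmorph_nat.
rewrite n1Cl ger0_norm//.
have [Fz|Fz] := eqVneq (F z) 0; last by rewrite res_mult0// !mul0r.
rewrite ler_wpM2l//; have /andP[z1 z2] := F_zero_strip Fz.
have hz : y1 <= complex.Im z <= y2 by rewrite !ltW.
by have := @g_le_J (complex.Re z) _ hz; case: (z).
Qed.

Lemma line_integrandE y x : F (x +i* y) != 0 ->
  line_integrand Q g y x = - (g (x +i* y) * (cderiv F (x +i* y) / F (x +i* y))).
Proof. by move=> h; rewrite /line_integrand trace_logderiv// mulrN. Qed.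

Lemma line_scont y : y1 <= y <= y2 -> (forall x, F (x +i* y) != 0) ->
  forall a b, scont a b (line_integrand Q g y).
Proof.
move=> hy hF a b.
have -> : line_integrand Q g y = (fun x => - (g (x +i* y) * (cderiv F (x +i* y) / F (x +i* y)))).
  by apply/funext => x; exact: line_integrandE.
apply: scontN.
apply: (hscont (f := fun z => g z * (cderiv F z / F z))) => x _; apply: chol_ccont.
by apply: cholM; [exact: chol_g|exact: chol_logderiv].
Qed.

(** The integrand is dominated by a constant times [J], which is integrable by [int_smear]. *)
Lemma line_defined y (c : R) : y1 <= y <= y2 -> 0 < c -> (forall x, c <= n1 (F (x +i* y))) ->
  line_integral_defined Q g y.
Proof.
move=> hy c0 hc.
have hF x : F (x +i* y) != 0.
  by have := hc x; apply: contraTneq => ->; rewrite n1_0 -ltNge.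
split; first by move=> x; rewrite F_neq0_unitmx.
have [M M0 hM] := deriv_bound_strip Q y y.
have B0 : 0 <= M * (2 / c) by rewrite !mulr_ge0 ?invr_ge0 ?(ltW M0) ?(ltW c0).
have hb x : n1 (line_integrand Q g y x) <= (K * (M * (2 / c))) * J x.
  rewrite line_integrandE// n1N mulrAC; apply: le_trans (n1M _ _) _.
  apply: ler_pM; rewrite ?n1_ge0//; first exact: g_le_J.
  by apply: logderiv_bound => //; apply: hM => /=; rewrite lexx.
have B1 : 0 <= K * (M * (2 / c)) by rewrite mulr_ge0.
have iJ : mu.-integrable setT (fun x => ((K * (M * (2 / c)))%:E * smear radius G x)%E).
  apply: integrableZl => //; apply/integrableP; split; first exact: measurable_smear.
  under eq_integral do rewrite gee0_abs ?smear_ge0//.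
  exact: int_smear.
have sc := line_scont hy hF.
have cont (p : C -> R) : (forall z, {for z, continuous (p : Cplx R -> R)}) ->
   (forall z, `|p z| <= n1 z) -> mu.-integrable setT (fun x => (p (line_integrand Q g y x))%:E).
  move=> cp hp; apply: (le_integrable measurableT _ _ iJ).
    apply/measurable_EFinP; apply: continuous_measurable_fun => x.
    have sx : {for x, continuous (line_integrand Q g y : R -> Cplx R)} by apply: (sc x x); rewrite lexx.
    exact: (@continuous_comp _ (Cplx R) R _ p x sx (cp _)).
  move=> x _; rewrite [leRHS]gee0_abs ?mule_ge0 ?lee_fin ?smear_ge0//.
  rewrite -(fineK (smear_fin_num x)) -EFinM lee_fin.
  exact: le_trans (hp _) (hb x).
split.
- by apply: (cont (@complex.Re R)) => [z|z]; [exact: Re_cont|exact: Re_le_n1].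
- by apply: (cont (@complex.Im R)) => [z|z]; [exact: Im_cont|exact: Im_le_n1].
Qed.

Lemma line1_defined : line_integral_defined Q g y1.
Proof.
move: hy1; rewrite le_eqVlt => /orP[/eqP/line1//|h].
have [|c c0 hc] := @lower_bound_horizontal R Q y1.
  by move=> th; apply: F_below.
by apply: (line_defined _ c0 hc); rewrite lexx ltW// y1_lt_y2.
Qed.

Lemma line2_defined : line_integral_defined Q g y2.
Proof.
move: hy2; rewrite le_eqVlt => /orP[/eqP/esym/line2//|h].
have [|c c0 hc] := @lower_bound_horizontal R Q y2.
  by move=> th; apply: Fth_neq0_up.
by apply: (line_defined _ c0 hc); rewrite lexx ltW// y1_lt_y2.
Qed.

Lemma J_cvg0 (x_ : nat -> R) : (forall n, n%:R <= `|x_ n|) ->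
  forall e : R, 0 < e -> exists m, forall n, (m <= n)%N -> J (x_ n) <= e.
Proof.
move=> hx e e0.
have hc : `|x_ k| @[k --> \oo] --> +oo.
  apply/cvgryPge => B; exists (Num.truncn `|B|).+1 => // k /= hk.
  apply: le_trans (ler_norm B) _; apply: le_trans (hx k).
  by apply: ltW; apply: lt_le_trans (truncnS_gt _) _; rewrite ler_nat.
have := @smear_cvg0 R radius G mG G0 Gfin x_ hc.
move=> /fine_cvg /cvgrPdist_le/(_ e e0)[m _ hm]; exists m => n /hm.
by rewrite /= sub0r normrN => h; apply: le_trans (ler_norm _) h.
Qed.

Lemma vertical_bound x c M : 0 < c -> 0 < M ->
  (forall y, y1 <= y <= y2 -> c <= n1 (F (x +i* y))) ->
  (forall z, y1 <= complex.Im z <= y2 -> n1 (cderiv F z) <= M) ->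
  n1 (cint y1 y2 (fun y => g (x +i* y) * (cderiv F (x +i* y) / F (x +i* y)))) <=
  (K * (M * (2 / c)) * (y2 - y1)) * J x.
Proof.
move=> c0 M0 hc hM; have y12 := ltW y1_lt_y2.
have -> : K * (M * (2 / c)) * (y2 - y1) * J x = (K * J x * (M * (2 / c))) * (y2 - y1) by ring.
apply: cint_bound => //.
  apply: (vscont (f := fun z => g z * (cderiv F z / F z))) => y hy; apply: chol_ccont.
  apply: cholM; first exact: chol_g.
  apply: chol_logderiv; have := hc y hy.
  by apply: contraTneq => ->; rewrite n1_0 -ltNge.
move=> y hy; apply: le_trans (n1M _ _) _; apply: ler_pM; rewrite ?n1_ge0 ?g_le_J//.
by apply: logderiv_bound => //; [exact: hc|exact: hM].
Qed.

(** Here t is 2 i pi, S the sum over a rectangle and X its limit, A1 and A2 truncated line integrals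
    with limits I1 and I2, Va and Vb the vertical sides. Five errors, hence e / 5. *)
Lemma limit_bound (t S X A1 A2 I1 I2 Va Vb : C) (e : R) : 0 < e ->
  t * S = - A1 - - A2 + 'i%C * (Vb - Va) -> n1 (S - X) <= e / 5 / (n1 t + 1) ->
  n1 (A1 - I1) <= e / 5 -> n1 (A2 - I2) <= e / 5 -> n1 Va <= e / 5 -> n1 Vb <= e / 5 ->
  n1 (t * X - - (I1 - I2)) <= e.
Proof.
move=> e_gt0 E k1 k2 k3 va vb.
have t0 : 0 < n1 t + 1 by rewrite ltr_wpDl// n1_ge0.
have e5 : 0 < e / 5 by rewrite divr_gt0.
have -> : t * X - - (I1 - I2) = - (t * (S - X)) - (A1 - I1) + (A2 - I2) + 'i%C * (Vb - Va).
  rewrite mulrBr E; ring.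
apply: le_trans (n1D _ _) _; rewrite n1i.
have q1 := n1D (- (t * (S - X)) - (A1 - I1)) (A2 - I2).
have q2 := n1B (- (t * (S - X))) (A1 - I1).
have q3 := n1B Vb Va.
have q4 : n1 (- (t * (S - X))) <= e / 5.
  rewrite n1N; apply: le_trans (n1M _ _) _.
  exact: ler_mul_div1 (n1_ge0 _) (ltW e5) k1.
lra.
Qed.

Lemma trace_formula :
  csummable (Res Q) (fun z => (res_mult Q z)%:R * g z) /\
  tpi R * csum (Res Q) (fun z => (res_mult Q z)%:R * g z) =
   - (cintegral (line_integrand Q g y1) - cintegral (line_integrand Q g y2)).
Proof.
have y12 := ltW y1_lt_y2.
have [c c0 hc] := lower_bound_vertical Q y1 y2.
have [M M0 hM] := deriv_bound_strip Q y1 y2.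
(* The constant c does not depend on n, so the vertical integrals tend to 0 through J alone. *)
have /choice[a_ ha] : forall n : nat, exists a : R, - n%:R - 1 <= a <= - n%:R /\
    forall y, y1 <= y <= y2 -> c <= n1 (F (a +i* y)).
  move=> n; have [a h1 h2] := hc (- n%:R - 1); exists a; split => //.
  by move: h1; rewrite subrK.
have /choice[b_ hb] : forall n : nat, exists b : R, n%:R <= b <= n%:R + 1 /\
    forall y, y1 <= y <= y2 -> c <= n1 (F (b +i* y)).
  by move=> n; have [b h1 h2] := hc n%:R; exists b.
have an n : a_ n <= - n%:R by have [/andP[]] := ha n.
have bn n : n%:R <= b_ n by have [/andP[]] := hb n.
have ab n : a_ n <= b_ n.
  by apply: le_trans (an n) _; apply: le_trans (bn n); have : 0 <= (n%:R : R) by []; lra.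
have Fb n z : bdry (a_ n) (b_ n) y1 y2 z -> F z != 0.
  case: z => x y [/andP[/= _ yab] h]; move: yab.
  have pos w : c <= n1 (F w) -> F w != 0.
    by apply: contraTneq => ->; rewrite n1_0 -ltNge.
  case: h => -> yab.
  - by apply: pos; exact: (ha n).2.
  - by apply: pos; exact: (hb n).2.
  - exact: F_line1.
  - exact: F_line2.
have hgr n z : rect (a_ n) (b_ n) y1 y2 z -> chol g z by move=> /andP[_ /chol_g].
have /choice[Z hZ] := fun n => residue_F (ab n) y12 (hgr n) (Fb n).
have uZ n : uniq (Z n) by have [] := hZ n.
have memZ n z : (z \in Z n) <-> (rect (a_ n) (b_ n) y1 y2 z /\ F z = 0) by have [_ h _] := hZ n.
have ZA n z : z \in Z n -> Res Q z by move=> /memZ[_ /Fth0_Res].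
have ZS n m : (n <= m)%N -> {subset Z n <= Z m}.
  rewrite leq_eqVlt => /orP[/eqP ->//|nm] z /memZ[hz Fz]; apply/memZ; split => //.
  (* The rectangles are nested: a_ m <= - m <= - n - 1 <= a_ n, and likewise on the right. *)
  have nm' : (n%:R + 1 : R) <= m%:R by rewrite natr1 ler_nat.
  apply: rectS hz => //.
    by have [/andP[h1 _] _] := ha n; have := an m; lra.
  by have [/andP[_ h1] _] := hb n; have := bn m; lra.
have [B hB] := sum_res_bound.
(* A term with non-zero weight comes from a zero of F, and such a zero enters the rectangles once n
   exceeds |Re z|. *)
have fZ z : Res Q z -> (res_mult Q z)%:R * g z != 0 -> exists n, z \in Z n.
  move=> _ h; have Fz : F z = 0.
    by apply/eqP; apply: contraNT h => /res_mult0 ->; rewrite mul0r.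
  exists (Num.truncn `|complex.Re z|).+1; apply/memZ; split => //.
  have := truncnS_gt `|complex.Re z|; set n := (Num.truncn _).+1; rewrite ltr_norml => /andP[x1 x2].
  have /andP[z1 z2] := F_zero_strip Fz.
  apply/andP; split; apply/andP; split; rewrite ?(ltW z1) ?(ltW z2)//.
    by apply: le_trans (an n) _; exact: ltW.
  by apply: le_trans (bn n); exact: ltW.
have [sm lim] := csum_exhaustion uZ ZA ZS fZ (fun n => hB (Z n) (uZ n)).
split => //.
have [_ i1] := line1_defined; have [_ i2] := line2_defined.
have e0 := n1_ge0 (tpi R).
apply/eqP; rewrite -subr_eq0; apply/eqP; apply: n1_eq0; apply/eqP; rewrite eq_le n1_ge0 andbT.
apply/ler_addgt0Pr => e e_gt0; rewrite add0r.
have t0 : 0 < n1 (tpi R) + 1 by rewrite ltr_wpDl.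
have e1 : 0 < e / 5 / (n1 (tpi R) + 1) by rewrite !divr_gt0.
have e5 : 0 < e / 5 by rewrite divr_gt0.
set V := K * (M * (2 / c)) * (y2 - y1).
have V0 : 0 <= V.
  rewrite /V mulr_ge0 ?subr_ge0// mulr_ge0//.
  by rewrite !mulr_ge0 ?(ltW M0) ?invr_ge0 ?(ltW c0).
have V1 : 0 < V + 1 by rewrite ltr_wpDl.
have eV : 0 < e / 5 / (V + 1) by rewrite divr_gt0.
have [m1 k1] := lim _ e1.
have [m2 k2] := cint_limit an bn i1 e5.
have [m3 k3] := cint_limit an bn i2 e5.
have [|m4 k4] := @J_cvg0 a_ _ _ eV.
  by move=> n; rewrite -normrN; apply: le_trans (ler_norm _); rewrite lerNr.
have [|m5 k5] := @J_cvg0 b_ _ _ eV.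
  by move=> n; apply: le_trans (ler_norm _).
set n := maxn m1 (maxn m2 (maxn m3 (maxn m4 m5))).
have [n1' n2' n3' n4' n5'] : [/\ (m1 <= n)%N, (m2 <= n)%N, (m3 <= n)%N, (m4 <= n)%N & (m5 <= n)%N].
  by rewrite /n !leq_max !leqnn ?orbT.
have {}k1 := k1 _ n1'; have {}k2 := k2 _ n2'; have {}k3 := k3 _ n3'.
have {}k4 := k4 _ n4'; have {}k5 := k5 _ n5'.
have [_ _ E] := hZ n.
pose f z := g z * (cderiv F z / F z).
have l1 : cint (a_ n) (b_ n) (fun x => f (x +i* y1)) = - cint (a_ n) (b_ n) (line_integrand Q g y1).
  rewrite -cintN; last by apply: line_scont; [rewrite lexx|exact: F_line1].
  by apply: cint_ext => x _; rewrite line_integrandE ?F_line1// opprK.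
have l2 : cint (a_ n) (b_ n) (fun x => f (x +i* y2)) = - cint (a_ n) (b_ n) (line_integrand Q g y2).
  rewrite -cintN; last by apply: line_scont; [rewrite lexx andbT|exact: F_line2].
  by apply: cint_ext => x _; rewrite line_integrandE ?F_line2// opprK.
have va := @vertical_bound (a_ n) c M c0 M0 (ha n).2 hM.
have vb := @vertical_bound (b_ n) c M c0 M0 (hb n).2 hM.
rewrite -/V in va vb.
have {}va := le_trans va (ler_mul_div1 V0 (ltW e5) k4).
have {}vb := le_trans vb (ler_mul_div1 V0 (ltW e5) k5).
rewrite /rint -/f l1 l2 in E.
exact: (limit_bound e_gt0 (esym E) k1 k2 k3 va vb).
Qed.

End TraceFormula.

Theorem theorem2 (R : realType) (D n0 : nat) (Lmin Lmax : R)
    (Q : quantum_graph R) (y1 y2 eps : R) (g : R[i] -> R[i]) :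
  (0 < D)%N -> (0 < n0)%N ->
  0 < Lmin -> Lmin <= Lmax ->
  bounded_data Q D n0 Lmin Lmax -> unbalanced Q ->
  y1 <= Y_bound D n0 Lmin -> 0 <= y2 -> 0 < eps ->
  holomorphic_on (strip (y1 - eps) (y2 + eps)) g ->
  L1_strip (y1 - eps) (y2 + eps) g ->
  (* only the two extreme lines can carry resonances *)
  (y1 = Y_bound D n0 Lmin -> line_integral_defined Q g y1) ->
  (y2 = 0 -> line_integral_defined Q g y2) ->
  [/\ csummable (Res Q) (fun z => (res_mult Q z)%:R * g z),
      line_integral_defined Q g y1,
      line_integral_defined Q g y2
    & 2%:R * 'i%C * pi%:C *
        csum (Res Q) (fun z => (res_mult Q z)%:R * g z)
      (* the lines bound a strip: the upper one is run from +oo to -oo *)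
      = - (cintegral (line_integrand Q g y1)
           - cintegral (line_integrand Q g y2))].
Proof.
move=> D0 n00 L0 _ bd unb hy1 hy2 eps0 hg Lg line1 line2.
have [sm E] := trace_formula D0 n00 L0 bd unb hy1 hy2 eps0 hg Lg line1 line2.
split => //.
- exact: (line1_defined D0 n00 L0 bd unb hy1 hy2 eps0 hg Lg line1).
- exact: (line2_defined D0 n00 L0 hy1 hy2 eps0 hg Lg line2).
Qed.
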